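(* Suppose that $-1<\alpha<p-2$ and let $\mu$ be a finite positive Borel measure on $[0,1)$. The operator $\mathcal H_\mu$ is well defined on $A^p_\alpha$ and it is a bounded operator from $A^p_\alpha$ to itself if and only if $\mu$ is a Carleson measure.
   Context: $\mathbb D$ is the open unit disc in $\mathbb C$ and $dA=\frac1\pi\,dx\,dy$ is normalized area measure on $\mathbb D$. For $0<p<\infty$ and $\alpha>-1$, the weighted Bergman space $A^p_\alpha$ consists of all analytic $f$ in $\mathbb D$ with $$\|f\|_{A^p_\alpha}=\left((\alpha+1)\int_{\mathbb D}(1-|z|^2)^\alpha|f(z)|^p\,dA(z)\right)^{1/p}<\infty.$$ For a finite positive Borel measure $\mu$ on $[0,1)$ and $n\ge 0$, let $\mu_n=\int_{[0,1)}t^n\,d\mu(t)$. For $f(z)=\sum_{k\ge0}a_kz^k$ analytic in $\mathbb D$, define formally $$\mathcal H_\mu f(z)=\sum_{n=0}^\infty\Big(\sum_{k=0}^\infty \mu_{n+k}a_k\Big)z^n,\quad z\in\mathbb D;$$ $\mathcal H_\mu f$ is well defined if the inner series converge and the resulting power series defines an analytic function in $\mathbb D$. $\mu$ is a Carleson measure if there is a constant $C>0$ such that $\mu([t,1))\le C(1-t)$ for all $0\le t<1$. The equivalence asserted is: ($\mathcal H_\mu$ is well defined on $A^p_\alpha$ and bounded from $A^p_\alpha$ to itself) if and only if ($\mu$ is a Carleson measure). *)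

(* Defs.v *)
From HB Require Import structures.
From mathcomp Require Import all_boot all_order all_algebra.
From mathcomp Require Import all_classical all_reals all_analysis.
From mathcomp Require Import complex.

Set Implicit Arguments.
Unset Strict Implicit.
Unset Printing Implicit Defensive.
Import Order.TTheory GRing.Theory Num.Theory.
Import numFieldNormedType.Exports.
Import Normc.

Local Open Scope classical_set_scope.
Local Open Scope ring_scope.

(* The complex numbers carry their norm topology through the regular module
   R[i]^o; [normc z : R] is the modulus as a real number, whereas [`|z|] has
   values in R[i]. *)

(* The unit disc, in the complex plane and in the real coordinates (x, y) that
   are used for area integrals. *)
Definition disc (R : realType) : set R[i]^o := [set z | normc z < 1].

Definition disc2 (R : realType) : set (R * R) :=
  [set w | disc (w.1 +i* w.2)%C].

(* Functions are total; only their values on the disc are relevant.  The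
   scalar field being R[i], [derivable f z 1] is complex differentiability. *)
Definition analytic_in_disc (R : realType) (f : R[i]^o -> R[i]^o) : Prop :=
  forall z, disc z -> derivable f z 1.

(* The weighted area integral is taken against dA = dx dy / pi. *)
Definition bergman_norm (R : realType) (p alpha : R) (f : R[i]^o -> R[i]^o) :
    \bar R :=
  poweR ((alpha + 1)%:E * ((pi^-1)%R%:E *
    \int[lebesgue_measure \x lebesgue_measure]_(w in @disc2 R)
      (powR (1 - normc (w.1 +i* w.2)%C ^+ 2) alpha
       * powR (normc (f (w.1 +i* w.2)%C)) p)%:E))%E p^-1.

Definition bergman (R : realType) (p alpha : R) (f : R[i]^o -> R[i]^o) : Prop :=
  analytic_in_disc f /\ (bergman_norm p alpha f < +oo)%E.

Definition power_series (R : realType) (a : nat -> R[i]^o) (z : R[i]^o) :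
    nat -> R[i]^o :=
  series (fun k => a k * z ^+ k).

(* f(z) = \sum_k a_k z^k on the disc. *)
Definition taylor_expansion (R : realType) (f : R[i]^o -> R[i]^o)
    (a : nat -> R[i]^o) : Prop :=
  forall z, disc z -> power_series a z @ \oo --> f z.

Section HilbertOperator.
Context {R : realType}.
Variable mu : {finite_measure set R -> \bar R}.

Definition moment (n : nat) : R := \int[mu]_(t in `[0, 1[) (t ^+ n).

Definition hilbert_inner (a : nat -> R[i]^o) (n : nat) : nat -> R[i]^o :=
  series (fun k => (moment (n + k))%:C%C * a k).

Definition hilbert_coef (a : nat -> R[i]^o) (n : nat) : R[i]^o :=
  limn (hilbert_inner a n).

(* [hilbert_op a] is the image of the function with Taylor coefficients [a];
   it is meaningful when [hilbert_well_defined a] holds. *)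
Definition hilbert_op (a : nat -> R[i]^o) (z : R[i]^o) : R[i]^o :=
  limn (power_series (hilbert_coef a) z).

Definition hilbert_well_defined (a : nat -> R[i]^o) : Prop :=
  [/\ forall n, cvgn (hilbert_inner a n),
      forall z, disc z -> cvgn (power_series (hilbert_coef a) z) &
      analytic_in_disc (hilbert_op a)].

(* The Taylor coefficients of f are the unique sequence [a] such that
   [taylor_expansion f a]. *)
Definition hilbert_well_defined_on_bergman (p alpha : R) : Prop :=
  forall f a, bergman p alpha f -> taylor_expansion f a ->
    hilbert_well_defined a.

Definition hilbert_bounded_on_bergman (p alpha : R) : Prop :=
  exists2 C : R, 0 <= C &
    forall f a, bergman p alpha f -> taylor_expansion f a ->
      bergman p alpha (hilbert_op a) /\
      (bergman_norm p alpha (hilbert_op a) <= C%:E * bergman_norm p alpha f)%E.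

Definition carleson : Prop :=
  exists2 C : R, 0 < C &
    forall t : R, 0 <= t < 1 -> (mu `[t, 1%R[%classic <= (C * (1 - t))%:E)%E.

End HilbertOperator.

(* Main.v *)
(* Put beta = (alpha + 2) / p, which lies in (0, 1), and let
   I(f) = int_D (1 - |w|^2)^alpha |f|^p, a constant multiple of ||f||^p.

   Sufficiency.  The sub-mean-value property gives |f(t)| <= x_j 2^(j beta) on
   the shell 2^(-j-1) <= 1 - t <= 2^-j, with sum_j x_j^p <= K I(f), and in
   particular |f(z)| <= G (1 - |z|)^-beta.  Hence the partial sums of the Taylor
   coefficients are O(k^b) for every b > beta; taking b < 1, Abel summation and
   the finiteness of int (1 - t)^-b dmu, which holds for Carleson measures, show
   that the inner series converge, uniformly in n, and that
   |H f(z)| <= 2 int |f(t)| / |1 - t z| dmu(t).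
   For |1 - z| comparable to 2^-i the right-hand side is at most a constant times
   sum_j x_j 2^(j beta) 2^-j 2^min(i,j), that is 2^(i beta) times the
   convolution of x with a geometric kernel.  Since
   int_(|1 - w| < rho) (1 - |w|^2)^alpha <= C rho^(alpha + 2), summing p-th powers
   over i gives I(H f) <= K' I(f).

   Necessity.  Apply the operator to f(z) = 1 / (1 - r z): the norm of H f is
   bounded by that of f, so the growth estimate at z = r gives
   |H f(r)| <= C / (1 - r), whereas H f(r) >= mu([r,1)) (1 - r^2)^-2 because the
   moments satisfy mu_n >= r^n mu([r,1)). *)

Require Import Defs.
From HB Require Import structures.
From mathcomp Require Import all_boot all_order all_algebra.
From mathcomp Require Import all_classical all_reals all_analysis.
From mathcomp Require Import complex.
From mathcomp Require Import measurable_realfun.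
From mathcomp Require Import ring lra zify.

Set Implicit Arguments.
Unset Strict Implicit.
Unset Printing Implicit Defensive.
Import Order.TTheory GRing.Theory Num.Theory.
Import numFieldNormedType.Exports.
Import Normc.

Local Open Scope classical_set_scope.
Local Open Scope ring_scope.

(** * Complex modulus and power series *)

(** Bounds on single coefficients are too weak for the inner series: moments of order 1 / k against
    |a_k| = O(k^b) give no absolute convergence. The partial sums are the coefficients of f(z) / (1
    - z); the division costs only a logarithm, the size of the mean of 1 / |1 - rho w| over the
    circle, and the gap between beta and b absorbs it. Circle means are taken over 2^m-th roots of
    unity, and area means come from integrating derivatives along horizontal and vertical sections,
    so polar coordinates never enter. The mean inequality for |f|^p follows from the one for |f| by
    the tangent inequality of x^p, available because p > alpha + 2 > 1. The condition alpha < p - 2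
    is beta < 1: the kernel convolved with x decays like 2^((beta - 1) (j - i)) for j > i and like
    2^(-beta (i - j)) for j < i. The same weight estimate yields the norm of 1 / (1 - r z), as the
    case of a sequence x carried by one shell. That norm is O((1 - r)^(beta - 1)), and multiplied by
    the growth factor (1 - r)^-beta it gives the C / (1 - r) of the necessity part. *)

Section ComplexModulus.
Variable R : realType.
Implicit Types x y z : R[i].

Lemma normcE z : `|z| = (normc z)%:C%C.
Proof. by case: z. Qed.

Lemma normc_ge0 z : 0 <= normc z.
Proof. by case: z => a b; rewrite sqrtr_ge0. Qed.

Lemma normcB x y : normc (x - y) = normc (y - x).
Proof. by rewrite -opprB; apply: (@normcN R). Qed.

Lemma ler_normcD x y : normc (x + y) <= normc x + normc y.
Proof. exact: (@le_normcD R). Qed.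

Lemma ler_normcB x y : normc (x - y) <= normc x + normc y.
Proof. by apply: le_trans (ler_normcD _ _) _; rewrite (@normcN R). Qed.

Lemma ler_distc_dist x y : normc x - normc y <= normc (x - y).
Proof. by rewrite lerBlDr; apply: le_trans (ler_normcD _ _); rewrite subrK. Qed.

Lemma normcX z n : normc (z ^+ n) = normc z ^+ n.
Proof. by elim: n => [|n IH]; rewrite ?expr0 ?normc1 // !exprS normcM IH. Qed.

Lemma normc_sum (I : Type) (r : seq I) (P : pred I) (F : I -> R[i]) :
  normc (\sum_(i <- r | P i) F i) <= \sum_(i <- r | P i) normc (F i).
Proof.
elim/big_rec2 : _ => [|i y1 y2 _ h]; first by rewrite normc0.
by apply: le_trans (ler_normcD _ _) _; rewrite lerD2l.
Qed.

Lemma normc_real (r : R) : normc (r%:C%C) = `|r|.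
Proof. by rewrite /= expr0n /= addr0 sqrtr_sqr. Qed.

Lemma normc_sqr z : normc z ^+ 2 = complex.Re z ^+ 2 + complex.Im z ^+ 2.
Proof. by case: z => a b /=; rewrite sqr_sqrtr // addr_ge0 ?sqr_ge0. Qed.

Lemma ler_Re_normc z : `|complex.Re z| <= normc z.
Proof.
rewrite -(@ler_pXn2r R 2) ?nnegrE ?normc_ge0// normc_sqr real_normK ?num_real//.
by rewrite lerDl sqr_ge0.
Qed.

Lemma ler_Im_normc z : `|complex.Im z| <= normc z.
Proof.
rewrite -(@ler_pXn2r R 2) ?nnegrE ?normc_ge0// normc_sqr real_normK ?num_real//.
by rewrite lerDr sqr_ge0.
Qed.

Lemma normc_le_ReIm z : normc z <= `|complex.Re z| + `|complex.Im z|.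
Proof.
rewrite -(@ler_pXn2r R 2) ?nnegrE ?normc_ge0// ?addr_ge0// normc_sqr.
rewrite sqrrD !real_normK ?num_real// addrAC lerDl.
by rewrite mulrn_wge0// mulr_ge0.
Qed.

(** The witness is the conjugate of z divided by |z|. It turns a bound on a modulus into a bound on
    the real part of a linear expression, which can be integrated as a real function. *)
Lemma normc_phase z :
  exists2 l, normc l = 1 & complex.Re (l * z) = normc z.
Proof.
have [->|z0] := eqVneq z 0.
  by exists 1; rewrite ?normc1// mulr0 normc0.
have nz : normc z != 0 by apply: contra z0 => /eqP/eq0_normc ->.
case: z z0 nz => a b z0 nz; set N := normc _ in nz *.
exists ((a / N) +i* (- (b / N)))%C; last first.
  have := normc_sqr (a +i* b)%C; rewrite -/N /= => h.
  transitivity ((a ^+ 2 + b ^+ 2) / N); first by rewrite /=; ring.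
  by rewrite -h expr2 mulfK.
have N0 : 0 <= N by exact: normc_ge0.
apply/eqP; rewrite -(@eqrXn2 _ 2)// ?normc_ge0// normc_sqr /=.
have := normc_sqr (a +i* b)%C; rewrite -/N /= => h.
by rewrite expr1n sqrrN !exprMn exprVn -mulrDl -h divff// expf_neq0.
Qed.

Lemma Re_sum (I : Type) (r : seq I) (P : pred I) (F : I -> R[i]) :
  complex.Re (\sum_(i <- r | P i) F i) = \sum_(i <- r | P i) complex.Re (F i).
Proof. by elim/big_rec2 : _ => [//|i y1 y2 _ <-]; case: (F i) y2 => ? ? []. Qed.

Lemma Re_mulr_real z (r : R) : complex.Re (z * r%:C%C) = complex.Re z * r.
Proof. by case: z => a b /=; rewrite mulr0 subr0. Qed.

Lemma cvgc_seqP (u : nat -> R[i]^o) (l : R[i]^o) :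
  u @ \oo --> l <->
  (forall e : R, 0 < e -> exists N, forall n, (N <= n)%N -> normc (l - u n) < e).
Proof.
split=> [/cvgrPdist_lt h e e0|h].
  have /h [N _ hN] : 0 < e%:C%C by rewrite ltcR.
  by exists N => n /hN /=; rewrite normcE ltcR.
(* A positive element of [R[i]] has zero imaginary part, so the radius is a real number in
   disguise. *)
apply/cvgrPdist_lt => -[e e'] /=; rewrite ltcE/= => /andP[/eqP -> e0].
have [N hN] := h _ e0; exists N => // n /= /hN hn.
by rewrite normcE ltcE /= eqxx.
Qed.

Lemma cvgr_seqP (u : nat -> R) (l : R) :
  u @ \oo --> l <->
  (forall e : R, 0 < e -> exists N, forall n, (N <= n)%N -> `|l - u n| < e).
Proof.
split=> [/cvgrPdist_lt h e e0|h].
  by have [N _ hN] := h _ e0; exists N => n /hN.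
by apply/cvgrPdist_lt => e /h[N hN]; exists N.
Qed.

Lemma cauchy_real (u : nat -> R) :
  (forall e : R, 0 < e -> exists N, forall n m, (N <= n)%N -> (N <= m)%N ->
     `|u n - u m| < e) -> exists l : R, u @ \oo --> l.
Proof.
move=> h; apply/cvg_ex/cauchy_cvgP/cauchyP => e /= e0.
have [N hN] := h _ e0; exists (u N); exists N => // n /= Nn.
by rewrite /ball /= hN.
Qed.

Lemma cvgc_cauchy (u : nat -> R[i]^o) :
  (forall e : R, 0 < e -> exists N, forall n m, (N <= n)%N -> (N <= m)%N ->
     normc (u n - u m) < e) -> exists l : R[i]^o, u @ \oo --> l.
Proof.
move=> h.
have ReB x y : complex.Re (x - y) = complex.Re x - complex.Re y.
  by case: x y => ? ? [].
have ImB x y : complex.Im (x - y) = complex.Im x - complex.Im y.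
  by case: x y => ? ? [].
have [a ha] : exists a : R, (fun n => complex.Re (u n)) @ \oo --> a.
  apply: cauchy_real => e /h[N hN]; exists N => n m Nn Nm.
  by rewrite -ReB; apply: le_lt_trans (ler_Re_normc _) (hN _ _ Nn Nm).
have [b hb] : exists b : R, (fun n => complex.Im (u n)) @ \oo --> b.
  apply: cauchy_real => e /h[N hN]; exists N => n m Nn Nm.
  by rewrite -ImB; apply: le_lt_trans (ler_Im_normc _) (hN _ _ Nn Nm).
exists (a +i* b)%C; apply/cvgc_seqP => e e0.
have e2 : 0 < e / 2 by rewrite divr_gt0.
have [N1 h1] := (cvgr_seqP _ _).1 ha _ e2.
have [N2 h2] := (cvgr_seqP _ _).1 hb _ e2.
exists (maxn N1 N2) => n; rewrite geq_max => /andP[/h1 {}h1 /h2 {}h2].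
apply: le_lt_trans (normc_le_ReIm _) _.
by rewrite ReB ImB /= [e]splitr ltrD.
Qed.

Lemma cvgc_le (u : nat -> R[i]^o) (l : R[i]^o) (M : R) :
  u @ \oo --> l -> (exists N, forall n, (N <= n)%N -> normc (u n) <= M) ->
  normc l <= M.
Proof.
move=> /cvgc_seqP ul [N hN]; apply/ler_addgt0Pr => e e0.
have [N' hN'] := ul _ e0.
have := hN _ (leq_maxl N N'); have := hN' _ (leq_maxr N N').
have := ler_distc_dist l (u (maxn N N')); lra.
Qed.

Lemma cvgcB (u : nat -> R[i]^o) (l c : R[i]^o) :
  u @ \oo --> l -> (fun n => u n - c : R[i]^o) @ \oo --> (l - c : R[i]^o).
Proof.
move=> /cvgc_seqP h; apply/cvgc_seqP => e /h[N hN]; exists N => n /hN.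
by congr (normc _ < _); ring.
Qed.

Lemma cvgcM (u : nat -> R[i]^o) (l c : R[i]^o) :
  u @ \oo --> l -> (fun n => c * u n : R[i]^o) @ \oo --> (c * l : R[i]^o).
Proof.
move=> /cvgc_seqP h; apply/cvgc_seqP => e e0.
have [|N hN] := h (e / (normc c + 1)).
  by rewrite divr_gt0// ltr_wpDl// normc_ge0.
exists N => n /hN; rewrite -mulrBr normcM ltr_pdivlMr ?ltr_wpDl ?normc_ge0//.
have := normc_ge0 (l - u n); nra.
Qed.

Lemma cvgcD (u v : nat -> R[i]^o) (l k : R[i]^o) :
  u @ \oo --> l -> v @ \oo --> k ->
  (fun n => u n + v n : R[i]^o) @ \oo --> (l + k : R[i]^o).
Proof.
move=> /cvgc_seqP hu /cvgc_seqP hv; apply/cvgc_seqP => e e0.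
have e2 : 0 < e / 2 by rewrite divr_gt0.
have [N1 h1] := hu _ e2; have [N2 h2] := hv _ e2.
exists (maxn N1 N2) => n; rewrite geq_max => /andP[/h1 {}h1 /h2 {}h2].
rewrite opprD addrACA; apply: le_lt_trans (ler_normcD _ _) _.
by rewrite [e]splitr ltrD.
Qed.

Lemma cvgc_uniq (u : nat -> R[i]^o) (l k : R[i]^o) :
  u @ \oo --> l -> u @ \oo --> k -> l = k.
Proof.
move=> ul uk; apply/eqP; rewrite -subr_eq0; apply/eqP/eq0_normc/eqP.
rewrite eq_le normc_ge0 andbT; apply/ler_addgt0Pr => e e0; rewrite add0r.
have e2 : 0 < e / 2 by rewrite divr_gt0.
have [N1 h1] := (cvgc_seqP _ _).1 ul _ e2.
have [N2 h2] := (cvgc_seqP _ _).1 uk _ e2.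
have := h1 _ (leq_maxl N1 N2); have := h2 _ (leq_maxr N1 N2).
set w := u _; have := ler_normcD (l - w) (w - k).
by rewrite (normcB k) addrA subrK; lra.
Qed.

Lemma cvgc_lim (u : nat -> R[i]^o) (l : R[i]^o) : u @ \oo --> l -> limn u = l.
Proof.
by move=> h; apply: (cvgc_uniq _ h); apply: (cvgP _ h).
Qed.

Lemma sum_geom_le (x : R) m n : 0 <= x -> x < 1 ->
  \sum_(m <= k < n) x ^+ k <= x ^+ m / (1 - x).
Proof.
move=> x0 x1; have h : 0 < 1 - x by rewrite subr_gt0.
rewrite ler_pdivlMr//.
have [mn|nm] := leqP m n; last first.
  by rewrite big_geq ?(ltnW nm)// mul0r exprn_ge0.
suff -> : (\sum_(m <= k < n) x ^+ k) * (1 - x) = x ^+ m - x ^+ n.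
  by rewrite lerBlDr lerDl exprn_ge0.
elim: n mn => [|n IH]; first by rewrite leqn0 => /eqP ->; rewrite big_geq// mul0r subrr.
rewrite leq_eqVlt => /orP[/eqP <-|]; first by rewrite big_geq// mul0r subrr.
by rewrite ltnS => mn; rewrite big_nat_recr//= mulrDl (IH mn) exprS; ring.
Qed.

Lemma expr_small (x : R) e : 0 <= x -> x < 1 -> 0 < e ->
  exists N, forall n, (N <= n)%N -> x ^+ n < e.
Proof.
move=> x0 x1 e0.
have /cvgr_seqP/(_ _ e0)[N hN] : (fun n => x ^+ n) @ \oo --> (0 : R).
  by apply: cvg_expr; rewrite ger0_norm.
by exists N => n /hN; rewrite sub0r normrN ger0_norm// exprn_ge0.
Qed.

Lemma power_seriesE (a : nat -> R[i]^o) z n :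
  power_series a z n = \sum_(0 <= k < n) a k * z ^+ k.
Proof. by []. Qed.

(** Convergence at one real point q with r < q < 1 bounds a_k q^k, and x = r / q is the geometric
    rate. It provides the uniform approximation of f by polynomials on smaller discs. *)
Lemma power_series_unif (f : R[i]^o -> R[i]^o) (a : nat -> R[i]^o) (r : R) :
  taylor_expansion f a -> 0 <= r -> r < 1 ->
  exists B x : R, [/\ 0 <= B, 0 <= x, x < 1,
    forall k, normc (a k) * r ^+ k <= B * x ^+ k &
    forall z n, normc z <= r -> normc (f z - power_series a z n) <= B * x ^+ n].
Proof.
move=> fa r0 r1.
pose q := (r + 1) / 2; have q0 : 0 < q by rewrite /q; lra.
have q1 : q < 1 by rewrite /q; lra.
have rq : r < q by rewrite /q; lra.
have [|M1 hM1] := (cvgc_seqP _ _).1 (fa (q%:C%C) _) 1 ltr01.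
  by rewrite /disc /= expr0n addr0 sqrtr_sqr gtr0_norm.
have hM n : (M1 <= n)%N -> normc (a n) * q ^+ n <= 2.
  move=> h; have h1 := hM1 _ h; have h2 := hM1 _ (leqW h).
  have -> : normc (a n) * q ^+ n = normc (a n * (q%:C%C) ^+ n).
    by rewrite normcM normcX normc_real gtr0_norm.
  (* A term is the difference of two consecutive remainders, each below 1 in modulus past [M1]. *)
  have -> : a n * (q%:C%C) ^+ n =
     (f (q%:C%C) - power_series a (q%:C%C) n) -
     (f (q%:C%C) - power_series a (q%:C%C) n.+1).
    by rewrite !power_seriesE big_nat_recr//=; ring.
  by apply: le_trans (ler_normcB _ _) _; lra.
pose A := 2 + \sum_(0 <= k < M1) normc (a k) * q ^+ k.
have A2 : 0 <= \sum_(0 <= k < M1) normc (a k) * q ^+ k.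
  by apply: sumr_ge0 => k _; rewrite mulr_ge0 ?normc_ge0 ?exprn_ge0 ?ltW.
have hA n : normc (a n) * q ^+ n <= A.
  have [/hM h|h] := leqP M1 n; first by rewrite /A; lra.
  rewrite /A (bigD1_seq n) ?mem_index_iota ?iota_uniq//=.
  rewrite addrCA lerDl addr_ge0// sumr_ge0// => k _.
  by rewrite mulr_ge0 ?normc_ge0 ?exprn_ge0 ?ltW.
pose x := r / q; have x0 : 0 <= x by rewrite divr_ge0// ltW.
have x1 : x < 1 by rewrite ltr_pdivrMr// mul1r.
have hak k : normc (a k) * r ^+ k <= A * x ^+ k.
  have -> : r ^+ k = q ^+ k * x ^+ k.
    by rewrite -exprMn /x mulrCA divff ?mulr1// gt_eqF.
  by rewrite mulrA ler_wpM2r// exprn_ge0.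
have x1' : 0 < 1 - x by rewrite subr_gt0.
exists (A / (1 - x)), x; split => //.
- by rewrite divr_ge0 ?ltW// /A; lra.
- move=> k; apply: le_trans (hak k) _; rewrite ler_wpM2r ?exprn_ge0//.
  rewrite ler_pdivlMr// ler_piMr//; first by rewrite /A; lra.
  by rewrite lerBlDr lerDl.
move=> z n zr.
have zd : disc z by apply: le_lt_trans zr r1.
have h := @cvgcB _ _ (power_series a z n) (fa z zd).
apply: (cvgc_le h).
exists n => m nm.
have -> : power_series a z m - power_series a z n =
    \sum_(n <= k < m) a k * z ^+ k :> R[i].
  by rewrite !power_seriesE (big_cat_nat (n := n))//= addrAC subrr add0r.
apply: le_trans (normc_sum _ _ _) _.
apply: (@le_trans _ _ (\sum_(n <= k < m) A * x ^+ k)).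
  apply: ler_sum => k _; rewrite normcM normcX; apply: le_trans (hak k).
  by rewrite ler_wpM2l ?normc_ge0// lerXn2r// nnegrE ?normc_ge0.
rewrite -mulr_sumr -mulrA [_^-1 * _]mulrC ler_wpM2l//; first by rewrite /A; lra.
exact: sum_geom_le.
Qed.

End ComplexModulus.

(** * Growth of the partial sums of the Taylor coefficients *)

Section RootsOfUnity.
Variable R : realType.
Implicit Types (z w : R[i]) (r : R).

(** Iterated square roots of -1: when w^(2^m) = -1, the order of w divides 2^(m+1) but not 2^m. The
    means below only need arbitrarily large orders. *)
Lemma pow2_prim_root m : exists w, (2 ^ m).-primitive_root w.
Proof.
case: m => [|m]; first by exists 1; apply/andP; split => //; apply/forallP => -[[|//] ?] /=; rewrite unity_rootE expr1 eqxx.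
pose w := iter m sqrtC (-1 : R[i]).
have hw : w ^+ (2 ^ m) = -1.
  rewrite /w; elim: m {w} => [|m IH] /=; first by rewrite expr1.
  by rewrite expnS exprM sqrtCK IH.
have hw2 : w ^+ (2 ^ m.+1) = 1 by rewrite expnSr exprM hw sqrrN expr1n.
have [|d hd] := prim_order_exists _ hw2; first by rewrite expn_gt0.
case/(dvdn_pfactor _ _ (isT : prime 2)) => k; rewrite leq_eqVlt => /orP[/eqP ->|].
  by move=> dE; exists w; rewrite -dE.
rewrite ltnS => km dE.
have : w ^+ (2 ^ m) = 1.
  by apply/eqP; rewrite -(prim_order_dvd hd) dE dvdn_exp2l.
rewrite hw => /eqP; rewrite eq_sym -subr_eq0 opprK -[1 + 1]/(2%:R) pnatr_eq0.
by [].
Qed.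

Lemma normc_unity_root M z : (0 < M)%N -> z ^+ M = 1 -> normc z = 1.
Proof.
move=> M0 zM; have : normc z ^+ M == 1 by rewrite -normcX zM normc1.
by rewrite pexprn_eq1 ?normc_ge0// gtn_eqF// => /eqP.
Qed.

Lemma sum_unity_root M z : z ^+ M = 1 -> z != 1 -> \sum_(j < M) z ^+ j = 0.
Proof.
move=> zM z1; have := subrX1 z M; rewrite zM subrr => /esym/eqP.
by rewrite mulf_eq0 subr_eq0 (negbTE z1) => /eqP.
Qed.

Lemma prim_root_orth M w (k l : nat) : M.-primitive_root w ->
  (k < M)%N -> (l < M)%N ->
  \sum_(j < M) (w ^+ j) ^+ k * ((w ^+ j) ^+ l)^-1 = (M * (k == l))%:R.
Proof.
move=> wM kM lM; have M0 := prim_order_gt0 wM.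
have w0 : w != 0 by rewrite (prim_root_eq0 wM) -lt0n.
have wj j : (w ^+ j) ^+ k * ((w ^+ j) ^+ l)^-1 = (w ^+ k / w ^+ l) ^+ j.
  by rewrite exprMn exprVn -!exprM (mulnC k) (mulnC l).
under eq_bigr do rewrite wj.
have [->|kl] := eqVneq k l.
  by rewrite divff ?expf_neq0//; under eq_bigr do rewrite expr1n;
     rewrite sumr_const card_ord muln1.
rewrite muln0; apply: sum_unity_root.
  by rewrite expr_div_n -!exprM ![(_ * M)%N]mulnC !exprM (prim_expr_order wM)
    !expr1n invr1 mulr1.
apply: contra kl => /eqP h.
have : w ^+ k == w ^+ l by rewrite -[w ^+ k](divfK (expf_neq0 l w0)) h mul1r.
by rewrite (eq_prim_root_expr wM) !modn_small.
Qed.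

(** Discrete Cauchy estimate: divide by w^(j K) and sum over j. Since n <= M, no two exponents agree
    modulo M and orthogonality isolates b_K. *)
Lemma coef_le_mean M w (b : nat -> R[i]) n (K : nat) : M.-primitive_root w ->
  (n <= M)%N -> (K < n)%N ->
  M%:R * normc (b K) <=
    \sum_(j < M) normc (\sum_(k < n) b k * (w ^+ j) ^+ k).
Proof.
move=> wM nM Kn; have M0 := prim_order_gt0 wM.
have nw j : normc (w ^+ j) = 1.
  by rewrite normcX (normc_unity_root M0 (prim_expr_order wM)) expr1n.
have -> : M%:R * normc (b K) = normc (\sum_(j < M)
     (\sum_(k < n) b k * (w ^+ j) ^+ k) * ((w ^+ j) ^+ K)^-1).
  under eq_bigr do rewrite mulr_suml.
  rewrite exchange_big/=.
  rewrite (eq_bigr (fun k : 'I_n => b k * (M * (val k == K))%:R)); last first.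
    move=> k _; rewrite -(prim_root_orth wM (leq_trans (ltn_ord k) nM) (leq_trans Kn nM)).
    by rewrite mulr_sumr; apply: eq_bigr => j _; rewrite mulrA.
  rewrite (bigD1 (Ordinal Kn))//= eqxx muln1 big1 ?addr0.
    rewrite normcM mulrC; congr (_ * _).
    by rewrite -(rmorph_nat (@real_complex R)) normc_real normr_nat.
  move=> k; rewrite -val_eqE /= => /negbTE ->.
  by rewrite muln0 mulr0.
apply: le_trans (normc_sum _ _ _) _; apply: ler_sum => j _.
by rewrite normcM normcV normcX nw expr1n invr1 mulr1.
Qed.

(** Parseval over the roots of unity for the truncated geometric sum. As w^M = 1, this sum at r w^j
    equals (1 - r^M) / (1 - r w^j), with the same numerator at every node; hence the factor (1 -
    r^M)^2. *)
Lemma mean_poisson_le M w r : M.-primitive_root w -> 0 <= r -> r < 1 ->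
  \sum_(j < M) (normc (1 - r%:C%C * w ^+ j) ^+ 2)^-1 <=
    M%:R / ((1 - r ^+ 2) * (1 - r ^+ M) ^+ 2).
Proof.
move=> wM r0 r1; have M0 := prim_order_gt0 wM.
have nw j : normc (w ^+ j) = 1.
  by rewrite normcX (normc_unity_root M0 (prim_expr_order wM)) expr1n.
have rM : r ^+ M < 1 by rewrite exprn_ilt1// -lt0n.
have r2 : r ^+ 2 < 1 by rewrite exprn_ilt1.
have e1 j : normc (\sum_(k < M) (r ^+ k)%:C%C * (w ^+ j) ^+ k) ^+ 2 =
    (1 - r ^+ M) ^+ 2 / normc (1 - r%:C%C * w ^+ j) ^+ 2.
  have -> : \sum_(k < M) (r ^+ k)%:C%C * (w ^+ j) ^+ k =
      \sum_(k < M) (r%:C%C * w ^+ j) ^+ k.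
    by apply: eq_bigr => k _; rewrite exprMn rmorphXn.
  have n0 : 0 < normc (1 - r%:C%C * w ^+ j).
    apply: lt_le_trans (ler_distc_dist _ _).
    by rewrite normc1 normcM nw normc_real mulr1 ger0_norm// subr_gt0.
  have := subrX1 (r%:C%C * w ^+ j) M.
  rewrite exprMn -exprM mulnC exprM (prim_expr_order wM) expr1n mulr1 => /(congr1 (@normc R)).
  rewrite normcM (normcB _ 1) (normcB _ 1) -rmorphXn -[1]/(1%:C%C) -rmorphB.
  rewrite normc_real ger0_norm ?subr_ge0 ?ltW// => ->.
  by rewrite exprMn mulrAC divff ?mul1r// expf_neq0// gt_eqF.
have h : \sum_(j < M) normc (\sum_(k < M) (r ^+ k)%:C%C * (w ^+ j) ^+ k) ^+ 2 =
    M%:R * \sum_(k < M) (r ^+ 2) ^+ k.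
  apply: complexI; rewrite rmorph_sum /=.
  under eq_bigr => j _.
    rewrite rmorphXn /= -normcE normCK rmorph_sum /= mulr_suml.
    over.
  rewrite (eq_bigr (fun j : 'I_M => \sum_(k < M) \sum_(l < M)
      (r ^+ k)%:C%C * (w ^+ j) ^+ k * ((r ^+ l)%:C%C * (w ^+ j) ^+ l)^*)); last first.
    by move=> j _; apply: eq_bigr => k _; rewrite mulr_sumr.
  rewrite exchange_big /= rmorphM /= rmorph_nat rmorph_sum mulr_sumr.
  apply: eq_bigr => k _; rewrite exchange_big /=.
  rewrite (eq_bigr (fun l : 'I_M => (r ^+ k * r ^+ l)%:C%C * (M * (val k == l))%:R)).
    rewrite (bigD1 k)//= eqxx muln1 big1 ?addr0.
      by rewrite -expr2 -exprM mulnC exprM mulrC.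
    by move=> l; rewrite eq_sym -val_eqE /= => /negbTE ->; rewrite muln0 mulr0.
  move=> l _; rewrite -(prim_root_orth wM (ltn_ord k) (ltn_ord l)) mulr_sumr; apply: eq_bigr => j _.
  have -> : ((r ^+ l)%:C%C * (w ^+ j) ^+ l)^* = (r ^+ l)%:C%C * ((w ^+ j) ^+ l)^*.
    rewrite rmorphM; congr (_ * _); exact: conjc_real.
  have -> : ((w ^+ j) ^+ l)^* = ((w ^+ j) ^+ l)^-1.
    have u1 : normc ((w ^+ j) ^+ l) = 1 by rewrite normcX nw expr1n.
    have u0 : (w ^+ j) ^+ l != 0.
      by apply/eqP => h0; move: u1; rewrite h0 normc0 => /esym/eqP; rewrite oner_eq0.
    by apply: (mulfI u0); rewrite divff// -normCK normcE u1 expr1n.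
  by rewrite rmorphM /=; ring.
have hs : \sum_(j < M) (normc (1 - r%:C%C * w ^+ j) ^+ 2)^-1 =
  M%:R * (\sum_(k < M) (r ^+ 2) ^+ k) / (1 - r ^+ M) ^+ 2.
  rewrite -h mulr_suml; apply: eq_bigr => j _; rewrite e1 mulrAC divff ?mul1r//.
  by rewrite expf_neq0// gt_eqF// subr_gt0.
have -> : M%:R / ((1 - r ^+ 2) * (1 - r ^+ M) ^+ 2) =
    M%:R / (1 - r ^+ 2) / (1 - r ^+ M) ^+ 2 by rewrite invfM mulrA.
rewrite hs; apply: ler_wpM2r; first by rewrite invr_ge0 sqr_ge0.
apply: ler_wpM2l; first exact: ler0n.
have := @sum_geom_le R (r ^+ 2) 0 M (sqr_ge0 _) r2.
by rewrite big_mkord expr0 mul1r.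
Qed.

End RootsOfUnity.

(** * Partial sums of the coefficients at dyadic scales *)

Section PartialSums.
Variable R : realType.

Local Notation half := (2^-1 : R).
Let rr (i : nat) : R := 1 - half ^+ i.

Lemma half_gt0 i : 0 < half ^+ i.
Proof. by rewrite exprn_gt0. Qed.

Lemma half_le1 i : half ^+ i <= 1.
Proof. by rewrite exprn_ile1//; lra. Qed.

Lemma halfS i : half ^+ i.+1 = half ^+ i / 2.
Proof. by rewrite exprSr. Qed.

(* The terms on the right are means of squares, which Parseval evaluates; this
   bounds the mean of the modulus of the Cauchy kernel by O(L). *)
Lemma inv_le_sum_poisson (w : R[i]) L : normc w = 1 ->
  (normc (1 - (rr L)%:C%C * w))^-1 <=
  8 * \sum_(i < L.+1) half ^+ i / normc (1 - (rr i)%:C%C * w) ^+ 2.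
Proof.
move=> nw; set v := normc (1 - (rr L)%:C%C * w).
have rr0 i : 0 <= rr i by rewrite subr_ge0 half_le1.
have vL : half ^+ L <= v.
  apply: le_trans (ler_distc_dist _ _).
  by rewrite normc1 normcM nw normc_real mulr1 ger0_norm// /rr; lra.
have v2 : v <= 2.
  apply: le_trans (ler_normcB _ _) _.
  rewrite normc1 normcM nw normc_real mulr1 ger0_norm// /rr.
  by have := half_gt0 L; lra.
have v0 : 0 < v by apply: lt_le_trans vL; exact: half_gt0.
(* The first scale with 2^-i <= v. There |1 - r_i w| <= 2 v, so the i-th term alone is at least a
   constant times 1 / v. For i = 0 the upper bound is v <= 2. *)
have [i [iL iv vi]] : exists i, [/\ (i <= L)%N, half ^+ i <= v & v <= 2 * half ^+ i].
  have ex : exists i, half ^+ i <= v by exists L.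
  case: (ex_minnP ex) => -[|i] hi hmin.
    by exists 0%N; split => //; rewrite expr0 mulr1.
  exists i.+1; split => //; first exact: hmin.
  rewrite halfS mulrCA divff ?mulr1//; rewrite leNgt; apply/negP => h.
  by have := hmin i (ltW h); rewrite ltnn.
have hi : normc (1 - (rr i)%:C%C * w) <= 2 * v.
  have -> : 1 - (rr i)%:C%C * w =
    (1 - (rr L)%:C%C * w) + (rr L - rr i)%:C%C * w.
    by rewrite [(rr L - rr i)%:C%C](rmorphB (real_complex R)) /=; ring.
  apply: le_trans (ler_normcD _ _) _; rewrite normcM nw normc_real mulr1 -/v.
  have -> : rr L - rr i = half ^+ i - half ^+ L by rewrite /rr; ring.
  rewrite ger0_norm; first by have := half_gt0 L; lra.
  by rewrite subr_ge0 ler_wiXn2l//; lra.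
have ni0 : 0 < normc (1 - (rr i)%:C%C * w).
  apply: lt_le_trans (ler_distc_dist _ _).
  rewrite normc1 normcM nw normc_real mulr1 ger0_norm// /rr.
  by have := half_gt0 i; lra.
apply: (@le_trans _ _ (8 * (half ^+ i / normc (1 - (rr i)%:C%C * w) ^+ 2))).
  apply: (@le_trans _ _ (8 * (half ^+ i / (2 * v) ^+ 2))); last first.
    rewrite ler_pM2l// ler_pM2l ?half_gt0// lef_pV2 ?posrE ?exprn_gt0//.
      by rewrite lerXn2r ?nnegrE ?normc_ge0// mulr_ge0// ltW.
    by rewrite mulr_gt0.
  rewrite -[leLHS]mul1r ler_pdivrMr//.
  have -> : 8 * (half ^+ i / (2 * v) ^+ 2) * v = 2 * half ^+ i / v.
    by field; rewrite gt_eqF.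
  by rewrite ler_pdivlMr// mul1r.
rewrite ler_pM2l// (bigD1 (Ordinal (iL : (i < L.+1)%N)))//= lerDl.
by rewrite sumr_ge0// => k _; rewrite mulr_ge0 ?invr_ge0 ?sqr_ge0 ?ltW ?half_gt0.
Qed.

(** Each of the L + 1 scales contributes at most 4 M: 1 - r_i^2 >= 2^-i cancels the weight of the
    scale, and the hypothesis on [rr L ^+ M] keeps (1 - r_i^M)^2 above 1 / 4. The factor L + 1 is
    the logarithm in the mean of the Cauchy kernel. *)
Lemma mean_inv_le (w : R[i]) M L : M.-primitive_root w ->
  rr L ^+ M <= half ->
  \sum_(j < M) (normc (1 - (rr L)%:C%C * w ^+ j))^-1 <= 32 * L.+1%:R * M%:R.
Proof.
move=> wM LM; have M0 := prim_order_gt0 wM.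
have nw j : normc (w ^+ j) = 1.
  by rewrite normcX (normc_unity_root M0 (prim_expr_order wM)) expr1n.
have rr0 i : 0 <= rr i by rewrite subr_ge0 half_le1.
have rr1 i : rr i < 1 by rewrite ltrBlDr ltrDl half_gt0.
apply: (@le_trans _ _ (\sum_(j < M) 8 * \sum_(i < L.+1)
   half ^+ i / normc (1 - (rr i)%:C%C * w ^+ j) ^+ 2)).
  by apply: ler_sum => j _; apply: inv_le_sum_poisson.
rewrite -mulr_sumr exchange_big /=.
apply: (@le_trans _ _ (8 * \sum_(i < L.+1) 4 * M%:R)); last first.
  by rewrite sumr_const card_ord -[_ *+ L.+1]mulr_natr; lra.
rewrite ler_pM2l//; apply: ler_sum => i _; rewrite -mulr_sumr.
apply: (@le_trans _ _ (half ^+ i * (M%:R / ((1 - rr i ^+ 2) * (1 - rr i ^+ M) ^+ 2)))).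
  by rewrite ler_pM2l ?half_gt0// mean_poisson_le.
have h1 : half ^+ i <= 1 - rr i ^+ 2.
  have := rr0 i; have := rr1 i; have -> : half ^+ i = 1 - rr i by rewrite /rr; ring.
  by rewrite expr2; nra.
have h2 : half <= 1 - rr i ^+ M.
  suff : rr i ^+ M <= half by lra.
  apply: le_trans LM; rewrite lerXn2r ?nnegrE//.
  by rewrite lerB// ler_wiXn2l//; [lra|rewrite -ltnS ltn_ord].
have h3 : half ^+ 2 <= (1 - rr i ^+ M) ^+ 2 by rewrite lerXn2r ?nnegrE//; lra.
set X := (1 - rr i ^+ M) ^+ 2 in h3 *.
have h10 := half_gt0 i; have h30 := half_gt0 2.
have p1 : 0 < 1 - rr i ^+ 2 by lra.
have p2 : 0 < X by lra.
rewrite mulrA ler_pdivrMr; last exact: mulr_gt0.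
rewrite -subr_ge0.
have -> : 4 * M%:R * ((1 - rr i ^+ 2) * X) - half ^+ i * M%:R =
  M%:R * ((1 - rr i ^+ 2) * X * 4 - half ^+ i) by ring.
apply: mulr_ge0; rewrite ?ler0n// subr_ge0.
have h3' : 1 <= X * 4 by move: h3; rewrite expr2; lra.
by rewrite -mulrA; apply: le_trans h1 _; rewrite ler_peMr// ltW.
Qed.

(** Induction by (1 - h / 2)^2 >= 1 - h, starting from equality at L = 1. It allows the factor rho^K
    to be removed from a coefficient as long as K < 2^L. *)
Lemma rr_exp_ge L : (0 < L)%N -> 4^-1 <= rr L ^+ (2 ^ L).
Proof.
case: L => // L _; elim: L => [|L IH].
  by rewrite /rr expn1 expr1 expr2; lra.
apply: le_trans IH _; rewrite [in leRHS]expnS exprM lerXn2r ?nnegrE ?sqr_ge0//.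
  by rewrite subr_ge0 half_le1.
rewrite /rr (halfS L.+1); move: (half ^+ L.+1) => h.
by rewrite expr2; have := sqr_ge0 h; rewrite expr2; lra.
Qed.

Variables (f : R[i]^o -> R[i]^o) (a : nat -> R[i]^o).
Hypothesis fa : taylor_expansion f a.

(* [S k * rho ^ k] is the [k]-th coefficient of [f (rho w) / (1 - rho w)], hence
   at most the mean of the modulus of that quotient over the circle. *)
Lemma partial_sum_le_dyadic (G beta : R) L K : 0 <= G ->
  (forall z, disc z -> normc (f z) <= G * (1 - normc z) `^ (- beta)) ->
  (0 < L)%N -> (K.+1 <= 2 ^ L)%N ->
  normc (\sum_(0 <= k < K.+1) a k) <=
    128 * L.+1%:R * (G * (half ^+ L) `^ (- beta) + 1).
Proof.
move=> G0 hG L0 KL; set rho := rr L.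
pose S k : R[i] := \sum_(0 <= i < k.+1) a i.
have rho0 : 0 <= rho by rewrite subr_ge0 half_le1.
have rho1 : rho < 1 by rewrite ltrBlDr ltrDl half_gt0.
have [B [x [B0 x0 x1 hB hf]]] := power_series_unif fa rho0 rho1.
have nr w : normc w = 1 -> normc (rho%:C%C * w) = rho.
  by move=> nw; rewrite normcM nw normc_real mulr1 ger0_norm.
(* Summation by parts: up to the truncation of f and a boundary term, the polynomial with
   coefficients S_k rho^k is f(rho w) / (1 - rho w). *)
have tel n w : (1 - rho%:C%C * w) * (\sum_(k < n.+1) (S k * (rho ^+ k)%:C%C) * w ^+ k) =
   power_series a (rho%:C%C * w) n.+1 - S n * (rho%:C%C * w) ^+ n.+1.
  rewrite power_seriesE -(big_mkord xpredT (fun k => S k * (rho ^+ k)%:C%C * w ^+ k)).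
  elim: n => [|n IH]; first by rewrite !big_nat1 /S big_nat1 !expr0 !expr1; ring.
  rewrite big_nat_recr//= mulrDr IH [in RHS]big_nat_recr//=.
  have -> : S n.+1 = S n + a n.+1 by rewrite /S big_nat_recr.
  by rewrite !rmorphXn /= !exprMn !exprS; ring.
(* Truncating at a large degree replaces f by a polynomial, so that the mean can
   be taken over finitely many roots of unity. *)
have [n [Kn hn]] : exists n, (K <= n)%N /\ forall w, normc w = 1 ->
   normc (power_series a (rho%:C%C * w) n.+1 - S n * (rho%:C%C * w) ^+ n.+1) <=
   G * (half ^+ L) `^ (- beta) + 1.
  pose q := (1 + rho) / 2; have q0 : 0 < q by rewrite /q; lra.
  have q1 : q < 1 by rewrite /q; lra.
  have rq : rho < q by rewrite /q; lra.
  have [B' [x' [B'0 x'0 x'1 hB' _]]] := power_series_unif fa (ltW q0) q1.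
  pose y := rho / q; have y0 : 0 <= y by rewrite divr_ge0// ltW.
  have y1 : y < 1 by rewrite ltr_pdivrMr// mul1r.
  have hS n : normc (S n) * rho ^+ n.+1 <= B' / (1 - x') * y ^+ n.
    apply: (@le_trans _ _ (normc (S n) * rho ^+ n)).
      by rewrite ler_wpM2l ?normc_ge0// exprS ler_piMl ?exprn_ge0// ltW.
    have -> : rho ^+ n = q ^+ n * y ^+ n.
      by rewrite -exprMn mulrCA divff ?mulr1// gt_eqF.
    rewrite mulrA ler_wpM2r ?exprn_ge0//.
    apply: (@le_trans _ _ (\sum_(0 <= i < n.+1) B' * x' ^+ i)).
      apply: le_trans (ler_wpM2r _ (normc_sum _ _ _)) _.
        by rewrite exprn_ge0// ltW.
      rewrite mulr_suml !big_mkord; apply: ler_sum => i _; apply: le_trans (hB' i).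
      by rewrite ler_wpM2l ?normc_ge0// ler_wiXn2l ?ltW// -ltnS.
    rewrite -mulr_sumr ler_wpM2l//; apply: le_trans (sum_geom_le _ _ x'0 x'1) _.
    by rewrite expr0 mul1r.
  have [|N1 hN1] := @expr_small R x (2 * (B + 1))^-1 x0 x1.
    by rewrite invr_gt0; lra.
  have T0 : 0 <= B' / (1 - x') by rewrite divr_ge0// subr_ge0 ltW.
  have [|N2 hN2] := @expr_small R y (2 * (B' / (1 - x') + 1))^-1 y0 y1.
    by rewrite invr_gt0; lra.
  pose n := maxn K (maxn N1 N2).
  have n1 := hN1 n.+1 (leq_trans (leq_trans (leq_maxl _ _) (leq_maxr K _)) (leqnSn _)).
  have n2 := hN2 n (leq_trans (leq_maxr N1 _) (leq_maxr K _)).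
  exists n; split; first exact: leq_maxl.
  move=> w nw; apply: le_trans (ler_normcB _ _) _.
  have small (C u : R) : 0 <= C -> u < (2 * (C + 1))^-1 -> C * u <= 2^-1.
    move=> C0; rewrite -[_^-1]mul1r ltr_pdivlMr; last by lra.
    by move=> h; nra.
  rewrite [normc (S n * _)]normcM normcX nr//.
  have e1 : normc (S n) * rho ^+ n.+1 <= 2^-1.
    by apply: le_trans (hS n) _; apply: small.
  have e2 : normc (f (rho%:C%C * w) - power_series a (rho%:C%C * w) n.+1) <= 2^-1.
    by apply: le_trans (hf _ _ _) _; [rewrite nr|apply: small].
  have e3 := hG (rho%:C%C * w); rewrite nr // in e3.
  have e4 : 1 - rho = half ^+ L by rewrite /rho /rr; ring.
  rewrite e4 in e3.
  have := ler_distc_dist (power_series a (rho%:C%C * w) n.+1) (f (rho%:C%C * w)).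
  rewrite normcB => e5.
  have := e3 _; rewrite /disc /= nr// => /(_ rho1); lra.
(* The number of nodes must exceed the degree, against aliasing, and be large enough for the
   hypothesis of [mean_inv_le]. *)
have [m [nm hm]] : exists m, (n.+1 <= 2 ^ m)%N /\ rho ^+ (2 ^ m) <= half.
  have [|N hN] := @expr_small R rho half rho0 rho1; first lra.
  exists (maxn N n.+1); split.
    by apply: leq_trans (ltnW (ltn_expl _ (isT : (1 < 2)%N))); rewrite leq_maxr.
  rewrite ltW// hN//; apply: leq_trans (ltnW (ltn_expl _ (isT : (1 < 2)%N))).
  by rewrite leq_maxl.
have [w wM] := pow2_prim_root R m.
have M0 := prim_order_gt0 wM.
have nw j : normc (w ^+ j) = 1.
  by rewrite normcX (normc_unity_root M0 (prim_expr_order wM)) expr1n.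
have := @coef_le_mean R _ w (fun k => S k * (rho ^+ k)%:C%C) n.+1 K wM nm Kn.
rewrite normcM normc_real ger0_norm ?exprn_ge0// => h1.
have h2 : \sum_(j < 2 ^ m) normc (\sum_(k < n.+1) S k * (rho ^+ k)%:C%C * (w ^+ j) ^+ k)
   <= (G * (half ^+ L) `^ (- beta) + 1) * (32 * L.+1%:R * (2 ^ m)%:R).
  apply: le_trans (ler_wpM2l _ (mean_inv_le wM hm)); last first.
    by rewrite addr_ge0// mulr_ge0// powR_ge0.
  rewrite mulr_sumr; apply: ler_sum => j _.
  have n0 : 0 < normc (1 - rho%:C%C * w ^+ j).
    apply: lt_le_trans (ler_distc_dist _ _).
    by rewrite normc1 nr// subr_gt0.
  by rewrite ler_pdivlMr// mulrC -normcM tel hn.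
have M0' : 0 < (2 ^ m)%:R :> R by rewrite ltr0n.
have h3 : normc (S K) * rho ^+ K <= 32 * L.+1%:R * (G * (half ^+ L) `^ (- beta) + 1).
  rewrite -(ler_pM2l M0'); apply: le_trans h1 _; apply: le_trans h2 _.
  by rewrite le_eqVlt; apply/orP; left; apply/eqP; ring.
(* Dividing by rho^K turns the constant 32 into 128. *)
have h4 : 4^-1 <= rho ^+ K.
  apply: le_trans (rr_exp_ge L0) _; rewrite ler_wiXn2l ?(ltW rho1)//.
  exact: ltnW.
have := ler_wpM2l (normc_ge0 (S K)) h4; rewrite -/(S K); lra.
Qed.

End PartialSums.

(** * Power bounds for the partial sums, and Abel summation *)

Section PartialSumsPower.
Variable R : realType.

(** With K < 2^L <= 2 K the dyadic bound is of size L 2^(L beta). The factor L is absorbed by 2^(L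
    (beta' - beta)) through exp x >= 1 + x, which is why the exponent has to be enlarged. *)
Lemma partial_sum_le (f : R[i]^o -> R[i]^o) (a : nat -> R[i]^o)
    (G beta beta' : R) : taylor_expansion f a -> 0 <= G -> 0 <= beta ->
  beta < beta' ->
  (forall z, disc z -> normc (f z) <= G * (1 - normc z) `^ (- beta)) ->
  exists2 A : R, 0 <= A &
    forall K, normc (\sum_(0 <= k < K) a k) <= A * K%:R `^ beta'.
Proof.
move=> fa G0 b0 bb' hG.
pose e := (beta' - beta) * ln 2.
have ln2 : 0 < ln 2 :> R by rewrite ln_gt0// ltr1n.
have e0 : 0 < e by rewrite mulr_gt0// subr_gt0.
have C0 : 0 <= 128 * (1 + e^-1) * (G + 1).
  by rewrite !mulr_ge0// addr_ge0// ltW// invr_gt0.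
exists (128 * (1 + e^-1) * (G + 1) * 2 `^ beta').
  by rewrite mulr_ge0 ?powR_ge0.
(* At K = 0 both sides vanish, because 0 raised to the positive power [beta'] is 0. *)
case=> [|K]; first by rewrite big_nil normc0 powR0 ?mulr0// gt_eqF//; lra.
pose L := (trunc_log 2 K.+1).+1.
have /andP[L1 L2] := trunc_log_bounds (isT : (1 < 2)%N) (isT : (0 < K.+1)%N).
have := partial_sum_le_dyadic fa G0 hG (isT : (0 < L)%N) (ltnW L2).
move=> /le_trans; apply.
pose N : R := 2 ^+ L.
have N1 : 1 <= N by rewrite exprn_ege1// ler1n.
have -> : (2^-1 ^+ L) `^ (- beta) = N `^ beta.
  by rewrite exprVn -powR_inv1 ?exprn_ge0// -powRrM mulN1r opprK.
have NE : N `^ (beta' - beta) = expR (e * L%:R).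
  have lnN : ln N = ln 2 * L%:R by rewrite /N lnXn// mulr_natr.
  rewrite /powR gt_eqF ?(lt_le_trans ltr01)// lnN /e.
  by congr expR; ring.
have L1N : L.+1%:R <= (1 + e^-1) * N `^ (beta' - beta).
  rewrite NE; apply: le_trans (ler_wpM2l _ (expR_ge1Dx _)); last first.
    by rewrite addr_ge0// ltW// invr_gt0.
  rewrite mulrDr mulr1 mulrDl mul1r mulKf ?gt_eqF//.
  rewrite -[L.+1]addn1 natrD; have := ler0n R L.
  have : 0 < e^-1 by rewrite invr_gt0.
  by have := mulr_ge0 (ltW e0) (ler0n R L); lra.
have Nb1 : 1 <= N `^ beta by rewrite -(powRr0 N) ler_powR.
have GN : G * N `^ beta + 1 <= (G + 1) * N `^ beta by lra.
have NK : N `^ beta' <= 2 `^ beta' * K.+1%:R `^ beta'.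
  rewrite -powRM// ge0_ler_powR ?nnegrE ?mulr_ge0 ?exprn_ge0//; first by lra.
  by rewrite /N exprS ler_pM2l// -natrX ler_nat.
apply: (@le_trans _ _ (128 * ((1 + e^-1) * N `^ (beta' - beta)) * ((G + 1) * N `^ beta))).
  by apply: ler_pM => //; rewrite ?mulr_ge0 ?addr_ge0 ?mulr_ge0 ?powR_ge0// ler_pM2l.
have -> : 128 * ((1 + e^-1) * N `^ (beta' - beta)) * ((G + 1) * N `^ beta) =
  128 * (1 + e^-1) * (G + 1) * (N `^ (beta' - beta) * N `^ beta) by ring.
rewrite -powRD; last by apply/implyP => _; rewrite gt_eqF// (lt_le_trans ltr01).
by rewrite subrK -[leRHS]mulrA ler_wpM2l.
Qed.

(* The factor [2 + K (1 - t)] makes [K |-> t ^+ K * (2 + K (1 - t))] telescope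
   against [(1 - t) * t ^+ k * (1 + (k + 1) (1 - t))]. *)
Definition abel_tail (b : R) (K : nat) (t : R) : R :=
  (1 - t) `^ (- b) * (t ^+ K * (2 + K%:R * (1 - t))).

Lemma abel_tail_ge0 b K (t : R) : 0 <= t < 1 -> 0 <= abel_tail b K t.
Proof.
move=> /andP[t0 t1]; rewrite mulr_ge0 ?powR_ge0// mulr_ge0 ?exprn_ge0//.
by rewrite addr_ge0// mulr_ge0// subr_ge0 ltW.
Qed.

Lemma abel_tail_nincr b K L (t : R) : 0 <= t < 1 -> (K <= L)%N ->
  abel_tail b L t <= abel_tail b K t.
Proof.
move=> /andP[t0 t1] KL; rewrite ler_wpM2l ?powR_ge0//.
elim: L KL => [|L IH]; first by rewrite leqn0 => /eqP ->.
rewrite leq_eqVlt => /orP[/eqP <- //|]; rewrite ltnS => /IH; apply: le_trans.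
rewrite exprS -[L.+1]addn1 natrD -mulrA mulrCA ler_wpM2l ?exprn_ge0//.
have := mulr_ge0 (ler0n R L) (sqr_ge0 (1 - t)); rewrite expr2.
by have := sqr_ge0 (1 - t); rewrite expr2; lra.
Qed.

Lemma powR_le_lin (b x : R) : 0 <= b -> b <= 1 -> 0 <= x -> x `^ b <= 1 + x.
Proof.
move=> b0 b1 x0; have [x1|x1] := leP 1 x.
  by apply: le_trans (ler1_powR x1 b1) _; lra.
have : x `^ b <= 1; last lra.
by have := @ge0_ler_powR R b b0 x 1; rewrite powR1; apply; rewrite ?nnegrE// ltW.
Qed.

(** Summation by parts leaves two boundary terms and one telescoping sum, each at most
    [A * abel_tail b K t], hence the 3. The power k^b is made linear by (k (1 - t))^b <= 1 + k (1 -
    t), at the price of (1 - t)^-b. *)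
Lemma abel_sum_le (a : nat -> R[i]) (A b : R) K L (t : R) :
  0 <= A -> 0 <= b -> b <= 1 ->
  (forall k, normc (\sum_(0 <= i < k) a i) <= A * k%:R `^ b) ->
  0 <= t < 1 -> (K <= L)%N ->
  normc (\sum_(K <= k < L) a k * (t ^+ k)%:C%C) <= 3 * A * abel_tail b K t.
Proof.
move=> A0 b0 b1 hA t01 KL; have /andP[t0 t1] := t01.
pose S k : R[i] := \sum_(0 <= i < k) a i.
have u0 : 0 < 1 - t by rewrite subr_gt0.
have abel : \sum_(K <= k < L) a k * (t ^+ k)%:C%C =
    S L * (t ^+ L)%:C%C - S K * (t ^+ K)%:C%C +
    \sum_(K <= k < L) S k.+1 * (t ^+ k - t ^+ k.+1)%:C%C.
  elim: L KL => [|L IH]; first by rewrite leqn0 => /eqP ->; rewrite !big_geq// subrr add0r.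
  rewrite leq_eqVlt => /orP[/eqP <-|]; first by rewrite !big_geq// subrr add0r.
  rewrite ltnS => KL; rewrite !big_nat_recr//= IH//.
  have -> : S L.+1 = S L + a L by rewrite /S big_nat_recr.
  by rewrite [(_ - _)%:C%C](rmorphB (real_complex R)) /=; ring.
have nb k : k%:R `^ b <= (1 - t) `^ (- b) * (1 + k%:R * (1 - t)).
  have -> : k%:R `^ b = (1 - t) `^ (- b) * (k%:R * (1 - t)) `^ b.
    rewrite powRM ?ler0n ?(ltW u0)// mulrCA -powRD; last by rewrite (gt_eqF u0) implybT.
    by rewrite addNr powRr0 mulr1.
  by rewrite ler_wpM2l ?powR_ge0// powR_le_lin// mulr_ge0// ltW.
have bd k : normc (S k) * t ^+ k <= A * abel_tail b k t.
  apply: (@le_trans _ _ (A * ((1 - t) `^ (- b) * (1 + k%:R * (1 - t))) * t ^+ k)).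
    rewrite ler_wpM2r ?exprn_ge0//; apply: le_trans (hA k) _.
    by rewrite ler_wpM2l.
  rewrite -!mulrA ler_wpM2l// ler_wpM2l ?powR_ge0// mulrC ler_wpM2l ?exprn_ge0//.
  by rewrite lerD2r ler1n.
have sm : normc (\sum_(K <= k < L) S k.+1 * (t ^+ k - t ^+ k.+1)%:C%C) <=
    A * abel_tail b K t.
  apply: le_trans (normc_sum _ _ _) _.
  pose h k := t ^+ k * (2 + k%:R * (1 - t)).
  apply: (@le_trans _ _ (\sum_(K <= k < L) A * ((1 - t) `^ (- b)) * (h k - h k.+1))).
    apply: ler_sum => k _; rewrite normcM normc_real.
    have -> : t ^+ k - t ^+ k.+1 = (1 - t) * t ^+ k by rewrite exprS; ring.
    have -> : h k - h k.+1 = (1 + k.+1%:R * (1 - t)) * ((1 - t) * t ^+ k).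
      by rewrite /h exprS -[k.+1]addn1 natrD; ring.
    have p0 : 0 <= (1 - t) * t ^+ k by rewrite mulr_ge0 ?exprn_ge0// ltW.
    rewrite (ger0_norm p0) [leRHS]mulrA; apply: ler_wpM2r => //.
    by apply: le_trans (hA _) _; rewrite -mulrA ler_wpM2l.
  rewrite -mulr_sumr -mulrA ler_wpM2l// ler_wpM2l ?powR_ge0//.
  have -> : \sum_(K <= k < L) (h k - h k.+1) = h K - h L.
    rewrite -[RHS]opprB -telescope_sumr// -sumrN; apply: eq_bigr => k _.
    by rewrite opprB.
  by rewrite lerBlDr lerDl mulr_ge0 ?exprn_ge0// addr_ge0// mulr_ge0// ltW.
rewrite abel; apply: le_trans (ler_normcD _ _) _.
apply: le_trans (lerD (ler_normcB _ _) sm) _.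
rewrite !normcM !normc_real !ger0_norm ?exprn_ge0//.
have := bd L; have := bd K; have := ler_wpM2l A0 (abel_tail_nincr b t01 KL).
lra.
Qed.

Lemma taylor_abel_tail (f : R[i]^o -> R[i]^o) (a : nat -> R[i]^o) (A b : R) K (t : R) :
  taylor_expansion f a -> 0 <= A -> 0 <= b -> b <= 1 ->
  (forall k, normc (\sum_(0 <= i < k) a i) <= A * k%:R `^ b) ->
  0 <= t < 1 ->
  normc (f (t%:C%C) - power_series a (t%:C%C) K) <= 3 * A * abel_tail b K t.
Proof.
move=> fa A0 b0 b1 hA t01.
have [z ez] : exists z : R[i]^o, z = t%:C%C by exists t%:C%C.
rewrite -ez; have td : disc z.
  case/andP: t01 => ? ?; rewrite ez /disc.
  by change (normc (t%:C%C) < 1); rewrite normc_real ger0_norm.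
have h := @cvgcB _ _ _ (power_series a z K) (fa _ td).
apply: (cvgc_le h); exists K => n Kn.
have -> : power_series a z n - power_series a z K =
    \sum_(K <= k < n) a k * (t ^+ k)%:C%C :> R[i].
  rewrite !power_seriesE (big_cat_nat (n := K))//= addrAC subrr add0r.
  by apply: eq_bigr => k _; rewrite ez rmorphXn.
exact: abel_sum_le.
Qed.

End PartialSumsPower.

(** * Mean value inequality for area integrals *)

Section ComplexMeasurable.
Context d (T : measurableType d) (R : realType).
Variable D : set T.
Implicit Types F G : T -> R[i].

Definition cmeasurable F :=
  measurable_fun D (fun x => complex.Re (F x)) /\
  measurable_fun D (fun x => complex.Im (F x)).

Lemma cmeasurable_cst c : cmeasurable (fun=> c).
Proof. by split; exact: measurable_cst. Qed.

Lemma cmeasurableD F G : cmeasurable F -> cmeasurable G ->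
  cmeasurable (fun x => F x + G x).
Proof.
move=> [F1 F2] [G1 G2]; split.
- rewrite (_ : (fun _ => _) =
    (fun x => complex.Re (F x)) \+ (fun x => complex.Re (G x))).
    exact: measurable_funD.
  by apply/funext => x /=; case: (F x) (G x) => ? ? [].
- rewrite (_ : (fun _ => _) =
    (fun x => complex.Im (F x)) \+ (fun x => complex.Im (G x))).
    exact: measurable_funD.
  by apply/funext => x /=; case: (F x) (G x) => ? ? [].
Qed.

Lemma cmeasurableM F G : cmeasurable F -> cmeasurable G ->
  cmeasurable (fun x => F x * G x).
Proof.
move=> [F1 F2] [G1 G2]; split.
- rewrite (_ : (fun _ => _) =
    ((fun x => complex.Re (F x)) \* (fun x => complex.Re (G x))) \-
    ((fun x => complex.Im (F x)) \* (fun x => complex.Im (G x)))).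
    by apply: measurable_funB; apply: measurable_funM.
  by apply/funext => x /=; case: (F x) (G x) => ? ? [].
- rewrite (_ : (fun _ => _) =
    ((fun x => complex.Re (F x)) \* (fun x => complex.Im (G x))) \+
    ((fun x => complex.Im (F x)) \* (fun x => complex.Re (G x)))).
    by apply: measurable_funD; apply: measurable_funM.
  by apply/funext => x /=; case: (F x) (G x) => ? ? [].
Qed.

Lemma cmeasurable_horner F (Q : {poly R[i]}) : cmeasurable F ->
  cmeasurable (fun x => Q.[F x]).
Proof.
move=> mF; elim/poly_ind: Q => [|Q c IH].
  rewrite (_ : (fun _ => _) = fun=> 0); first exact: cmeasurable_cst.
  by apply/funext => x; rewrite horner0.
rewrite (_ : (fun _ => _) = fun x => Q.[F x] * F x + c).
  by apply: cmeasurableD; [exact: cmeasurableM|exact: cmeasurable_cst].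
by apply/funext => x; rewrite !hornerE.
Qed.

Lemma cmeasurable_normc F : cmeasurable F ->
  measurable_fun D (fun x => normc (F x)).
Proof.
move=> [F1 F2].
rewrite (_ : (fun _ => _) =
   (@powR R ^~ (2^-1)) \o (fun x => complex.Re (F x) ^+ 2 + complex.Im (F x) ^+ 2)).
  apply: measurableT_comp; first exact: measurable_powR.
  by apply: measurable_funD; apply: measurable_funX.
apply/funext => x /=; rewrite powR12_sqrt ?addr_ge0 ?sqr_ge0//.
by case: (F x).
Qed.

Lemma measurable_normc_cvg (G : nat -> T -> R[i]) F : (forall n, cmeasurable (G n)) ->
  (forall x, D x -> (fun n => G n x : R[i]^o) @ \oo --> (F x : R[i]^o)) ->
  measurable_fun D (fun x => normc (F x)).
Proof.
move=> mG GF; apply: (@measurable_fun_cvg _ _ _ _ (fun n x => normc (G n x))).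
  by move=> n; exact: cmeasurable_normc.
move=> x /GF /cvgc_seqP h; apply/cvgr_seqP => e /h [N hN]; exists N => n /hN.
apply: le_lt_trans; rewrite ler_norml ler_distc_dist andbT.
by rewrite lerNl opprB (normcB (F x)) ler_distc_dist.
Qed.

End ComplexMeasurable.

Lemma power_series_horner (R : realType) (a : nat -> R[i]^o) z n :
  power_series a z n = (\poly_(k < n) a k).[z].
Proof.
by rewrite horner_poly power_seriesE big_mkord.
Qed.

(** * Polynomials in real coordinates and integration of derivatives *)

Section PolyPlane.
Variable R : realType.
Implicit Types (Q : {poly R[i]}) (x y : R).

Lemma Re_mulD (u v c : R[i]) : complex.Re (u * v + c) =
  complex.Re u * complex.Re v - complex.Im u * complex.Im v + complex.Re c.
Proof. by case: u v c => ? ? [? ?] []. Qed.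

Lemma Im_mulD (u v c : R[i]) : complex.Im (u * v + c) =
  complex.Re u * complex.Im v + complex.Im u * complex.Re v + complex.Im c.
Proof. by case: u v c => ? ? [? ?] []. Qed.

Lemma horner_MXaddC Q (c z : R[i]) : (Q * 'X + c%:P).[z] = Q.[z] * z + c.
Proof. by rewrite !hornerE. Qed.

Lemma deriv_MXaddC Q (c z : R[i]) :
  (Q * 'X + c%:P)^`().[z] = Q^`().[z] * z + Q.[z].
Proof. by rewrite derivMXaddC !hornerE addrC. Qed.

Lemma horner_bounded Q (rho : R) :
  exists2 B, 0 <= B & forall w, normc w <= rho -> normc Q.[w] <= B.
Proof.
elim/poly_ind: Q => [|Q c [B B0 IH]].
  by exists 0 => // w _; rewrite horner0 normc0.
exists (B * Num.max 0 rho + normc c).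
  by apply: addr_ge0; [apply: mulr_ge0 => //; rewrite le_max lexx|exact: normc_ge0].
move=> w wr; rewrite !hornerE.
apply: le_trans (ler_normcD _ _) _; rewrite lerD2r normcM.
by apply: ler_pM; rewrite ?normc_ge0 ?IH// le_max wr orbT.
Qed.

Let leibniz_Im (a b u d s t : R) :
  a * 0 + t * b + (u * 1 + s * d) + 0 = b * t + d * s + u.
Proof. by rewrite mulr0 add0r mulr1 addr0 (mulrC t) (mulrC s) (addrC u) addrA. Qed.

Let leibniz_Re (a b u d s t : R) :
  a * 1 + t * - d + (u * 0 + s * b) + 0 = b * s - d * t + a.
Proof.
by rewrite mulr0 add0r mulr1 addr0 mulrN (mulrC t) (mulrC s) addrAC [RHS]addrC addrA.
Qed.

Lemma is_derive_horner_x Q x y :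
  is_derive x 1 (fun s : R => complex.Re Q.[(s +i* y)%C]) (complex.Re Q^`().[(x +i* y)%C]) /\
  is_derive x 1 (fun s : R => complex.Im Q.[(s +i* y)%C]) (complex.Im Q^`().[(x +i* y)%C]).
Proof.
elim/poly_ind: Q => [|Q c [IH1 IH2]].
  have r0 (p : R[i] -> R) : p 0 = 0 -> (fun s : R => p (0 : {poly R[i]}).[(s +i* y)%C]) = cst 0.
    by move=> p0; apply/funext => s; rewrite horner0 p0.
  rewrite deriv0 horner0 ?oppr0; split; rewrite r0//; exact: is_derive_cst.
split.
- rewrite (_ : (fun _ => _) = (fun s => complex.Re Q.[(s +i* y)%C]) * id
     - (fun s => complex.Im Q.[(s +i* y)%C]) * cst y + cst (complex.Re c)); last first.
    by apply/funext => s; rewrite horner_MXaddC ?Re_mulD ?Im_mulD.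
  apply: is_derive_eq; rewrite deriv_MXaddC ?Re_mulD ?Im_mulD.
  have key (a b u d s t : R) : a * 1 + s * b - (u * 0 + t * d) + 0 = b * s - d * t + a.
    by rewrite !(mulr0, mulr1, add0r, addr0); ring.
  exact: key.
- rewrite (_ : (fun _ => _) = (fun s => complex.Re Q.[(s +i* y)%C]) * cst y
     + (fun s => complex.Im Q.[(s +i* y)%C]) * id + cst (complex.Im c)); last first.
    by apply/funext => s; rewrite horner_MXaddC ?Re_mulD ?Im_mulD.
  apply: (is_derive_eq (is_deriveD (is_deriveD (is_deriveM IH1 (is_derive_cst y x 1))
    (is_deriveM IH2 (is_derive_id x 1))) (is_derive_cst (complex.Im c) x 1))).
  by rewrite deriv_MXaddC Im_mulD; exact: leibniz_Im.
Qed.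

(** Differentiating in y multiplies the complex derivative by i, which exchanges real and imaginary
    parts with a sign. Together with the lemma in x these are the Cauchy-Riemann equations, by
    induction on the Horner form. *)
Lemma is_derive_horner_y Q x y :
  is_derive y 1 (fun s : R => complex.Re Q.[(x +i* s)%C]) (- complex.Im Q^`().[(x +i* y)%C]) /\
  is_derive y 1 (fun s : R => complex.Im Q.[(x +i* s)%C]) (complex.Re Q^`().[(x +i* y)%C]).
Proof.
elim/poly_ind: Q => [|Q c [IH1 IH2]].
  have r0 (p : R[i] -> R) : p 0 = 0 -> (fun s : R => p (0 : {poly R[i]}).[(x +i* s)%C]) = cst 0.
    by move=> p0; apply/funext => s; rewrite horner0 p0.
  rewrite deriv0 horner0 ?oppr0; split; rewrite r0//; exact: is_derive_cst.
split.
- rewrite (_ : (fun _ => _) = (fun s => complex.Re Q.[(x +i* s)%C]) * cst x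
     - (fun s => complex.Im Q.[(x +i* s)%C]) * id + cst (complex.Re c)); last first.
    by apply/funext => s; rewrite horner_MXaddC ?Re_mulD ?Im_mulD.
  apply: is_derive_eq; rewrite deriv_MXaddC ?Re_mulD ?Im_mulD.
  have key (a b u d s t : R) : a * 0 + s * - d - (u * 1 + t * b) + 0 = - (b * t + d * s + u).
    by rewrite !(mulr0, mulr1, add0r, addr0); ring.
  exact: key.
- rewrite (_ : (fun _ => _) = (fun s => complex.Re Q.[(x +i* s)%C]) * id
     + (fun s => complex.Im Q.[(x +i* s)%C]) * cst x + cst (complex.Im c)); last first.
    by apply/funext => s; rewrite horner_MXaddC ?Re_mulD ?Im_mulD.
  apply: (is_derive_eq (is_deriveD (is_deriveD (is_deriveM IH1 (is_derive_id y 1))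
    (is_deriveM IH2 (is_derive_cst x y 1))) (is_derive_cst (complex.Im c) y 1))).
  by rewrite deriv_MXaddC Re_mulD; exact: leibniz_Re.
Qed.

Lemma integral_derive_itvoo0 (F f : R -> R) a b : a < b ->
  (forall x, is_derive x 1 F (f x)) -> (forall x, derivable f x 1) ->
  F a = 0 -> F b = 0 ->
  (\int[lebesgue_measure]_(x in `]a, b[) (f x)%:E = 0)%E.
Proof.
move=> ab dF df Fa Fb.
have cf : continuous f by move=> x; apply/differentiable_continuous/derivable1_diffP.
have cF : continuous F.
  by move=> x; apply/differentiable_continuous/derivable1_diffP/(@ex_derive _ _ _ _ _ _ _ (dF x)).
have mf A : measurable_fun A (EFin \o f).
  by apply: measurable_funTS; apply/measurable_EFinP; exact: continuous_measurable_fun.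
rewrite integral_itv_bndo_bndc; last exact: mf.
rewrite integral_itv_obnd_cbnd; last exact: mf.
rewrite (@continuous_FTC2 _ _ F)//.
- by rewrite Fa Fb subee.
- by apply: continuous_subspaceT => x; exact: cf.
- split.
  + by move=> x _; exact: (@ex_derive _ _ _ _ _ _ _ (dF x)).
  + by apply: cvg_at_right_filter; exact: cF.
  + by apply: cvg_at_left_filter; exact: cF.
- by move=> x _; rewrite derive1E; exact: (@derive_val _ _ _ _ _ _ _ (dF x)).
Qed.

End PolyPlane.

Section SectionsIntegral0.
Context d1 d2 (T1 : measurableType d1) (T2 : measurableType d2) (R : realType).
Variables (m1 : {sigma_finite_measure set T1 -> \bar R})
  (m2 : {sigma_finite_measure set T2 -> \bar R}).
Variables (D : set (T1 * T2)) (g : T1 * T2 -> R).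
Hypothesis mD : measurable D.
Hypothesis ig : (m1 \x m2)%E.-integrable D (EFin \o g).

Lemma integral_ysections0 :
  (forall y, \int[m1]_(x in [set x | D (x, y)]) (g (x, y))%:E = 0)%E ->
  (\int[(m1 \x m2)%E]_(w in D) (g w)%:E = 0)%E.
Proof.
move=> h; rewrite integral_mkcond -integral21_prod_meas1; last first.
  by rewrite -integrable_mkcond.
by apply: integral0_eq => y _; rewrite /fubini_G -[RHS](h y) [RHS]integral_mkcond.
Qed.

Lemma integral_xsections0 :
  (forall x, \int[m2]_(y in [set y | D (x, y)]) (g (x, y))%:E = 0)%E ->
  (\int[(m1 \x m2)%E]_(w in D) (g w)%:E = 0)%E.
Proof.
move=> h; rewrite integral_mkcond -integral12_prod_meas1; last first.
  by rewrite -integrable_mkcond.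
by apply: integral0_eq => y _; rewrite /fubini_F -[RHS](h y) [RHS]integral_mkcond.
Qed.

Lemma integral_lincomb0 (h : T1 * T2 -> R) (a b : R) :
  (m1 \x m2)%E.-integrable D (EFin \o h) ->
  (\int[(m1 \x m2)%E]_(w in D) (g w)%:E = 0)%E ->
  (\int[(m1 \x m2)%E]_(w in D) (h w)%:E = 0)%E ->
  (\int[(m1 \x m2)%E]_(w in D) (a * g w + b * h w)%:E = 0)%E.
Proof.
move=> ih g0 h0; under eq_integral do rewrite EFinD !EFinM.
rewrite integralD//; [|exact: integrableZl|exact: integrableZl].
by rewrite !integralZl//= g0 h0 !mule0 adde0.
Qed.

End SectionsIntegral0.

Notation plane R := (measurableTypeR R * measurableTypeR R)%type.

(** * Weighted mean value property on a disc *)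

Section MeanValue.
Variable R : realType.
Local Notation leb2 := (@lebesgue_measure R \x @lebesgue_measure R)%E.

Definition cpt (w : plane R) : R[i] := ((w.1 : R) +i* (w.2 : R))%C.

Lemma cmeasurable_cpt (D : set (plane R)) : cmeasurable D cpt.
Proof.
by split; apply: measurable_funTS; [exact: measurable_fst|exact: measurable_snd].
Qed.

Variables (c1 c2 r : R).
Hypothesis r0 : 0 < r.

(** Positive inside the disc and zero on the circle, so that a multiple of [bump ^+ 2] has no
    boundary contribution on any section. With this weight the mean value property follows from
    Fubini in Cartesian coordinates. *)
Definition bump (w : plane R) : R :=
  r ^+ 2 - ((w.1 : R) - c1) ^+ 2 - ((w.2 : R) - c2) ^+ 2.
Definition pdisc : set (plane R) := [set w | 0 < bump w].

Lemma bumpE w : bump w = r ^+ 2 - normc (cpt w - (c1 +i* c2)%C) ^+ 2.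
Proof. by rewrite normc_sqr /= /bump opprD addrA. Qed.

Lemma pdiscP w : pdisc w <-> normc (cpt w - (c1 +i* c2)%C) < r.
Proof.
rewrite /pdisc /= bumpE subr_gt0 ltr_pXn2r// ?nnegrE ?normc_ge0// ltW//.
Qed.

Lemma measurable_bump D : measurable_fun D bump.
Proof.
apply: measurable_funTS; rewrite /bump.
by apply: measurable_funB; [apply: measurable_funB|]; [exact: measurable_cst|..];
  apply: measurable_funX; apply: measurable_funB => //; exact: measurable_cst.
Qed.

Lemma measurable_pdisc : measurable pdisc.
Proof.
rewrite (_ : pdisc = bump @^-1` `]0, +oo[).
  by rewrite -[X in measurable X]setTI; exact: measurable_bump.
by apply/seteqP; split=> w; rewrite /pdisc /= in_itv /= andbT.
Qed.

Lemma bump_le w : bump w <= r ^+ 2.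
Proof. by rewrite bumpE lerBlDr lerDl sqr_ge0. Qed.

Lemma pdisc_rect w : pdisc w ->
  w \in `[c1 - r, c1 + r]%classic `*` `[c2 - r, c2 + r]%classic.
Proof.
move=> /pdiscP h; rewrite inE; split; rewrite /= in_itv /= -ler_distl.
  exact: le_trans (ler_Re_normc (cpt w - (c1 +i* c2)%C)) (ltW h).
exact: le_trans (ler_Im_normc (cpt w - (c1 +i* c2)%C)) (ltW h).
Qed.

Lemma leb2_pdisc_lty : (leb2 pdisc < +oo)%E.
Proof.
apply: (@le_lt_trans _ _ (leb2 (`[c1 - r, c1 + r]%classic `*` `[c2 - r, c2 + r]%classic))).
  apply: le_measure; rewrite ?inE.
  - exact: measurable_pdisc.
  - by apply: measurableX.
  - by move=> w /pdisc_rect; rewrite inE.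
rewrite product_measure1E; [|exact: measurable_itv|exact: measurable_itv].
have h (a : R) : (@lebesgue_measure R `[(a - r)%R, (a + r)%R]%classic < +oo)%E.
  by rewrite lebesgue_measure_itv /=; case: ifP => _; rewrite -?EFinB ltry.
apply: lte_mul_pinfty => //; last exact: (h c2).
by rewrite ge0_fin_numE//; exact: (h c1).
Qed.

Lemma integrable_pdisc (g : plane R -> R) B : measurable_fun pdisc g ->
  (forall w, pdisc w -> `|g w| <= B) -> leb2.-integrable pdisc (EFin \o g).
Proof.
move=> mg gB; apply: measurable_bounded_integrable => //.
- exact: measurable_pdisc.
- exact: leb2_pdisc_lty.
- exists B; split; first exact: num_real.
  by move=> M BM w /= wD; apply: le_trans (gB _ wD) (ltW BM).
Qed.

Lemma section_itv (c t : R) :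
  [set s : R | 0 < r ^+ 2 - (s - c) ^+ 2 - t] =
  if t < r ^+ 2 then `]c - Num.sqrt (r ^+ 2 - t), c + Num.sqrt (r ^+ 2 - t)[%classic
  else set0.
Proof.
case: ltP => tr; last first.
  by apply/seteqP; split => s //=; have := sqr_ge0 (s - c); lra.
have h : 0 <= r ^+ 2 - t by rewrite subr_ge0 ltW.
apply/seteqP; split => s /=; rewrite in_itv /= -ltr_distl.
  move=> hs; rewrite -(@ltr_pXn2r _ 2)// ?nnegrE ?sqrtr_ge0//.
  by rewrite sqr_sqrtr// real_normK ?num_real//; lra.
rewrite -(@ltr_pXn2r _ 2)// ?nnegrE ?sqrtr_ge0//.
by rewrite sqr_sqrtr// real_normK ?num_real//; lra.
Qed.

Section Green.
Variable Q : {poly R[i]}.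
Local Notation Q' := (Q^`()).

(* The x-derivative of [bump ^ 2 * Re Q] and the y-derivative of
   [bump ^ 2 * Im Q]; by the Cauchy-Riemann equations their difference is
   [- 4 * bump * Re ((w - c) * Q)]. *)
Let gx (w : plane R) : R := (bump w * (- 4 * ((w.1 : R) - c1))) * complex.Re Q.[cpt w]
  + bump w ^+ 2 * complex.Re Q'.[cpt w].
Let gy (w : plane R) : R := (bump w * (- 4 * ((w.2 : R) - c2))) * complex.Im Q.[cpt w]
  + bump w ^+ 2 * complex.Re Q'.[cpt w].

Let pdisc_disc w : pdisc w -> normc (cpt w) <= normc ((c1 +i* c2)%C : R[i]) + r.
Proof.
move=> /pdiscP h; have := ler_distc_dist (cpt w) (c1 +i* c2)%C; lra.
Qed.

Let bump_norm w : pdisc w -> `|bump w| <= r ^+ 2.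
Proof. by move=> h; rewrite gtr0_norm// bump_le. Qed.

Let mcoord1 : measurable_fun setT (fun w : plane R => (w.1 : R) - c1).
Proof. by apply: measurable_funB => //; exact: measurable_cst. Qed.

Let mcoord2 : measurable_fun setT (fun w : plane R => (w.2 : R) - c2).
Proof. by apply: measurable_funB => //; exact: measurable_cst. Qed.

Let igx : leb2.-integrable pdisc (EFin \o gx).
Proof.
have [B B0 hB] := horner_bounded Q (normc ((c1 +i* c2)%C : R[i]) + r).
have [B' B'0 hB'] := horner_bounded Q' (normc ((c1 +i* c2)%C : R[i]) + r).
apply: (@integrable_pdisc _ (r ^+ 2 * (4 * r) * B + (r ^+ 2) ^+ 2 * B')).
  apply: measurable_funD; apply: measurable_funM.
  - apply: measurable_funM; first exact: measurable_bump.
    by apply: measurable_funM; [exact: measurable_cst|exact: measurable_funTS].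
  - by have [] := cmeasurable_horner Q (cmeasurable_cpt pdisc).
  - by apply: measurable_funX; exact: measurable_bump.
  - by have [] := cmeasurable_horner Q' (cmeasurable_cpt pdisc).
move=> w wD; apply: le_trans (ler_normD _ _) _.
have h1 := hB _ (pdisc_disc wD); have h2 := hB' _ (pdisc_disc wD).
have h3 := bump_norm wD; have h4 := (pdiscP w).1 wD.
have h5 : `|(w.1 : R) - c1| <= r.
  exact: le_trans (ler_Re_normc (cpt w - (c1 +i* c2)%C)) (ltW h4).
apply: lerD; rewrite !normrM.
  apply: ler_pM.
  - by apply: mulr_ge0 => //; apply: mulr_ge0.
  - exact: normr_ge0.
  - apply: ler_pM => //.
    by rewrite normrN (ger0_norm (_ : 0 <= 4))// ler_pM2l.
  - exact: le_trans (ler_Re_normc _) h1.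
rewrite (expr2 (r ^+ 2)); apply: ler_pM.
- exact: mulr_ge0.
- exact: normr_ge0.
- exact: ler_pM.
- exact: le_trans (ler_Re_normc _) h2.
Qed.

Let igy : leb2.-integrable pdisc (EFin \o gy).
Proof.
have [B B0 hB] := horner_bounded Q (normc ((c1 +i* c2)%C : R[i]) + r).
have [B' B'0 hB'] := horner_bounded Q' (normc ((c1 +i* c2)%C : R[i]) + r).
apply: (@integrable_pdisc _ (r ^+ 2 * (4 * r) * B + (r ^+ 2) ^+ 2 * B')).
  apply: measurable_funD; apply: measurable_funM.
  - apply: measurable_funM; first exact: measurable_bump.
    by apply: measurable_funM; [exact: measurable_cst|exact: measurable_funTS].
  - by have [] := cmeasurable_horner Q (cmeasurable_cpt pdisc).
  - by apply: measurable_funX; exact: measurable_bump.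
  - by have [] := cmeasurable_horner Q' (cmeasurable_cpt pdisc).
move=> w wD; apply: le_trans (ler_normD _ _) _.
have h1 := hB _ (pdisc_disc wD); have h2 := hB' _ (pdisc_disc wD).
have h3 := bump_norm wD; have h4 := (pdiscP w).1 wD.
have h5 : `|(w.2 : R) - c2| <= r.
  exact: le_trans (ler_Im_normc (cpt w - (c1 +i* c2)%C)) (ltW h4).
apply: lerD; rewrite !normrM.
  apply: ler_pM.
  - by apply: mulr_ge0 => //; apply: mulr_ge0.
  - exact: normr_ge0.
  - apply: ler_pM => //.
    by rewrite normrN (ger0_norm (_ : 0 <= 4))// ler_pM2l.
  - exact: le_trans (ler_Im_normc _) h1.
rewrite (expr2 (r ^+ 2)); apply: ler_pM.
- exact: mulr_ge0.
- exact: normr_ge0.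
- exact: ler_pM.
- exact: le_trans (ler_Re_normc _) h2.
Qed.

Let int_gx : (\int[leb2]_(w in pdisc) (gx w)%:E = 0)%E.
Proof.
refine (@integral_ysections0 _ _ _ _ R (@lebesgue_measure R) (@lebesgue_measure R) pdisc gx measurable_pdisc igx _) => /= y0; pose y : R := y0; rewrite -[y0]/y; clearbody y; move=> {y0}.
pose t : R := (y - c2) ^+ 2.
have -> : [set s | pdisc (s, y)] = [set s : R | 0 < r ^+ 2 - (s - c1) ^+ 2 - t].
  by apply/seteqP; split => s; rewrite /pdisc /bump /= /t; lra.
rewrite section_itv; case: ifPn => [tr|_]; last by rewrite integral_set0.
set q := Num.sqrt _; have h : 0 < q by rewrite sqrtr_gt0 subr_gt0.
have e : q ^+ 2 = r ^+ 2 - t by rewrite sqr_sqrtr// subr_ge0 ltW.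
(* The ends of the section lie on the circle, where [bump] vanishes. *)
have z0 (s : R) : (s - c1) ^+ 2 = q ^+ 2 -> bump (s, y) ^+ 2 * complex.Re Q.[cpt (s, y)] = 0.
  rewrite e => es; have -> : bump (s, y) = 0 by move: es; rewrite /bump /= /t; lra.
  by rewrite expr0n mul0r.
have ab : c1 - q < c1 + q by lra.
pose k : R -> R := cst (r ^+ 2 - t) - (id - cst c1) ^+ 2.
have kE (s : R) : bump (s, y) = k s by rewrite /k /bump /t /= !fctE /=; ring.
have dF (s : R) : is_derive s 1 (fun s : R => bump (s, y) ^+ 2 * complex.Re Q.[cpt (s, y)]) (gx (s, y)).
  have [d1 _] := is_derive_horner_x Q s y.
  rewrite (_ : (fun _ => _) = k ^+ 2 * (fun s : R => complex.Re Q.[cpt (s, y)])); last first.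
    by apply/funext => u; rewrite kE.
  apply: is_derive_eq; rewrite /gx kE /k /cpt /= !fctE /= /GRing.scale /=; ring.
have df (s : R) : derivable (fun s : R => gx (s, y)) s 1.
  have [d1 _] := is_derive_horner_x Q s y; have [d2 _] := is_derive_horner_x Q' s y.
  rewrite (_ : (fun _ => _) = k * (cst (- 4) * (id - cst c1)) *
     (fun s : R => complex.Re Q.[cpt (s, y)]) +
     k ^+ 2 * (fun s : R => complex.Re Q'.[cpt (s, y)])); last first.
    by apply/funext => u; rewrite /gx kE.
  by apply: derivableD.
apply: (@integral_derive_itvoo0 _ _ (fun s : R => gx (s, y)) _ _ ab dF df).
  by apply: z0; ring.
by apply: z0; ring.
Qed.

Let int_gy : (\int[leb2]_(w in pdisc) (gy w)%:E = 0)%E.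
Proof.
refine (@integral_xsections0 _ _ _ _ R (@lebesgue_measure R) (@lebesgue_measure R) pdisc gy measurable_pdisc igy _) => /= x0; pose x : R := x0; rewrite -[x0]/x; clearbody x; move=> {x0}.
pose t : R := (x - c1) ^+ 2.
have -> : [set s | pdisc (x, s)] = [set s : R | 0 < r ^+ 2 - (s - c2) ^+ 2 - t].
  by apply/seteqP; split => s; rewrite /pdisc /bump /= /t; lra.
rewrite section_itv; case: ifPn => [tr|_]; last by rewrite integral_set0.
set q := Num.sqrt _; have h : 0 < q by rewrite sqrtr_gt0 subr_gt0.
have e : q ^+ 2 = r ^+ 2 - t by rewrite sqr_sqrtr// subr_ge0 ltW.
have z0 (s : R) : (s - c2) ^+ 2 = q ^+ 2 -> bump (x, s) ^+ 2 * complex.Im Q.[cpt (x, s)] = 0.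
  rewrite e => es; have -> : bump (x, s) = 0 by move: es; rewrite /bump /= /t; lra.
  by rewrite expr0n mul0r.
have ab : c2 - q < c2 + q by lra.
pose k : R -> R := cst (r ^+ 2 - t) - (id - cst c2) ^+ 2.
have kE (s : R) : bump (x, s) = k s by rewrite /k /bump /t /= !fctE /=; ring.
have dF (s : R) : is_derive s 1 (fun s : R => bump (x, s) ^+ 2 * complex.Im Q.[cpt (x, s)]) (gy (x, s)).
  have [_ d1] := is_derive_horner_y Q x s.
  rewrite (_ : (fun _ => _) = k ^+ 2 * (fun s : R => complex.Im Q.[cpt (x, s)])); last first.
    by apply/funext => u; rewrite kE.
  apply: is_derive_eq; rewrite /gy kE /k /cpt /= !fctE /= /GRing.scale /=; ring.
have df (s : R) : derivable (fun s : R => gy (x, s)) s 1.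
  have [_ d1] := is_derive_horner_y Q x s; have [d2 _] := is_derive_horner_y Q' x s.
  rewrite (_ : (fun _ => _) = k * (cst (- 4) * (id - cst c2)) *
     (fun s : R => complex.Im Q.[cpt (x, s)]) +
     k ^+ 2 * (fun s : R => complex.Re Q'.[cpt (x, s)])); last first.
    by apply/funext => u; rewrite /gy kE.
  by apply: derivableD.
apply: (@integral_derive_itvoo0 _ _ (fun s : R => gy (x, s)) _ _ ab dF df).
  by apply: z0; ring.
by apply: z0; ring.
Qed.

(** In gx - gy the terms in Q' cancel, and the coefficients -1/4 and 1/4 undo the factor -4 from the
    derivative of [bump ^+ 2]. Since (w - c) Q is an arbitrary polynomial vanishing at c, this is
    the mean value property in real part. *)
Lemma integral_bump_horner0 :
  (\int[leb2]_(w in pdisc)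
     (bump w * complex.Re ((cpt w - (c1 +i* c2)%C) * Q.[cpt w]))%:E = 0)%E.
Proof.
have := @integral_lincomb0 _ _ _ _ R (@lebesgue_measure R) (@lebesgue_measure R) pdisc gx measurable_pdisc igx gy (- 4^-1) 4^-1 igy int_gx int_gy.
congr (_ = _); apply: eq_integral => w _; congr EFin; rewrite /gx /gy.
by case: (Q.[_]) => q1 q2 /=; field.
Qed.

End Green.

End MeanValue.

Section Area.
Variable R : realType.

(* Packaging the product measure once keeps the inference of its measure
   structure out of the later proofs. *)
Definition area : {measure set (plane R) -> \bar R} :=
  (@lebesgue_measure R \x @lebesgue_measure R)%E.

Lemma area_rect (a b c d : R) : a <= b -> c <= d ->
  area (`[a, b]%classic `*` `[c, d]%classic) = ((b - a) * (d - c))%:E.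
Proof.
move=> ab cd.
have h (x y : R) : x <= y -> (@lebesgue_measure R `[x, y]%classic = (y - x)%:E)%E.
  move=> xy; rewrite lebesgue_measure_itv /= lte_fin.
  case: ifPn => [//|]; rewrite -leNgt => yx.
  by have -> : y - x = 0 by lra.
transitivity ((@lebesgue_measure R `[a, b]%classic * @lebesgue_measure R `[c, d]%classic)%E).
  exact: (product_measure1E (@lebesgue_measure R) (@lebesgue_measure R) (measurable_itv _) (measurable_itv _)).
by rewrite !h.
Qed.

Lemma integrable_area_pdisc (c1 c2 r : R) (g : plane R -> R) B : 0 < r ->
  measurable_fun (pdisc c1 c2 r) g ->
  (forall w, pdisc c1 c2 r w -> `|g w| <= B) ->
  area.-integrable (pdisc c1 c2 r) (EFin \o g).
Proof. by move=> r0; exact: integrable_pdisc. Qed.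

Lemma area_bump_horner0 (c1 c2 r : R) (Q : {poly R[i]}) : 0 < r ->
  (\int[area]_(w in pdisc c1 c2 r)
     (bump c1 c2 r w * complex.Re ((cpt w - (c1 +i* c2)%C) * Q.[cpt w]))%:E = 0)%E.
Proof. by move=> r0; exact: integral_bump_horner0. Qed.

End Area.

Section NonnegIntegral.
Context d (T : measurableType d) (R : realType).
Variables (mu : {measure set T -> \bar R}) (D : set T).
Hypothesis mD : measurable D.
Implicit Types f g : T -> R.

Lemma int_le f g : (forall x, D x -> 0 <= f x) -> measurable_fun D f ->
  measurable_fun D g -> (forall x, D x -> f x <= g x) ->
  (\int[mu]_(x in D) (f x)%:E <= \int[mu]_(x in D) (g x)%:E)%E.
Proof.
move=> f0 mf mg fg; apply: ge0_le_integral => //; exact/measurable_EFinP.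
Qed.

Lemma intZ (k : R) f : 0 <= k -> (forall x, D x -> 0 <= f x) ->
  measurable_fun D f ->
  (\int[mu]_(x in D) (k * f x)%:E = k%:E * \int[mu]_(x in D) (f x)%:E)%E.
Proof.
move=> k0 f0 mf; rewrite -ge0_integralZl_EFin//; last exact/measurable_EFinP.
Qed.

Lemma intD f g : (forall x, D x -> 0 <= f x) -> measurable_fun D f ->
  (forall x, D x -> 0 <= g x) -> measurable_fun D g ->
  (\int[mu]_(x in D) (f x + g x)%:E =
   \int[mu]_(x in D) (f x)%:E + \int[mu]_(x in D) (g x)%:E)%E.
Proof.
move=> f0 mf g0 mg; rewrite -ge0_integralD//; exact/measurable_EFinP.
Qed.

Lemma int_subset (E : set T) f : measurable E -> E `<=` D ->
  (forall x, D x -> 0 <= f x) -> measurable_fun D f ->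
  (\int[mu]_(x in E) (f x)%:E <= \int[mu]_(x in D) (f x)%:E)%E.
Proof.
by move=> mE ED f0 mf; apply: ge0_subset_integral => //; exact/measurable_EFinP.
Qed.

End NonnegIntegral.

(** * Mean value inequalities for |f| and |f|^p *)

Section MeanValueInequality.
Variable R : realType.
Local Notation leb2 := (area R).

(** Young's inequality for x and y^(p-1) with exponents p and p / (p - 1). It expresses that the
    graph of x^p lies above its tangent at y, and once integrated it acts as Jensen's inequality. *)
Lemma young_tangent (p x y : R) : 1 < p -> 0 <= x -> 0 <= y ->
  p * (y `^ (p - 1)) * x <= x `^ p + (p - 1) * y `^ p.
Proof.
move=> p1 x0 y0; have p0 : 0 < p by lra.
have q0 : 0 < p / (p - 1) by rewrite divr_gt0//; lra.
have pN0 : p != 0 by rewrite gt_eqF.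
have qN0 : p - 1 != 0 by rewrite gt_eqF//; lra.
have := @conjugate_powR R x (y `^ (p - 1)) p (p / (p - 1)) x0 (powR_ge0 _ _) p0 q0.
rewrite -powRrM mulrCA divff// mulr1 => h.
have : p^-1 + (p / (p - 1))^-1 = 1 by field; rewrite ?pN0 ?qN0.
move=> /h {}h; rewrite -mulrA -(ler_pM2l (_ : 0 < p^-1)) ?invr_gt0//.
rewrite mulKf// mulrC; apply: le_trans h _.
rewrite le_eqVlt; apply/orP; left; apply/eqP; field.
by rewrite pN0 qN0.
Qed.

Variables (c1 c2 r : R).
Hypothesis r0 : 0 < r.
Local Notation bump := (bump c1 c2 r).
Local Notation pdisc := (pdisc c1 c2 r).
Local Notation c := ((c1 +i* c2)%C : R[i]).

Definition bump_mass : R := fine (\int[leb2]_(w in pdisc) (bump w)%:E)%E.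

Let mD := measurable_pdisc c1 c2 r : measurable pdisc.

Lemma bump_massE : ((\int[leb2]_(w in pdisc) (bump w)%:E) = bump_mass%:E)%E.
Proof.
rewrite fineK//; apply: integrable_fin_num => //.
apply: (@integrable_area_pdisc R c1 c2 r _ (r ^+ 2)) => //; first exact: measurable_bump.
by move=> w wD; rewrite gtr0_norm// bump_le.
Qed.

(** The exact mass is pi r^4 / 2. The square of side r centred at c, on which the weight is at least
    r^2 / 2, already gives a sufficient bound. *)
Lemma bump_mass_ge : r ^+ 4 / 2 <= bump_mass.
Proof.
pose S := (`[(c1 - r / 2)%R, (c1 + r / 2)%R]%classic `*` `[(c2 - r / 2)%R, (c2 + r / 2)%R]%classic : set (plane R)).
have mS : measurable S by apply: measurableX; exact: measurable_itv.
have bS w : S w -> r ^+ 2 / 2 <= bump w.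
  move=> [] /=; rewrite !in_itv /= -!ler_distl => h1 h2; rewrite /bump.
  have r2 : 0 <= r / 2 by rewrite divr_ge0// ltW.
  have := @lerXn2r R 2 `|w.1 - c1| (r / 2); rewrite !nnegrE => /(_ (normr_ge0 _) r2 h1).
  have := @lerXn2r R 2 `|w.2 - c2| (r / 2); rewrite !nnegrE => /(_ (normr_ge0 _) r2 h2).
  by rewrite !real_normK ?num_real// !expr2; lra.
have SD : S `<=` pdisc.
  by move=> w /bS h; rewrite /pdisc /=; apply: lt_le_trans h; rewrite divr_gt0// exprn_gt0.
rewrite -lee_fin -bump_massE.
apply: (@le_trans _ _ (\int[leb2]_(w in S) (r ^+ 2 / 2)%:E)%E); last first.
  apply: (@le_trans _ _ (\int[leb2]_(w in S) (bump w)%:E)%E).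
    apply: ge0_le_integral => //.
    + by move=> w _; rewrite lee_fin divr_ge0// sqr_ge0.
    + by apply/measurable_EFinP; exact: measurable_bump.
  apply: ge0_subset_integral => //.
  - by apply/measurable_EFinP; exact: measurable_bump.
  - by move=> w; rewrite /pdisc /= lee_fin => /ltW.
have -> : r ^+ 4 / 2 = r ^+ 2 / 2 * (r * r) by rewrite !exprS expr0; ring.
have aS : area R S = (r * r)%:E.
  have r2 : 0 <= r / 2 by rewrite divr_ge0// ltW.
  have l (x : R) : x - r / 2 <= x + r / 2 by rewrite lerD2l ge0_cp.
  by rewrite /S (area_rect (l c1) (l c2)); congr (_%:E); field.
by rewrite integral_cst// aS -EFinM.
Qed.

(** Rotate by l so that l P(c) = |P(c)| and write l P = l P(c) + (w - c) Q. The real part of the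
    second term has zero weighted mean, and the real part of l P is at most |P|. *)
Lemma poly_mean_le (P : {poly R[i]}) :
  ((normc P.[c])%:E * bump_mass%:E <=
   \int[leb2]_(w in pdisc) (bump w * normc P.[cpt w])%:E)%E.
Proof.
have [l l1 hl] := normc_phase P.[c].
have : root (l *: P - (l * P.[c])%:P) c by rewrite /root !hornerE subrr.
move=> /factor_theorem [Q hQ].
have lP w : l * P.[w] = l * P.[c] + (w - c) * Q.[w].
  have := congr1 (horner^~ w) hQ; rewrite !hornerE => /eqP; rewrite subr_eq => /eqP ->.
  by ring.
have h0 := area_bump_horner0 c1 c2 Q r0.
have [B B0 hB] := horner_bounded P (normc c + r).
have [B' B'0 hB'] := horner_bounded (('X - c%:P) * Q) (normc c + r).
have wc w : pdisc w -> normc (cpt w) <= normc c + r.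
  by move=> /pdiscP h; have := ler_distc_dist (cpt w) c; have := h r0; lra.
have mQ : measurable_fun pdisc (fun w => complex.Re ((cpt w - c) * Q.[cpt w])).
  have [+ _] := cmeasurable_horner (('X - c%:P) * Q) (@cmeasurable_cpt R pdisc).
  by under eq_fun do rewrite !hornerE.
have ib : leb2.-integrable pdisc (EFin \o (fun w => normc P.[c] * bump w)).
  apply: (@integrable_area_pdisc R c1 c2 r _ (normc P.[c] * r ^+ 2)) => //.
    by apply: measurable_funM; [exact: measurable_cst|exact: measurable_bump].
  move=> w wD; rewrite normrM (ger0_norm (normc_ge0 _)) ler_wpM2l ?normc_ge0//.
  by rewrite gtr0_norm// bump_le.
have iq : leb2.-integrable pdisc (EFin \o (fun w => bump w * complex.Re ((cpt w - c) * Q.[cpt w]))).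
  apply: (@integrable_area_pdisc R c1 c2 r _ (r ^+ 2 * B')) => //.
    by apply: measurable_funM => //; exact: measurable_bump.
  move=> w wD; rewrite normrM; apply: ler_pM => //.
    by rewrite gtr0_norm// bump_le.
  apply: le_trans (ler_Re_normc _) _; have := hB' _ (wc _ wD).
  by rewrite !hornerE.
have iP : leb2.-integrable pdisc (EFin \o (fun w => bump w * normc P.[cpt w])).
  apply: (@integrable_area_pdisc R c1 c2 r _ (r ^+ 2 * B)) => //.
    apply: measurable_funM; first exact: measurable_bump.
    exact: cmeasurable_normc (cmeasurable_horner P (@cmeasurable_cpt R pdisc)).
  move=> w wD; rewrite normrM; apply: ler_pM => //.
    by rewrite gtr0_norm// bump_le.
  by rewrite ger0_norm ?normc_ge0// hB// wc.
have -> : ((normc P.[c])%:E * bump_mass%:E =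
   \int[leb2]_(w in pdisc) ((normc P.[c] * bump w)%:E +
      (bump w * complex.Re ((cpt w - c) * Q.[cpt w]))%:E))%E.
  rewrite integralD//= h0 adde0 -bump_massE -integralZl//.
  apply: (@integrable_area_pdisc R c1 c2 r _ (r ^+ 2)) => //; first exact: measurable_bump.
  by move=> w wD; rewrite gtr0_norm// bump_le.
apply: le_integral => //; first exact: integrableD.
move=> w; rewrite inE => wD; rewrite -EFinD lee_fin.
rewrite mulrC -mulrDr ler_wpM2l//; first exact: ltW.
have -> : normc P.[c] + complex.Re ((cpt w - c) * Q.[cpt w]) = complex.Re (l * P.[cpt w]).
  rewrite lP -hl; by case: (l * _) (_ * Q.[_]) => ? ? [].
apply: le_trans (le_trans (ler_norm _) (ler_Re_normc _)) _.
by rewrite normcM l1 mul1r.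
Qed.

End MeanValueInequality.

Section AnalyticMeanValue.
Variable R : realType.
Local Notation leb2 := (area R).
Variables (f : R[i]^o -> R[i]^o) (a : nat -> R[i]^o).
Hypothesis fa : taylor_expansion f a.

(** On the disc f is the pointwise limit of its Taylor polynomials, whence the measurability. *)
Lemma measurable_normc_taylor (D : set (plane R)) :
  (forall w, D w -> normc (cpt w) < 1) ->
  measurable_fun D (fun w => normc (f (cpt w))).
Proof.
move=> Dd.
apply: (@measurable_normc_cvg _ _ _ _ (fun n w => (\poly_(k < n) a k).[cpt w])).
  by move=> n; apply: cmeasurable_horner; exact: cmeasurable_cpt.
move=> w /Dd wd; have := fa wd.
rewrite (_ : power_series a _ = fun n => (\poly_(k < n) a k).[cpt w])//.
by apply/funext => n; rewrite power_series_horner.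
Qed.

Variables (c1 c2 r p : R).
Hypothesis r0 : 0 < r.
Local Notation bump := (bump c1 c2 r).
Local Notation pdisc := (pdisc c1 c2 r).
Local Notation c := ((c1 +i* c2)%C : R[i]).
Local Notation mass := (bump_mass c1 c2 r).
Hypothesis cr1 : normc c + r < 1.
Hypothesis p1 : 1 < p.

Let mD := measurable_pdisc c1 c2 r : measurable pdisc.

Let pdisc_le w : pdisc w -> normc (cpt w) <= normc c + r.
Proof. by move=> /(pdiscP _ _ r0) h; have := ler_distc_dist (cpt w) c; lra. Qed.

Let mf : measurable_fun pdisc (fun w => normc (f (cpt w))).
Proof. by apply: measurable_normc_taylor => w /pdisc_le /le_lt_trans; apply. Qed.

Let mass_gt0 : 0 < mass.
Proof. by apply: lt_le_trans (bump_mass_ge _ _ r0); rewrite divr_gt0// exprn_gt0. Qed.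

Let b0 w : pdisc w -> 0 <= bump w.
Proof. by move=> h; exact: ltW. Qed.

Let mbump : measurable_fun pdisc bump.
Proof. exact: measurable_bump. Qed.

Let p0 : 0 < p := lt_trans ltr01 p1.
Let pm1 : 0 <= p - 1.
Proof. by rewrite subr_ge0 ltW. Qed.

(** Uniform approximation by a Taylor polynomial on the disc of radius |c| + r < 1. The error is met
    twice, in the integral and at the centre, each time as e / 2 after multiplication by the
    mass. *)
Lemma analytic_mean_le : ((normc (f c))%:E * mass%:E <=
  \int[leb2]_(w in pdisc) (bump w * normc (f (cpt w)))%:E)%E.
Proof.
apply/lee_addgt0Pr => e e0.
have rho0 : 0 <= normc c + r by rewrite addr_ge0 ?normc_ge0 ?ltW.
have [B [x [B0 x0 x1 _ hf]]] := power_series_unif fa rho0 cr1.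
pose d := e / (2 * mass) / (B + 1).
have d0 : 0 < d by rewrite !divr_gt0 ?mulr_gt0//; lra.
have [N hN] := expr_small x0 x1 d0.
pose P := \poly_(k < N) a k.
have hP z : normc z <= normc c + r -> normc (f z - P.[z]) <= e / (2 * mass).
  move=> /(hf _ N) h; rewrite -power_series_horner; apply: le_trans h _.
  apply: (@le_trans _ _ ((B + 1) * d)).
    by apply: ler_pM => //; [exact: exprn_ge0|lra|rewrite ltW// hN].
  by rewrite /d mulrC divfK// gt_eqF//; lra.
have mP : measurable_fun pdisc (fun w => normc P.[cpt w]).
  exact: cmeasurable_normc (cmeasurable_horner P (@cmeasurable_cpt R pdisc)).
have h1 := poly_mean_le c1 c2 r0 P.
have em : e / (2 * mass) * mass = e / 2 by field; rewrite gt_eqF.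
have h2 : (\int[leb2]_(w in pdisc) (bump w * normc P.[cpt w])%:E <=
   \int[leb2]_(w in pdisc) (bump w * normc (f (cpt w)))%:E + (e / 2)%:E)%E.
  rewrite -em EFinM -bump_massE// -(intZ _ mD)//; last 1 first.
  - by rewrite divr_ge0 ?mulr_ge0// ltW.
  rewrite -(intD _ mD); last 4 first.
  - by move=> w wD; rewrite mulr_ge0 ?normc_ge0// b0.
  - exact: measurable_funM.
  - by move=> w wD; rewrite mulr_ge0 ?b0// divr_ge0 ?mulr_ge0// ltW.
  - by apply: measurable_funM => //; exact: measurable_cst.
  apply: (int_le _ mD).
  - by move=> w wD; rewrite mulr_ge0 ?normc_ge0// b0.
  - exact: measurable_funM.
  - by apply: measurable_funD; apply: measurable_funM.
  move=> w wD; rewrite mulrC (mulrC (bump w)) -mulrDl.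
  apply: ler_wpM2r; first exact: b0.
  have := hP _ (pdisc_le wD); rewrite normcB.
  by have := ler_distc_dist P.[cpt w] (f (cpt w)); lra.
have h3 : ((normc (f c))%:E * mass%:E <= (normc P.[c])%:E * mass%:E + (e / 2)%:E)%E.
  rewrite -!EFinM -EFinD lee_fin -em -mulrDl; apply: ler_wpM2r; first exact: ltW.
  have h4 : normc c <= normc c + r by rewrite lerDl ltW.
  by have := hP c h4; have := ler_distc_dist (f c) P.[c]; lra.
apply: le_trans h3 _.
have -> : e%:E = ((e / 2)%:E + (e / 2)%:E)%E by rewrite -EFinD -splitr.
rewrite addeA leeD2r//.
exact: le_trans h1 h2.
Qed.

(** Integrate [young_tangent] at y = |f(c)| against [bump]. By [analytic_mean_le] the left side is
    at least p y^p times the mass, of which p - 1 parts cancel. The bounds bump <= r^2 and mass >=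
    r^4 / 2 leave the factor r^2 / 2. *)
Lemma analytic_power_mean_le : ((normc (f c) `^ p * (r ^+ 2 / 2))%:E <=
  \int[leb2]_(w in pdisc) (normc (f (cpt w)) `^ p)%:E)%E.
Proof.
set y := normc (f c); have y0 : 0 <= y by exact: normc_ge0.
have mfp : measurable_fun pdisc (fun w => normc (f (cpt w)) `^ p).
  exact: (measurableT_comp (@measurable_powR R p)) mf.
set J := (\int[leb2]_(w in pdisc) (normc (f (cpt w)) `^ p)%:E)%E.
have k0 : 0 <= p * y `^ (p - 1) by apply: mulr_ge0; [exact: ltW|exact: powR_ge0].
have h1 : ((p * y `^ (p - 1))%:E * (\int[leb2]_(w in pdisc) (bump w * normc (f (cpt w)))%:E) <=
    \int[leb2]_(w in pdisc) (bump w * normc (f (cpt w)) `^ p)%:E +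
    ((p - 1) * y `^ p)%:E * mass%:E)%E.
  have bf0 w : pdisc w -> 0 <= bump w * normc (f (cpt w)).
    by move=> wD; rewrite mulr_ge0 ?normc_ge0// b0.
  have q0 : 0 <= (p - 1) * y `^ p by apply: mulr_ge0 => //; exact: powR_ge0.
  rewrite -bump_massE// -(intZ _ mD)//; last exact: measurable_funM.
  rewrite -(intZ _ mD)//.
  rewrite -(intD _ mD); last 4 first.
  - by move=> w wD; rewrite mulr_ge0 ?powR_ge0// b0.
  - exact: measurable_funM.
  - by move=> w wD; rewrite mulr_ge0 ?b0.
  - by apply: measurable_funM => //; exact: measurable_cst.
  apply: (int_le _ mD).
  - by move=> w wD; rewrite mulr_ge0// bf0.
  - by apply: measurable_funM => //; exact: measurable_funM.
  - by apply: measurable_funD; apply: measurable_funM.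
  move=> w wD; set F := normc (f (cpt w)).
  have -> : p * y `^ (p - 1) * (bump w * F) = bump w * (p * y `^ (p - 1) * F) by ring.
  have -> : bump w * F `^ p + (p - 1) * y `^ p * bump w = bump w * (F `^ p + (p - 1) * y `^ p) by ring.
  apply: ler_wpM2l; first exact: b0.
  by apply: young_tangent => //; exact: normc_ge0.
have h2 : ((y `^ p)%:E * mass%:E <= \int[leb2]_(w in pdisc) (bump w * normc (f (cpt w)) `^ p)%:E)%E.
  have := le_trans (lee_wpmul2l _ analytic_mean_le) h1.
  rewrite lee_fin => /(_ k0); rewrite -!EFinM.
  have -> : p * y `^ (p - 1) * (y * mass) = y `^ p * mass + (p - 1) * y `^ p * mass.
    have -> : p * y `^ (p - 1) * (y * mass) = p * (y * y `^ (p - 1)) * mass by ring.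
    by rewrite mulr_powRB1//; ring.
  by rewrite EFinD leeD2rE.
have h3 : (\int[leb2]_(w in pdisc) (bump w * normc (f (cpt w)) `^ p)%:E <= (r ^+ 2)%:E * J)%E.
  rewrite -(intZ _ mD)//; first last.
  - by move=> w wD; exact: powR_ge0.
  - exact: sqr_ge0.
  apply: (int_le _ mD).
  - by move=> w wD; rewrite mulr_ge0 ?powR_ge0// b0.
  - exact: measurable_funM.
  - by apply: measurable_funM => //; exact: measurable_cst.
  by move=> w wD; rewrite ler_wpM2r ?powR_ge0// bump_le.
have r20 : 0 < r ^+ 2 by rewrite exprn_gt0.
rewrite -(@lee_pmul2l _ (r ^+ 2)%:E)//.
apply: le_trans (le_trans h2 h3); rewrite -!EFinM lee_fin mulrCA ler_wpM2l ?powR_ge0//.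
by apply: le_trans (bump_mass_ge _ _ r0); rewrite mulrA -exprD.
Qed.

End AnalyticMeanValue.

(** * Point evaluation against the weighted integral *)

Section WeightedPointEvaluation.
Variable R : realType.
Local Notation leb2 := (area R).

Definition weight (alpha : R) (w : plane R) : R :=
  (1 - normc (cpt w) ^+ 2) `^ alpha.

Lemma measurable_normc_cpt (D : set (plane R)) :
  measurable_fun D (fun w => normc (cpt w)).
Proof. exact: cmeasurable_normc (cmeasurable_cpt _). Qed.

Lemma measurable_weight alpha (D : set (plane R)) : measurable_fun D (weight alpha).
Proof.
apply: (measurableT_comp (@measurable_powR R alpha)).
apply: measurable_funB; first exact: measurable_cst.
by apply: measurable_funX; exact: measurable_normc_cpt.
Qed.

Definition annulus (s t : R) : set (plane R) :=
  [set w | s < 1 - normc (cpt w) < t].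

Lemma measurable_annulus s t : measurable (annulus s t).
Proof.
rewrite (_ : annulus s t = (fun w => 1 - normc (cpt w)) @^-1` `]s, t[).
  rewrite -[X in measurable X]setTI.
  have : measurable_fun setT (fun w : plane R => 1 - normc (cpt w)).
    by apply: measurable_funB; [exact: measurable_cst|exact: measurable_normc_cpt].
  by apply => //; exact: measurable_itv.
by apply/seteqP; split=> w; rewrite /annulus /= in_itv.
Qed.

(** Since alpha may have either sign, the power may increase or decrease; the minimum serves both
    cases. *)
Lemma powR_ge_comparable (alpha u x : R) : 0 < u -> u / 2 <= x -> x <= 3 * u ->
  Num.min (2^-1 `^ alpha) (3 `^ alpha) * u `^ alpha <= x `^ alpha.
Proof.
move=> u0 ux xu; have x0 : 0 < x by lra.
have [a0|a0] := leP 0 alpha.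
  apply: (@le_trans _ _ (2^-1 `^ alpha * u `^ alpha)).
    by rewrite ler_wpM2r ?powR_ge0// ge_min lexx.
  rewrite -powRM ?(ltW u0)// ?invr_ge0//.
  by apply: ge0_ler_powR => //; rewrite ?nnegrE; lra.
apply: (@le_trans _ _ (3 `^ alpha * u `^ alpha)).
  by rewrite ler_wpM2r ?powR_ge0// ge_min lexx orbT.
have u30 : 0 < 3 * u by rewrite mulr_gt0.
have -> : 3 `^ alpha * u `^ alpha = ((3 * u) `^ (- alpha))^-1.
  by rewrite -powRN opprK powRM// ltW.
have -> : x `^ alpha = (x `^ (- alpha))^-1 by rewrite -powRN opprK.
rewrite lef_pV2 ?posrE ?powR_gt0//.
by apply: ge0_ler_powR; rewrite ?nnegrE; lra.
Qed.

(** On the disc of radius u / 2 about z, with u = 1 - |z|, the quantity 1 - |w|^2 lies between u / 2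
    and 3 u, so the weight is at least k u^alpha; the 8 comes from (u / 2)^2 / 2 = u^2 / 8. The disc
    is enlarged to an annulus depending on |z| alone, so that all points of a dyadic shell can share
    one integral. *)
Lemma weighted_point_le (p alpha : R) : 1 < p -> exists2 K : R, 0 < K &
  forall (f : R[i]^o -> R[i]^o) (a : nat -> R[i]^o) (z : R[i]^o), taylor_expansion f a -> disc z ->
  ((normc (f z) `^ p * (1 - normc z) `^ (alpha + 2))%:E <=
   K%:E * \int[leb2]_(w in annulus ((1 - normc z) / 2) (2 * (1 - normc z)))
     (weight alpha w * normc (f (cpt w)) `^ p)%:E)%E.
Proof.
move=> p1; pose k := Num.min (2^-1 `^ alpha) (3 `^ alpha) : R.
have k0 : 0 < k by rewrite lt_min !powR_gt0.
exists (8 / k) => [|f a [c1 c2] fa zd]; first by rewrite divr_gt0.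
set z : R[i]^o := (c1 +i* c2)%C in zd *.
set u := 1 - normc z; have u0 : 0 < u by rewrite subr_gt0.
have r0 : 0 < u / 2 by lra.
have cr1 : normc ((c1 +i* c2)%C : R[i]) + u / 2 < 1.
  by change (normc z + u / 2 < 1); move: u0; rewrite /u; lra.
have h1 := analytic_power_mean_le fa r0 cr1 p1.
set D := annulus _ _; have mD : measurable D by exact: measurable_annulus.
have mP := measurable_pdisc c1 c2 (u / 2).
have PD : pdisc c1 c2 (u / 2) `<=` D.
  move=> w /(pdiscP _ _ r0) h; have h2 := ler_distc_dist (cpt w) z.
  have h3 := ler_distc_dist z (cpt w); rewrite normcB in h3.
  have zu : normc z = 1 - u by rewrite /u; ring.
  by rewrite /D /annulus /mkset; apply/andP; split; move: h h2 h3; rewrite -/z zu; lra.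
have Dd w : D w -> normc (cpt w) < 1 by rewrite /D /annulus /= => /andP[? _]; lra.
have mfp (E : set (plane R)) : E `<=` D -> measurable_fun E (fun w => normc (f (cpt w)) `^ p).
  move=> ED; apply: (measurableT_comp (@measurable_powR R p)).
  by apply: (measurable_normc_taylor fa) => w /ED /Dd.
have h2 : ((k * u `^ alpha)%:E * \int[leb2]_(w in pdisc c1 c2 (u / 2)) (normc (f (cpt w)) `^ p)%:E
   <= \int[leb2]_(w in D) (weight alpha w * normc (f (cpt w)) `^ p)%:E)%E.
  apply: (@le_trans _ _ (\int[leb2]_(w in pdisc c1 c2 (u / 2)) (weight alpha w * normc (f (cpt w)) `^ p)%:E)%E).
    rewrite -(intZ _ mP); last 3 first.
    - by rewrite mulr_ge0 ?powR_ge0// ltW.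
    - by move=> w wD; exact: powR_ge0.
    - exact: mfp.
    apply: (int_le _ mP).
    - by move=> w wD; rewrite mulr_ge0 ?mulr_ge0 ?powR_ge0// ltW.
    - by apply: measurable_funM; [exact: measurable_cst|exact: mfp].
    - by apply: measurable_funM; [exact: measurable_weight|exact: mfp].
    move=> w wP; rewrite ler_wpM2r ?powR_ge0//.
    have wD : D w by exact: PD.
    move: wD; rewrite /D /annulus /mkset => /andP[w1 w2].
    have n0 := normc_ge0 (cpt w).
    have /(pdiscP _ _ r0) h : pdisc c1 c2 (u / 2) w by [].
    have h3 := ler_distc_dist z (cpt w); rewrite normcB in h3.
    have zu : normc z = 1 - u by rewrite /u; ring.
    rewrite -/z zu in h h3; rewrite /weight.
    set n := normc (cpt w) in w1 w2 n0 h3 *.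
    have n1 : n <= 1 by lra.
    have n2 : n ^+ 2 <= n by rewrite expr2 ler_piMl.
    have n3 : 0 <= (1 - n) ^+ 2 by exact: sqr_ge0.
    apply: powR_ge_comparable => //; first by lra.
    by move: n3; rewrite sqrrB expr1n mul1r -mulr_natl; lra.
  have hs := @int_subset _ _ _ leb2 D mD (pdisc c1 c2 (u / 2)) (fun w => weight alpha w * normc (f (cpt w)) `^ p) mP PD.
  apply: hs.
  - by move=> w _; rewrite mulr_ge0 ?powR_ge0.
  - by apply: measurable_funM; [exact: measurable_weight|exact: mfp].
have h3 := lee_wpmul2l (_ : (0 <= (8 / k)%:E)%E) (le_trans (lee_wpmul2l (_ : (0 <= (k * u `^ alpha)%:E)%E) h1) h2).
apply: le_trans (h3 _ _).
- rewrite -!EFinM lee_fin powRD; last by apply/implyP => _; rewrite gt_eqF.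
  rewrite (powR_mulrn 2 (ltW u0)) le_eqVlt; apply/orP; left; apply/eqP.
  by field; rewrite gt_eqF.
- by rewrite lee_fin divr_ge0// ltW.
- by rewrite lee_fin mulr_ge0 ?powR_ge0// ltW.
Qed.

End WeightedPointEvaluation.

(** * The weight near the boundary point 1 *)

Section NonnegSeries.
Variable R : realType.

Lemma nneseries_term_le (u : nat -> \bar R) k : (forall n, 0 <= u n)%E ->
  (u k <= \sum_(0 <= i <oo) u i)%E.
Proof.
move=> u0; apply: le_trans (nneseries_lim_ge k.+1 (fun n _ _ => u0 n)).
by rewrite big_nat_recr//= leeDr// sume_ge0.
Qed.

Lemma nneseries_le (u : nat -> \bar R) (M : \bar R) : (forall n, 0 <= u n)%E ->
  (forall n, \sum_(0 <= i < n) u i <= M)%E ->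
  (\sum_(0 <= i <oo) u i <= M)%E.
Proof.
move=> u0 uM; apply: lime_le; first exact: is_cvg_nneseries.
by apply: nearW => n; exact: uM.
Qed.

Lemma nneseries_geometric_le (C q : R) : 0 <= C -> 0 <= q -> q < 1 ->
  (\sum_(0 <= i <oo) (C * q ^+ i)%:E <= (C / (1 - q))%:E)%E.
Proof.
move=> C0 q0 q1; apply: nneseries_le => n.
  by rewrite lee_fin mulr_ge0// exprn_ge0.
rewrite sumEFin lee_fin -mulr_sumr ler_wpM2l//.
by apply: le_trans (sum_geom_le 0 n q0 q1) _; rewrite expr0 mul1r.
Qed.

End NonnegSeries.

Section IntegralCover.
Context d (T : measurableType d) (R : realType).
Variables (mu : {measure set T -> \bar R}) (D : set T).
Hypothesis mD : measurable D.

(** The covering sets may overlap, which only increases the right-hand side. The dyadic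
    decompositions of the weight, of [mu] and of the kernel are instances. *)
Lemma integral_cover_le (w g : T -> R) (A : nat -> set T) (c : nat -> R) :
  (forall x, D x -> 0 <= w x) -> measurable_fun D w ->
  (forall x, D x -> 0 <= g x) -> measurable_fun D g ->
  (forall k, measurable (A k)) -> (forall k, 0 <= c k) ->
  (forall x, D x -> exists k, A k x /\ g x <= c k) ->
  (\int[mu]_(x in D) (w x * g x)%:E <=
   \sum_(0 <= k <oo) (c k)%:E * \int[mu]_(x in D `&` A k) (w x)%:E)%E.
Proof.
move=> w0 mw g0 mg mA c0 cover.
have mwA k : measurable_fun D ((EFin \o w) \_ (A k)).
  apply/(measurable_restrict _ (mA k) mD); apply: measurable_funS mD _ _.
    exact: subIsetl.
  exact/measurable_EFinP.
have wA0 k x : D x -> (0 <= ((EFin \o w) \_ (A k)) x)%E.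
  by move=> Dx; rewrite /patch; case: ifP => // _; rewrite lee_fin w0.
apply: (@le_trans _ _ (\int[mu]_(x in D) \sum_(0 <= k <oo) (c k)%:E * ((EFin \o w) \_ (A k)) x)%E).
  apply: ge0_le_integral => //.
  - by move=> x Dx; rewrite lee_fin mulr_ge0 ?w0 ?g0.
  - by apply/measurable_EFinP; exact: measurable_funM.
  - apply: ge0_emeasurable_sum => [k x Dx _|k _].
      by rewrite mule_ge0 ?wA0// lee_fin.
    exact: measurable_funeM.
  move=> x Dx; have [k [Ax gk]] := cover x Dx.
  apply: le_trans (nneseries_term_le k _); last first.
    by move=> n; rewrite mule_ge0 ?wA0// lee_fin.
  by rewrite /patch mem_set//= -EFinM lee_fin mulrC ler_wpM2r ?w0.
rewrite integral_nneseries//; last first.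
- by move=> k x Dx; rewrite mule_ge0 ?wA0// lee_fin.
- by move=> k; exact: measurable_funeM.
apply: lee_nneseries => [k _ _|k _].
  by apply: integral_ge0 => x Dx; rewrite mule_ge0 ?wA0// lee_fin.
rewrite ge0_integralZl_EFin//; last by move=> x Dx; exact: wA0.
by rewrite lee_wpmul2l ?lee_fin// integral_mkcondr.
Qed.

End IntegralCover.

Section ProductSections.
Context d1 d2 (T1 : measurableType d1) (T2 : measurableType d2) (R : realType).
Variables (m1 : {sigma_finite_measure set T1 -> \bar R})
  (m2 : {sigma_finite_measure set T2 -> \bar R}).
Variables (D : set (T1 * T2)) (c : R).
Hypotheses (mD : measurable D) (c0 : 0 <= c).

(** Cavalieri's principle for a set whose projection lies in B. *)
Lemma measure_ysections_le (B : set T2) : measurable B ->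
  (forall y, m1 [set x | D (x, y)] <= c%:E)%E ->
  (forall x y, D (x, y) -> B y) ->
  ((m1 \x m2) D <= c%:E * m2 B)%E.
Proof.
move=> mB hc hB.
have -> : ((m1 \x m2) D = \int[(m1 \x m2)%E]_z (\1_D z)%:E)%E.
  by rewrite integral_indic// setIT.
have mi : measurable_fun setT (fun z => (\1_D z)%:E : \bar R).
  by apply/measurable_EFinP; exact: measurable_indic.
rewrite fubini_tonelli2//.
have -> : fubini_G m1 (fun z => (\1_D z)%:E) = fubini_G m1 (EFin \o \1_D) by [].
rewrite indic_fubini_tonelli_GE//.
have -> : (c%:E * m2 B = \int[m2]_y (c%:E * (\1_B y)%:E))%E.
  have mB' : measurable_fun setT (fun z => (\1_B z)%:E : \bar R).
    by apply/measurable_EFinP; exact: measurable_indic.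
  by rewrite ge0_integralZl_EFin// integral_indic// setIT.
have ys y : ysection D y = [set x | D (x, y)].
  by apply/seteqP; split => x; rewrite /ysection /= inE.
apply: ge0_le_integral => //.
- exact: measurable_fun_ysection.
- apply: measurable_funeM; apply/measurable_EFinP; exact: measurable_indic.
move=> y _; rewrite /= ys indicE; have [yB|yB] := boolP (y \in B).
  by rewrite mule1.
have -> : [set x | D (x, y)] = set0.
  by apply/seteqP; split => // x /= /hB h; move: yB; rewrite notin_setE.
by rewrite measure0 mule0.
Qed.

Lemma measure_xsections_le (B : set T1) : measurable B ->
  (forall x, m2 [set y | D (x, y)] <= c%:E)%E ->
  (forall x y, D (x, y) -> B x) ->
  ((m1 \x m2) D <= c%:E * m1 B)%E.
Proof.
move=> mB hc hB.
have -> : ((m1 \x m2) D = \int[(m1 \x m2)%E]_z (\1_D z)%:E)%E.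
  by rewrite integral_indic// setIT.
have mi : measurable_fun setT (fun z => (\1_D z)%:E : \bar R).
  by apply/measurable_EFinP; exact: measurable_indic.
rewrite fubini_tonelli1//.
have -> : fubini_F m2 (fun z => (\1_D z)%:E) = fubini_F m2 (EFin \o \1_D) by [].
rewrite indic_fubini_tonelli_FE//.
have -> : (c%:E * m1 B = \int[m1]_y (c%:E * (\1_B y)%:E))%E.
  have mB' : measurable_fun setT (fun z => (\1_B z)%:E : \bar R).
    by apply/measurable_EFinP; exact: measurable_indic.
  by rewrite ge0_integralZl_EFin// integral_indic// setIT.
have xs x : xsection D x = [set y | D (x, y)].
  by apply/seteqP; split => y; rewrite /xsection /= inE.
apply: ge0_le_integral => //.
- exact: measurable_fun_xsection.
- apply: measurable_funeM; apply/measurable_EFinP; exact: measurable_indic.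
move=> x _; rewrite /= xs indicE; have [xB|xB] := boolP (x \in B).
  by rewrite mule1.
have -> : [set y | D (x, y)] = set0.
  by apply/seteqP; split => // y /= /hB h; move: xB; rewrite notin_setE.
by rewrite measure0 mule0.
Qed.

End ProductSections.

Section AnnularSection.
Variable R : realType.

(** With s = sqrt (1 - t^2), the product (s - |x|) (s + |x|) is at most delta while s + |x| >= 1, so
    |x| lies within delta below s: one interval of length delta for each sign of x. The condition
    |x| >= 1 / 2 excludes sections nearly tangent to the circle. *)
Lemma annular_section_le (D : set (measurableTypeR R)) (t delta : R) : measurable D -> 0 < delta ->
  (forall x : R, D x -> 2^-1 <= `|x| /\ 1 - delta < x ^+ 2 + t ^+ 2 < 1) ->
  (@lebesgue_measure R D <= (2 * delta)%:E)%E.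
Proof.
move=> mD d0 hD; pose s := Num.sqrt (1 - t ^+ 2).
pose E1 : set (measurableTypeR R) := `[s - delta, s]%classic.
pose E2 : set (measurableTypeR R) := `[- s, - s + delta]%classic.
have DE : D `<=` E1 `|` E2.
  move=> x /hD [x2 /andP[h1 h2]].
  have s0 : 0 <= s by exact: sqrtr_ge0.
  have s2 : s ^+ 2 = 1 - t ^+ 2 by rewrite sqr_sqrtr//; have := sqr_ge0 x; lra.
  have xs : `|x| <= s.
    by rewrite -(@ler_pXn2r _ 2)// ?nnegrE// real_normK ?num_real// s2; lra.
  have sx : s - `|x| <= delta.
    have : (s - `|x|) * (s + `|x|) <= delta.
      have -> : (s - `|x|) * (s + `|x|) = s ^+ 2 - `|x| ^+ 2 by ring.
      by rewrite real_normK ?num_real// s2; lra.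
    apply: le_trans; rewrite ler_peMr//; first by rewrite subr_ge0.
    lra.
  have [x0|x0] := leP 0 x.
    by left; rewrite /E1 /= in_itv /=; move: xs sx; rewrite ger0_norm//; lra.
  by right; rewrite /E2 /= in_itv /=; move: xs sx; rewrite ltr0_norm//; lra.
have mE1 : measurable E1 by exact: measurable_itv.
have mE2 : measurable E2 by exact: measurable_itv.
apply: (@le_trans _ _ (@lebesgue_measure R (E1 `|` E2))).
  by apply: le_measure => //; rewrite ?inE//; exact: measurableU.
apply: le_trans (measureU2 _ mE1 mE2) _.
have h (a b : R) : a <= b -> (@lebesgue_measure R `[a, b]%classic = (b - a)%:E)%E.
  move=> xy; rewrite lebesgue_measure_itv /= lte_fin.
  case: ifPn => [//|]; rewrite -leNgt => yx.
  by have -> : b - a = 0 by lra.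
have -> : (2 * delta)%:E = (delta%:E + delta%:E)%E by rewrite -EFinD; congr EFin; ring.
have l1 : (@lebesgue_measure R E1 <= delta%:E)%E.
  have le1 : s - delta <= s by lra.
  by rewrite /E1 (h _ _ le1) lee_fin; lra.
have l2 : (@lebesgue_measure R E2 <= delta%:E)%E.
  have le2 : - s <= - s + delta by lra.
  by rewrite /E2 (h _ _ le2) lee_fin; lra.
exact: (leeD l1 l2).
Qed.

Lemma area_cover_x (E : set (plane R)) (delta h : R) : measurable E -> 0 < delta -> 0 <= h ->
  (forall w, E w -> [/\ 2^-1 <= `|w.1 : R|, `|w.2 : R| <= h &
     1 - delta < (w.1 : R) ^+ 2 + (w.2 : R) ^+ 2 < 1]) ->
  (area R E <= (4 * h * delta)%:E)%E.
Proof.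
move=> mE d0 h0 hE.
have c0 : 0 <= 2 * delta by rewrite mulr_ge0// ltW.
have hI : (@lebesgue_measure R `[(- h)%R, h]%classic <= (2 * h)%:E)%E.
  rewrite lebesgue_measure_itv /= lte_fin; case: ifPn => [_|_].
    by rewrite -EFinB lee_fin; lra.
  by rewrite lee_fin mulr_ge0.
have h1 : ((@lebesgue_measure R \x @lebesgue_measure R)%E E <=
    (2 * delta)%:E * @lebesgue_measure R `[(- h)%R, h]%classic)%E.
  apply: (@measure_ysections_le _ _ _ _ R (@lebesgue_measure R) (@lebesgue_measure R) E (2 * delta) mE c0 `[- h, h]%classic).
  - exact: measurable_itv.
  - move=> y; apply: (@annular_section_le _ y) => //.
      rewrite (_ : [set _ | _] = ysection E y); first exact: measurable_ysection.
      by apply/seteqP; split => x; rewrite /ysection /= inE.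
    by move=> x /hE [? _ ?].
  - by move=> x y /hE [_ h1 _]; rewrite /= in_itv /= -ler_norml.
apply: (le_trans h1); apply: (le_trans (lee_wpmul2l _ hI)).
  by rewrite lee_fin.
by rewrite -EFinM lee_fin; lra.
Qed.

Lemma area_cover_y (E : set (plane R)) (delta h : R) : measurable E -> 0 < delta -> 0 <= h ->
  (forall w, E w -> [/\ 2^-1 <= `|w.2 : R|, `|w.1 : R| <= h &
     1 - delta < (w.1 : R) ^+ 2 + (w.2 : R) ^+ 2 < 1]) ->
  (area R E <= (4 * h * delta)%:E)%E.
Proof.
move=> mE d0 h0 hE.
have c0 : 0 <= 2 * delta by rewrite mulr_ge0// ltW.
have hI : (@lebesgue_measure R `[(- h)%R, h]%classic <= (2 * h)%:E)%E.
  rewrite lebesgue_measure_itv /= lte_fin; case: ifPn => [_|_].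
    by rewrite -EFinB lee_fin; lra.
  by rewrite lee_fin mulr_ge0.
have h1 : ((@lebesgue_measure R \x @lebesgue_measure R)%E E <=
    (2 * delta)%:E * @lebesgue_measure R `[(- h)%R, h]%classic)%E.
  apply: (@measure_xsections_le _ _ _ _ R (@lebesgue_measure R) (@lebesgue_measure R) E (2 * delta) mE c0 `[- h, h]%classic).
  - exact: measurable_itv.
  - move=> x; apply: (@annular_section_le _ x) => //.
      rewrite (_ : [set _ | _] = xsection E x); first exact: measurable_xsection.
      by apply/seteqP; split => y; rewrite /xsection /= inE.
    by move=> y /hE [? _ h2]; split => //; rewrite [y ^+ 2 + _]addrC.
  - by move=> x y /hE [_ h1 _]; rewrite /= in_itv /= -ler_norml.
apply: (le_trans h1); apply: (le_trans (lee_wpmul2l _ hI)).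
  by rewrite lee_fin.
by rewrite -EFinM lee_fin; lra.
Qed.

End AnnularSection.

Section RegionArea.
Variable R : realType.
Local Notation leb2 := (area R).

Definition ndisc (rho : R) : set (plane R) := [set w | normc (1 - cpt w) < rho].
Definition udisc : set (plane R) := [set w | normc (cpt w) < 1].
Definition thin (delta : R) : set (plane R) := [set w | 1 - normc (cpt w) ^+ 2 < delta].

Lemma measurable_lt_set (g : plane R -> R) (s : R) : measurable_fun setT g ->
  measurable [set w | g w < s].
Proof.
move=> mg; rewrite (_ : [set w | g w < s] = g @^-1` `]-oo, s[).
  by rewrite -[X in measurable X]setTI; apply: mg => //; exact: measurable_itv.
by apply/seteqP; split=> w; rewrite /= in_itv.
Qed.

Lemma measurable_ndisc rho : measurable (ndisc rho).
Proof.
apply: measurable_lt_set; apply: cmeasurable_normc.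
rewrite (_ : (fun _ => _) = fun w : plane R => ((1%:P - 'X) : {poly R[i]}).[cpt w]).
  by apply: cmeasurable_horner; exact: cmeasurable_cpt.
by apply/funext => w; rewrite !hornerE.
Qed.

Lemma measurable_udisc : measurable udisc.
Proof. by apply: measurable_lt_set; exact: measurable_normc_cpt. Qed.

Lemma measurable_thin delta : measurable (thin delta).
Proof.
apply: measurable_lt_set; apply: measurable_funB; first exact: measurable_cst.
by apply: measurable_funX; exact: measurable_normc_cpt.
Qed.

Lemma normc_sqr_cpt (w : plane R) : normc (cpt w) ^+ 2 = (w.1 : R) ^+ 2 + (w.2 : R) ^+ 2.
Proof. by rewrite normc_sqr. Qed.

(** For rho < 1 / 2 the first coordinate exceeds 1 / 2 and the second is below rho, which gives 4
    rho delta. For rho >= 1 / 2 the position no longer matters: if delta > 1 / 2 the bounding square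
    of area 4 suffices, and otherwise one coordinate has modulus at least 1 / 2, which leaves two
    pieces of area at most 4 delta. *)
Lemma region_area_le (rho delta : R) : 0 < rho -> 0 < delta ->
  (leb2 (udisc `&` ndisc rho `&` thin delta) <= (16 * rho * delta)%:E)%E.
Proof.
move=> rho0 d0; set E := _ `&` thin delta.
have mE : measurable E.
  by apply: measurableI; [apply: measurableI; [exact: measurable_udisc|exact: measurable_ndisc]|
     exact: measurable_thin].
have hE w : E w -> 1 - delta < (w.1 : R) ^+ 2 + (w.2 : R) ^+ 2 < 1.
  move=> [[h1 _] h2]; rewrite -normc_sqr_cpt; apply/andP; split.
    by move: h2; rewrite /thin /mkset; lra.
  by rewrite expr_lt1// normc_ge0.
have [rho2|rho2] := ltP rho 2^-1.
  apply: (@le_trans _ _ (4 * rho * delta)%:E); last first.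
    by rewrite lee_fin ler_wpM2r ?(ltW d0)// ler_wpM2r ?(ltW rho0)// ler_nat.
  apply: area_cover_x => //; first exact: ltW.
  move=> w Ew; split; last exact: hE.
    case: Ew => -[_ h] _; have := le_lt_trans (ler_Re_normc (1 - cpt w)) h => /=.
    by move=> h1; have := ler_norm (w.1 : R); have := ler_norm (1 - (w.1 : R)); lra.
  case: Ew => -[_ h] _; have := le_lt_trans (ler_Im_normc (1 - cpt w)) h => /=.
  by rewrite sub0r normrN => /ltW.
have hdisc w : E w -> `|w.1 : R| <= 1 /\ `|w.2 : R| <= 1.
  move=> [[h1 _] _]; split.
    exact: le_trans (ler_Re_normc (cpt w)) (ltW h1).
  exact: le_trans (ler_Im_normc (cpt w)) (ltW h1).
have [dl|dl] := leP delta 2^-1; last first.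
  pose S : set (plane R) := `[(-1)%R, 1%R]%classic `*` `[(-1)%R, 1%R]%classic.
  have mS : measurable S by apply: measurableX; exact: measurable_itv.
  apply: (@le_trans _ _ (leb2 S)).
    apply: le_measure => //; rewrite ?inE//.
    by move=> w /hdisc [h1 h2]; split; rewrite /= in_itv /= -ler_norml.
  have l11 : (-1 : R) <= 1 by lra.
  by rewrite /S (area_rect l11 l11) lee_fin; nra.
pose Bx : set (plane R) := [set w | `|w.1 : R| < 2^-1].
pose By : set (plane R) := [set w | `|w.2 : R| < 2^-1].
have mBx : measurable Bx.
  by apply: measurable_lt_set; apply: measurableT_comp => //; exact: measurable_fst.
have mBy : measurable By.
  by apply: measurable_lt_set; apply: measurableT_comp => //; exact: measurable_snd.
have mEx : measurable (E `\` Bx) by exact: measurableD.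
have mEy : measurable (E `\` By) by exact: measurableD.
have EU : E `<=` (E `\` Bx) `|` (E `\` By).
  move=> w Ew; have [wx|wx] := ltP `|w.1 : R| 2^-1; last first.
    by left; split => //; rewrite /Bx /= ltNge wx.
  have [wy|wy] := ltP `|w.2 : R| 2^-1; last first.
    by right; split => //; rewrite /By /= ltNge wy.
  have /andP[h _] := hE _ Ew.
  have h1 : (w.1 : R) ^+ 2 < 2^-1 ^+ 2.
    by rewrite -[_ ^+ 2]real_normK ?num_real// ltr_pXn2r// nnegrE.
  have h2 : (w.2 : R) ^+ 2 < 2^-1 ^+ 2.
    by rewrite -[_ ^+ 2]real_normK ?num_real// ltr_pXn2r// nnegrE.
  by move: h1 h2; rewrite [2^-1 ^+ 2]expr2; lra.
apply: (@le_trans _ _ (leb2 ((E `\` Bx) `|` (E `\` By)))).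
  by apply: le_measure => //; rewrite ?inE//; exact: measurableU.
apply: (le_trans (measureU2 _ mEx mEy)).
have ax : (leb2 (E `\` Bx) <= (4 * 1 * delta)%:E)%E.
  apply: area_cover_x => // w [Ew] /negP; rewrite -leNgt => h; split => //; last exact: hE.
  by have [] := hdisc _ Ew.
have ay : (leb2 (E `\` By) <= (4 * 1 * delta)%:E)%E.
  apply: area_cover_y => // w [Ew] /negP; rewrite -leNgt => h; split => //; last exact: hE.
  by have [] := hdisc _ Ew.
apply: (le_trans (leeD ax ay)); rewrite -EFinD lee_fin; nra.
Qed.

Lemma powR_le_comparable (alpha u x : R) : 0 < u -> u <= x -> x <= 2 * u ->
  x `^ alpha <= Num.max 1 (2 `^ alpha) * u `^ alpha.
Proof.
move=> u0 ux xu; have x0 : 0 < x by exact: lt_le_trans ux.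
have u20 : 0 < 2 * u by rewrite mulr_gt0.
have [a0|a0] := leP 0 alpha.
  apply: (@le_trans _ _ (2 `^ alpha * u `^ alpha)).
    rewrite -powRM ?(ltW u0)//.
    by apply: ge0_ler_powR => //; rewrite nnegrE ltW.
  by rewrite ler_wpM2r ?powR_ge0// le_max lexx orbT.
apply: (@le_trans _ _ (1 * u `^ alpha)); last first.
  by rewrite ler_wpM2r ?powR_ge0// le_max lexx.
rewrite mul1r -[alpha]opprK !(powRN _ (- alpha)) lef_pV2 ?posrE ?powR_gt0//.
by apply: ge0_ler_powR; rewrite ?nnegrE; lra.
Qed.

(** The least k for which the lower bound holds; minimality gives the upper bound, which for k = 0
    is the hypothesis. *)
Lemma dyadic_exists (s x : R) : 0 < x -> x <= s ->
  exists k, s * 2^-1 ^+ k.+1 <= x /\ x <= s * 2^-1 ^+ k.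
Proof.
move=> x0 xs; have s0 : 0 < s by exact: lt_le_trans xs.
have ex : exists k, s * 2^-1 ^+ k.+1 <= x.
  have h1 : 2^-1 < 1 :> R by lra.
  have h0 : 0 <= 2^-1 :> R by lra.
  have [N hN] := expr_small h0 h1 (divr_gt0 x0 s0).
  by exists N; rewrite mulrC -ler_pdivlMr// ltW// hN.
case: (ex_minnP ex) => k hk kmin; exists k; split => //.
case: k hk kmin => [|k] hk kmin; first by rewrite expr0 mulr1.
rewrite leNgt; apply/negP => h.
by have := kmin k (ltW h); rewrite ltnn.
Qed.

(** Layers by the size of 1 - |w|^2, which is at most 2 |1 - w| < 2 rho. The k-th layer contributes
    a multiple of rho^(alpha + 2) q^k with q = 2^-(alpha + 1), and q < 1 is the condition alpha >
    -1. *)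
Lemma weight_region_le (alpha : R) : -1 < alpha -> exists2 C : R, 0 <= C &
  forall rho : R, 0 < rho ->
  (\int[leb2]_(w in udisc `&` ndisc rho) (weight alpha w)%:E <=
   (C * rho `^ (alpha + 2))%:E)%E.
Proof.
move=> a1; pose K : R := Num.max 1 (2 `^ alpha).
have K0 : 0 <= K by rewrite le_max ler01.
pose q : R := 2^-1 `^ (alpha + 1).
have q1 : q < 1.
  have e0 : 0 < alpha + 1 by lra.
  have h1 : 2^-1 < 1 :> R by lra.
  have := @gt0_ltr_powR R (alpha + 1) e0 2^-1 1; rewrite powR1.
  by apply; rewrite ?nnegrE//; lra.
have q0 : 0 <= q by exact: powR_ge0.
exists (K * 64 / (1 - q)) => [|rho rho0].
  by rewrite divr_ge0 ?mulr_ge0// subr_ge0 ltW.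
set D := udisc `&` ndisc rho.
have mD : measurable D by apply: measurableI; [exact: measurable_udisc|exact: measurable_ndisc].
pose s k := 2 * rho * 2^-1 ^+ k.
have s0 k : 0 < s k by rewrite !mulr_gt0// exprn_gt0.
pose c k := K * (s k.+1) `^ alpha.
have c0 k : 0 <= c k by rewrite mulr_ge0 ?powR_ge0.
(* Twice [s k], because [thin] is strict while the layer contains its upper end. With the 16 of
   [region_area_le] this makes the constant 64. *)
pose A k := thin (s k + s k).
have mA k : measurable (A k) by exact: measurable_thin.
have cover w : D w -> exists k, A k w /\ weight alpha w <= c k.
  move=> [h1 h2]; move: h1 h2; rewrite /udisc /ndisc /mkset => h1 h2.
  have n0 := normc_ge0 (cpt w).
  have u0 : 0 < 1 - normc (cpt w) ^+ 2 by rewrite subr_gt0 expr_lt1.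
  have u2 : 1 - normc (cpt w) ^+ 2 <= 2 * rho.
    have := ler_distc_dist 1 (cpt w); rewrite normc1 => h3.
    have : 0 <= (1 - normc (cpt w)) ^+ 2 by exact: sqr_ge0.
    by rewrite sqrrB expr1n mul1r -mulr_natl; lra.
  have [k [k1 k2]] := dyadic_exists u0 u2.
  exists k; split.
    by rewrite /A /thin /mkset; apply: (le_lt_trans k2); rewrite ltrDl.
  apply: powR_le_comparable => //.
  by apply: (le_trans k2); rewrite /s exprS; lra.
have mw : measurable_fun D (weight alpha) by exact: measurable_weight.
have h := @integral_cover_le _ _ R leb2 D mD (fun=> 1) (weight alpha) A c
  (fun _ _ => ler01) (measurable_cst _) (fun _ _ => powR_ge0 _ _) mw mA c0 cover.
rewrite (_ : (\int[leb2]_(w in D) (weight alpha w)%:E =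
  \int[leb2]_(w in D) (1 * weight alpha w)%:E)%E); last first.
  by apply: eq_integral => w _; rewrite mul1r.
apply: (le_trans h).
apply: (@le_trans _ _ (\sum_(0 <= k <oo) (K * 64 * rho `^ (alpha + 2) * q ^+ k)%:E)%E).
  apply: lee_nneseries => [k _ _|k _].
    by rewrite mule_ge0 ?lee_fin// integral_ge0// => w _; rewrite lee_fin.
  rewrite integral_cst//; last exact: measurableI.
  rewrite mul1e; apply: (le_trans (lee_wpmul2l _ (region_area_le rho0 _))).
  - by rewrite lee_fin.
  - by rewrite addr_gt0.
  rewrite -EFinM lee_fin /c.
  have -> : s k.+1 = rho * 2^-1 ^+ k by rewrite /s exprS; lra.
  have -> : q ^+ k = (2^-1 ^+ k) `^ alpha * 2^-1 ^+ k.
    rewrite /q -powR_mulrn ?powR_ge0// powRAC powR_mulrn//.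
    by rewrite powRD ?powRr1 ?exprn_ge0// expf_neq0 ?implybT// gt_eqF.
  rewrite powRM ?exprn_ge0 ?(ltW rho0)// powRD; last by rewrite (gt_eqF rho0) implybT.
  rewrite (powR_mulrn 2 (ltW rho0)) /s.
  by rewrite le_eqVlt; apply/orP; left; apply/eqP; rewrite expr2; ring.
apply: (le_trans (nneseries_geometric_le _ q0 q1)).
  by rewrite !mulr_ge0// powR_ge0.
rewrite lee_fin le_eqVlt; apply/orP; left; apply/eqP; ring.
Qed.

End RegionArea.

(** * The operator on a Carleson measure *)

Section PowerSeriesDerivable.
Variable R : realType.

Lemma natmul_expr_le (y : R) k : 0 <= y < 1 -> k%:R * y ^+ k * (1 - y) <= 1.
Proof.
move=> /andP[y0 y1].
have h : k%:R * y ^+ k <= \sum_(0 <= i < k) y ^+ i.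
  rewrite mulr_natl -[X in _ *+ X]subn0 -sumr_const_nat.
  rewrite big_nat_cond [leRHS]big_nat_cond; apply: ler_sum => i /andP[/andP[_ ik] _].
  by rewrite ler_wiXn2l ?(ltW y1)// ltnW.
have u : 0 < 1 - y by rewrite subr_gt0.
rewrite -ler_pdivlMr// mul1r; apply: (le_trans h).
by have := @sum_geom_le R y 0 k y0 y1; rewrite expr0 mul1r.
Qed.

(** One factor y^k absorbs k by [natmul_expr_le] and the other is summed; this is why the ratio is
    written as a square. *)
Lemma sum_natmul_expr_le (y : R) m n : 0 <= y < 1 ->
  \sum_(m <= k < n) k%:R * (y ^+ 2) ^+ k <= y ^+ m / (1 - y) ^+ 2.
Proof.
move=> y01; have /andP[y0 y1] := y01; have u : 0 < 1 - y by rewrite subr_gt0.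
apply: (@le_trans _ _ (\sum_(m <= k < n) (1 - y)^-1 * y ^+ k)).
  apply: ler_sum => k _; rewrite -exprM mulnC exprM expr2 mulrA.
  rewrite ler_wpM2r ?exprn_ge0// -[leRHS]mul1r ler_pdivlMr//.
  exact: natmul_expr_le.
rewrite -mulr_sumr expr2 invfM mulrA [leRHS]mulrC.
by rewrite ler_wpM2l ?invr_ge0 ?(ltW u)// sum_geom_le.
Qed.

Lemma normc_powB_le (z w : R[i]) (rho : R) k : normc z <= rho -> normc w <= rho ->
  normc (w ^+ k - z ^+ k) <= normc (w - z) * (k%:R * rho ^+ k.-1).
Proof.
move=> zr wr; have r0 : 0 <= rho by exact: le_trans (normc_ge0 z) zr.
rewrite subrXX normcM ler_wpM2l ?normc_ge0//.
apply: le_trans (normc_sum _ _ _) _.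
apply: (@le_trans _ _ (\sum_(i < k) rho ^+ k.-1)).
  apply: ler_sum => i _; rewrite normcM !normcX.
  have -> : rho ^+ k.-1 = rho ^+ (k.-1 - i) * rho ^+ i.
    by rewrite -exprD subnK// -ltnS prednK// (leq_ltn_trans _ (ltn_ord i)).
  by apply: ler_pM; rewrite ?exprn_ge0 ?normc_ge0// lerXn2r ?nnegrE ?normc_ge0.
by rewrite sumr_const card_ord mulr_natl.
Qed.

Lemma normc_diffquot_le (z h : R[i]) k : h != 0 -> normc z <= 1 -> normc (z + h) <= 1 ->
  normc (((z + h) ^+ k - z ^+ k) / h - k%:R * z ^+ k.-1) <= normc h * (k * k)%:R.
Proof.
move=> h0 z1 zh1; have ezh : z + h - z = h by rewrite addrAC subrr add0r.
rewrite subrXX ezh mulrC mulKf//.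
have -> : k%:R * z ^+ k.-1 = \sum_(i < k) z ^+ k.-1.
  by rewrite sumr_const card_ord mulr_natl.
rewrite -sumrB; apply: le_trans (normc_sum _ _ _) _.
apply: (@le_trans _ _ (\sum_(i < k) normc h * k%:R)); last first.
  by rewrite sumr_const card_ord natrM mulrA -[leLHS]mulr_natr.
apply: ler_sum => i _.
have ki : (k.-1 - i + i = k.-1)%N by rewrite subnK// -ltnS prednK// (leq_ltn_trans _ (ltn_ord i)).
have -> : (z + h) ^+ (k.-1 - i) * z ^+ i - z ^+ k.-1 =
    ((z + h) ^+ (k.-1 - i) - z ^+ (k.-1 - i)) * z ^+ i.
  by rewrite mulrBl -exprD ki.
rewrite normcM.
have zi : normc (z ^+ i) <= 1 by rewrite normcX exprn_ile1// normc_ge0.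
have := normc_powB_le (k.-1 - i) z1 zh1.
rewrite ezh expr1n mulr1 => h1.
rewrite -[leRHS]mulr1; apply: ler_pM; rewrite ?normc_ge0//.
apply: (le_trans h1); rewrite ler_wpM2l ?normc_ge0// ler_nat.
by apply: leq_trans (leq_subr _ _) (leq_pred _).
Qed.

(** Termwise differentiation: the difference quotients [D n h] of the partial sums have tails
    bounded by C y^n uniformly in h, and for fixed n they tend to [D0 n]. Both the image of the
    operator and the test functions have bounded coefficients. *)
Lemma analytic_bounded_coef (F : R[i]^o -> R[i]^o) (b : nat -> R[i]^o) (B : R) :
  taylor_expansion F b -> (forall n, normc (b n) <= B) -> analytic_in_disc F.
Proof.
move=> Fb bB z zd; have B0 : 0 <= B by exact: le_trans (normc_ge0 _) (bB 0%N).
have nz0 := normc_ge0 z; have nz1 : normc z < 1 by [].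
(* The working radius [rho] is the midpoint of |z| and 1; y is its square root, as
   [sum_natmul_expr_le] requires. *)
pose y : R := Num.sqrt ((1 + normc z) / 2).
have y2 : y ^+ 2 = (1 + normc z) / 2 by rewrite sqr_sqrtr// divr_ge0// addr_ge0.
have y01 : 0 <= y < 1.
  rewrite sqrtr_ge0 /= -(@ltr_pXn2r _ 2)// ?nnegrE ?sqrtr_ge0// y2 expr1n; lra.
have /andP[y0 y1] := y01.
set rho := y ^+ 2 in y2.
have rho2 : 2^-1 <= rho by rewrite y2; lra.
have rho1 : rho < 1 by rewrite y2; lra.
have zrho : normc z <= rho by rewrite y2; lra.
pose D (n : nat) (h : R[i]) : R[i] := \sum_(0 <= k < n) b k * (((z + h) ^+ k - z ^+ k) / h).
pose D0 (n : nat) : R[i] := \sum_(0 <= k < n) b k * (k%:R * z ^+ k.-1).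
have krho k : k%:R * rho ^+ k.-1 <= 2 * (k%:R * rho ^+ k).
  case: k => [|k]; first by rewrite !mul0r mulr0.
  rewrite /= exprS mulrCA ler_wpM2l// mulrA ler_peMl ?exprn_ge0 ?sqr_ge0//; lra.
pose C := 2 * B / (1 - y) ^+ 2.
have C0 : 0 <= C by rewrite divr_ge0 ?sqr_ge0// mulr_ge0.
have sumC m n : \sum_(m <= k < n) B * (k%:R * rho ^+ k.-1) <= C * y ^+ m.
  apply: (@le_trans _ _ (\sum_(m <= k < n) (2 * B) * (k%:R * rho ^+ k))).
    apply: ler_sum => k _; rewrite (mulrC 2) -mulrA.
    by apply: ler_wpM2l => //; exact: krho.
  rewrite -mulr_sumr /C -[leRHS]mulrA; apply: ler_wpM2l; first exact: mulr_ge0.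
  by rewrite [leRHS]mulrC; apply: sum_natmul_expr_le.
have sub m n (u : nat -> R[i]) : (n <= m)%N ->
    \sum_(0 <= k < m) u k - \sum_(0 <= k < n) u k = \sum_(n <= k < m) u k.
  by move=> nm; rewrite (big_cat_nat (n := n))//= addrAC subrr add0r.
have tailD0 m n : (n <= m)%N -> normc (D0 m - D0 n) <= C * y ^+ n.
  move=> nm; rewrite /D0 sub//; apply: le_trans (normc_sum _ _ _) _.
  apply: le_trans (sumC n m); apply: ler_sum => k _.
  rewrite normcM; apply: ler_pM; rewrite ?normc_ge0//.
  rewrite normcM normcX -(rmorph_nat (real_complex R)) normc_real normr_nat.
  by rewrite ler_wpM2l// lerXn2r ?nnegrE ?normc_ge0 ?sqr_ge0.
have tailD m n h : h != 0 -> normc (z + h) <= rho -> (n <= m)%N ->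
    normc (D m h - D n h) <= C * y ^+ n.
  move=> h0 zh nm; rewrite /D sub//; apply: le_trans (normc_sum _ _ _) _.
  apply: le_trans (sumC n m); apply: ler_sum => k _.
  rewrite normcM; apply: ler_pM; rewrite ?normc_ge0// normcM normcV.
  have nh : 0 < normc h.
    by rewrite lt_neqAle normc_ge0 andbT eq_sym; apply: contra h0 => /eqP/eq0_normc ->.
  rewrite ler_pdivrMr//; apply: le_trans (normc_powB_le k zrho zh) _.
  by rewrite (addrC z) addrK mulrC.
have [L hL] : exists L : R[i]^o, (D0 : nat -> R[i]^o) @ \oo --> L.
  apply: cvgc_cauchy => e e0.
  have [|N hN] := @expr_small R y (e / (C + 1)) y0 y1.
    by rewrite divr_gt0//; lra.
  have small n : (N <= n)%N -> C * y ^+ n < e.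
    by move=> /hN; rewrite ltr_pdivlMr; [|lra]; have := exprn_ge0 n y0; nra.
  exists N => n m Nn Nm; have [mn|nm] := leqP m n.
    by apply: le_lt_trans (tailD0 _ _ mn) (small _ Nm).
  by rewrite normcB; apply: le_lt_trans (tailD0 _ _ (ltnW nm)) (small _ Nn).
have limD0 n : normc (L - D0 n) <= C * y ^+ n.
  have h := @cvgcB _ _ _ (D0 n) hL; apply: (cvgc_le h).
  by exists n => m nm; exact: tailD0.
have limD n h : h != 0 -> normc (z + h) <= rho ->
    normc ((F (z + h) - F z) / h - D n h) <= C * y ^+ n.
  move=> h0 zh.
  have zhd : disc (z + h : R[i]^o) by exact: le_lt_trans zh rho1.
  have c1 := cvgcM (c := h^-1) (cvgcD (Fb _ zhd) (cvgcM (c := -1) (Fb _ zd))).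
  have c2 := @cvgcB _ _ _ (D n h) c1.
  have -> : (F (z + h) - F z) / h - D n h = h^-1 * (F (z + h) + -1 * F z) - D n h.
    by rewrite mulN1r mulrC.
  apply: (cvgc_le c2); exists n => m nm.
  have -> : h^-1 * (power_series b (z + h) m + -1 * power_series b z m) = D m h.
    rewrite /D !power_seriesE mulN1r -sumrB mulr_sumr; apply: eq_bigr => k _.
    by rewrite -mulrBr; ring.
  exact: tailD.
have diffD n h : h != 0 -> normc (z + h) <= rho ->
    normc (D n h - D0 n) <= normc h * (B * \sum_(0 <= k < n) (k * k)%:R).
  move=> h0 zh; rewrite /D /D0 -sumrB; apply: le_trans (normc_sum _ _ _) _.
  rewrite !mulr_sumr; apply: ler_sum => k _; rewrite -mulrBr normcM mulrCA.
  apply: ler_pM; rewrite ?normc_ge0//.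
  by apply: normc_diffquot_le => //; [exact: ltW|apply: le_trans zh (ltW rho1)].
apply/cvg_ex; exists L; apply/cvgrPdist_lt => -[e e'] /=.
rewrite ltcE /= => /andP[/eqP -> e0] {e'}.
have [|N hN] := @expr_small R y (e / (4 * (C + 1))) y0 y1.
  by rewrite divr_gt0// mulr_gt0//; lra.
have CN : C * y ^+ N < e / 4.
  have := hN N (leqnn N); rewrite ltr_pdivlMr; last by rewrite mulr_gt0//; lra.
  by have := exprn_ge0 N y0; nra.
set S := \sum_(0 <= k < N) (k * k)%:R : R in diffD *.
have S0 : 0 <= B * S by rewrite mulr_ge0// sumr_ge0.
(* The first bound keeps z + h in the disc of radius [rho]; the second brings the truncated quotient
   within e / 4 of the truncated derivative. The two tails take another e / 4 each. *)
pose d := Num.min (rho - normc z) (e / (4 * (B * S + 1))).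
have d0 : 0 < d.
  rewrite lt_min; apply/andP; split; first by rewrite y2; lra.
  by rewrite divr_gt0// mulr_gt0//; lra.
have dC : 0 < (d%:C%C : R[i]) by rewrite ltcR.
have hd0 : \forall h \near (0 : R[i]^o)^', normc h < d.
  by have := @dnbhs0_lt R[i] R[i]^o _ dC; apply: filterS => h; rewrite normcE ltcR.
near=> h.
have h0 : h != 0 by near: h; rewrite near_withinE; apply: nearW.
have hd : normc h < d.
  by near: h; exact: hd0.
have [hd1 hd2] : normc h < rho - normc z /\ normc h < e / (4 * (B * S + 1)).
  by move: hd; rewrite /d lt_min => /andP.
have zh : normc (z + h) <= rho by have := ler_normcD z h; lra.
rewrite normcE ltcE /= eqxx /=.
have -> : h *: (1 : R[i]^o) + z = z + h by rewrite addrC [_ *: _]mulr1.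
have -> : h^-1 *: (F (z + h) - F z) = (F (z + h) - F z) / h by rewrite mulrC.
have b3 : normc (D N h - D0 N) < e / 4.
  apply: le_lt_trans (diffD N h h0 zh) _.
  move: hd2; rewrite -/S ltr_pdivlMr; last by rewrite mulr_gt0//; lra.
  have -> : normc h * (4 * (B * S + 1)) = 4 * (normc h * (B * S)) + 4 * normc h by ring.
  by have := normc_ge0 h; lra.
have b1 := limD0 N; have b2 := limD N h h0 zh.
have -> : L - (F (z + h) - F z) / h = (L - D0 N) - (D N h - D0 N)
   - ((F (z + h) - F z) / h - D N h) by ring.
apply: le_lt_trans (ler_normcB _ _) _.
have := ler_normcB (L - D0 N) (D N h - D0 N); lra.
Unshelve. all: by end_near.
Qed.

Lemma cvg_power_series_bounded (b : nat -> R[i]^o) (B : R) (z : R[i]^o) :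
  (forall n, normc (b n) <= B) -> disc z ->
  exists l : R[i]^o, power_series b z @ \oo --> l.
Proof.
move=> bB zd; have B0 : 0 <= B by exact: le_trans (normc_ge0 _) (bB 0%N).
have nz1 : normc z < 1 by [].
have u0 : 0 < 1 - normc z by rewrite subr_gt0.
apply: cvgc_cauchy => e e0.
have [|N hN] := @expr_small R (normc z) (e * (1 - normc z) / (B + 1)) (normc_ge0 z) nz1.
  by rewrite divr_gt0 ?mulr_gt0//; lra.
have tail m n : (N <= n)%N -> (n <= m)%N -> normc (power_series b z m - power_series b z n) < e.
  move=> Nn nm; rewrite !power_seriesE (big_cat_nat (n := n))//= addrAC subrr add0r.
  apply: le_lt_trans (normc_sum _ _ _) _.
  apply: (@le_lt_trans _ _ (\sum_(n <= k < m) B * normc z ^+ k)).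
    apply: ler_sum => k _; rewrite normcM normcX ler_wpM2r ?exprn_ge0 ?normc_ge0//.
  rewrite -mulr_sumr; apply: le_lt_trans (ler_wpM2l B0 (sum_geom_le n m (normc_ge0 z) nz1)) _.
  rewrite mulrA ltr_pdivrMr//; have := hN n Nn; rewrite ltr_pdivlMr; last by lra.
  by have := exprn_ge0 n (normc_ge0 z); nra.
exists N => n m Nn Nm; have [mn|nm] := leqP m n; first exact: tail.
by rewrite normcB; apply: tail => //; exact: ltnW.
Qed.

End PowerSeriesDerivable.

Lemma powR_lt_exponent (R : realType) (x b c : R) : 1 < x -> b < c -> x `^ b < x `^ c.
Proof.
move=> x1 bc; have x0 : 0 < x by exact: lt_trans x1.
by rewrite /powR !gt_eqF// ltr_expR ltr_pM2r// ln_gt0.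
Qed.

(** * Moments, and integrability against a Carleson measure *)

Section Moments.
Variables (R : realType) (mu : {finite_measure set R -> \bar R}).
Local Notation I01 := (`[(0:R), (1:R)[%classic : set R).

Let mI : measurable I01.
Proof. exact: measurable_itv. Qed.

Let muI : (mu I01 < +oo)%E.
Proof. by rewrite ltey_eq fin_num_measure. Qed.

Lemma integrable_bounded_I01 (g : R -> R) B : measurable_fun I01 g ->
  (forall t, I01 t -> `|g t| <= B) -> mu.-integrable I01 (EFin \o g).
Proof.
move=> mg gB; apply: measurable_bounded_integrable => //.
exists B; split; first exact: num_real.
by move=> M BM w /= wD; apply: le_trans (gB _ wD) (ltW BM).
Qed.

Lemma integrable_expr n : mu.-integrable I01 (fun t => (t ^+ n)%:E).
Proof.
apply: (@integrable_bounded_I01 (fun t => t ^+ n) 1).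
  exact: measurable_funX.
move=> t /=; rewrite in_itv /= => /andP[t0 t1].
by rewrite ger0_norm ?exprn_ge0// exprn_ile1// ltW.
Qed.

Lemma cmeasurable_real_expr (n : nat) :
  cmeasurable I01 (fun t : R => (t ^+ n)%:C%C).
Proof.
split; first exact: measurable_funX.
exact: measurable_cst.
Qed.

Lemma cmeasurable_sum_expr (I : Type) (s : seq I) (c : I -> R[i]) (e : I -> nat) :
  cmeasurable I01 (fun t : R => \sum_(i <- s) c i * (t ^+ e i)%:C%C).
Proof.
elim: s => [|i s IH].
  rewrite (_ : (fun _ => _) = fun=> 0); first exact: cmeasurable_cst.
  by apply/funext => t; rewrite big_nil.
rewrite (_ : (fun _ => _) = fun t : R => c i * (t ^+ e i)%:C%C +
    \sum_(i <- s) c i * (t ^+ e i)%:C%C); last by apply/funext => t; rewrite big_cons.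
apply: cmeasurableD => //; apply: cmeasurableM; first exact: cmeasurable_cst.
exact: cmeasurable_real_expr.
Qed.

Lemma moment_EFin n : ((moment mu n)%:E = \int[mu]_(t in I01) (t ^+ n)%:E)%E.
Proof. by rewrite /moment /Rintegral fineK//; apply: integrable_fin_num (integrable_expr n). Qed.

Lemma moment_sum (I : Type) (s : seq I) (r : I -> R) (e : I -> nat) :
  mu.-integrable I01 (fun t => (\sum_(i <- s) r i * t ^+ e i)%:E) /\
  ((\sum_(i <- s) r i * moment mu (e i))%:E =
   \int[mu]_(t in I01) (\sum_(i <- s) r i * t ^+ e i)%:E)%E.
Proof.
elim: s => [|i s [i1 i2]].
  under [X in mu.-integrable _ X]eq_fun do rewrite big_nil.
  under eq_integral do rewrite big_nil.
  by rewrite big_nil integral0; split => //; exact: integrable0.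
have i3 : mu.-integrable I01 (fun t => (r i)%:E * (t ^+ e i)%:E)%E.
  by apply: integrableZl => //; exact: integrable_expr.
split.
  under [X in mu.-integrable _ X]eq_fun do rewrite big_cons EFinD EFinM.
  exact: integrableD.
under eq_integral do rewrite big_cons EFinD EFinM.
rewrite integralD//= -i2 integralZl//; last exact: integrable_expr.
by rewrite -moment_EFin big_cons EFinD EFinM.
Qed.

(** The triangle inequality for a complex integrand, made real by rotating the sum. The map [e]
    admits the exponents n + k of a double sum. *)
Lemma normc_moment_sum_le (I : Type) (s : seq I) (c : I -> R[i]) (e : I -> nat) :
  ((normc (\sum_(i <- s) c i * (moment mu (e i))%:C%C))%:E <=
   \int[mu]_(t in I01) (normc (\sum_(i <- s) c i * (t ^+ e i)%:C%C))%:E)%E.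
Proof.
have [l l1 <-] := normc_phase (\sum_(i <- s) c i * (moment mu (e i))%:C%C).
rewrite mulr_sumr Re_sum.
under eq_bigr do rewrite mulrA Re_mulr_real.
have [i1 ->] := moment_sum s (fun i => complex.Re (l * c i)) e.
apply: le_integral => //.
  apply: (@integrable_bounded_I01 (fun t => normc (\sum_(i <- s) c i * (t ^+ e i)%:C%C))
     (\sum_(i <- s) normc (c i))).
    exact: cmeasurable_normc (cmeasurable_sum_expr _ _ _).
  move=> t /=; rewrite in_itv /= => /andP[t0 t1]; rewrite ger0_norm ?normc_ge0//.
  apply: le_trans (normc_sum _ _ _) _; apply: ler_sum => i _.
  rewrite normcM normc_real ger0_norm ?exprn_ge0// ler_piMr ?normc_ge0//.
  by rewrite exprn_ile1// ltW.
move=> t _; rewrite lee_fin.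
under eq_bigr do rewrite -Re_mulr_real -mulrA.
rewrite -Re_sum -mulr_sumr.
apply: le_trans (le_trans (ler_norm _) (ler_Re_normc _)) _.
by rewrite normcM l1 mul1r.
Qed.

Lemma measurable_powR_1B (b : R) : measurable_fun I01 (fun t : R => (1 - t) `^ b).
Proof.
apply: (measurableT_comp (@measurable_powR R b)).
by apply: measurable_funB; [exact: measurable_cst|exact: measurable_id].
Qed.

Lemma measurable_abel_tail (b : R) K : measurable_fun I01 (abel_tail b K).
Proof.
apply: measurable_funM; first exact: measurable_powR_1B.
apply: measurable_funM; first exact: measurable_funX.
apply: measurable_funD; first exact: measurable_cst.
apply: measurable_funM; first exact: measurable_cst.
by apply: measurable_funB; [exact: measurable_cst|exact: measurable_id].
Qed.

Hypothesis car : carleson mu.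

(** Where 1 - t lies between 2^-(k+1) and 2^-k the integrand is at most 2^((k+1) b), and the measure
    is at most C 2^-k. The ratio 2^b / 2 is below 1 because b < 1. *)
Lemma carleson_powR (b : R) : 0 <= b -> b < 1 -> exists M : R,
  (\int[mu]_(t in I01) ((1 - t) `^ (- b))%:E <= M%:E)%E.
Proof.
move=> b0 b1; have [C C0 hC] := car.
pose c k : R := (2^-1 ^+ k.+1) `^ (- b).
pose q : R := 2 `^ b / 2.
have h2 : (0 : R) < 2^-1 by rewrite invr_gt0.
have q0 : 0 <= q by rewrite divr_ge0 ?powR_ge0.
have q1 : q < 1.
  rewrite ltr_pdivrMr// mul1r -[ltRHS]powRr1//.
  by apply: powR_lt_exponent; rewrite ?ltr1n.
have ck k : c k * (C * 2^-1 ^+ k) = 2 `^ b * C * q ^+ k.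
  have -> : c k = 2 `^ b * (2 `^ b) ^+ k.
    rewrite /c -exprS -[RHS]powR_mulrn ?powR_ge0// -[RHS]powRrM.
    by rewrite exprVn -powR_invn// -powRrM; congr (_ `^ _); ring.
  by rewrite /q exprMn; ring.
exists (2 `^ b * C / (1 - q)).
pose A k : set R := `[1 - 2^-1 ^+ k, 1[%classic.
have mA k : measurable (A k) by exact: measurable_itv.
have g0 (t : R) : I01 t -> 0 <= (1 - t) `^ (- b) by move=> _; exact: powR_ge0.
have cover (t : R) : I01 t -> exists k, A k t /\ (1 - t) `^ (- b) <= c k.
  rewrite /= in_itv /= => /andP[t0 t1].
  have [k [k1 k2]] : exists k, (1:R) * 2^-1 ^+ k.+1 <= 1 - t /\ 1 - t <= (1:R) * 2^-1 ^+ k.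
    by apply: dyadic_exists; lra.
  rewrite !mul1r in k1 k2; exists k; split; first by rewrite /A /= in_itv /=; lra.
  rewrite /c !powRN lef_pV2 ?posrE ?powR_gt0 ?exprn_gt0//; last by lra.
  by apply: ge0_ler_powR; rewrite ?nnegrE ?exprn_ge0 ?(ltW h2)//; lra.
have m1 : measurable_fun I01 (fun=> 1 : R) by exact: measurable_cst.
have := integral_cover_le mu mI (fun t _ => @ler01 R) m1 g0
  (measurable_powR_1B (- b)) mA (fun k => powR_ge0 _ _) cover.
under eq_integral do rewrite mul1r.
move=> /le_trans; apply.
apply: le_trans (nneseries_geometric_le _ q0 q1); last first.
  by rewrite mulr_ge0 ?powR_ge0// ltW.
apply: lee_nneseries => [k _ _|k _].
  by rewrite mule_ge0 ?lee_fin ?powR_ge0// integral_ge0.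
rewrite integral_cst; last exact: measurableI.
rewrite mul1e -ck EFinM lee_wpmul2l ?lee_fin ?powR_ge0//.
apply: (@le_trans _ _ (mu (A k))).
  by apply: le_measure; rewrite ?inE//; exact: measurableI.
have := hC (1 - 2^-1 ^+ k).
have e1 : (2^-1 : R) ^+ k <= 1 by rewrite exprn_ile1 ?(ltW h2)// invf_le1// ler1n.
have e0 : 0 < (2^-1 : R) ^+ k by rewrite exprn_gt0.
have e2 : 0 <= 1 - (2^-1 : R) ^+ k < 1 by lra.
by move=> /(_ e2); have -> : 1 - (1 - 2^-1 ^+ k) = 2^-1 ^+ k :> R by ring.
Qed.

Variable b : R.
Hypotheses (b0 : 0 <= b) (b1 : b < 1).

Definition tail_int K : R := fine (\int[mu]_(t in I01) (abel_tail b K t)%:E)%E.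

Lemma abel_tail_le3 K (t : R) : 0 <= t < 1 -> abel_tail b K t <= 3 * (1 - t) `^ (- b).
Proof.
move=> t01; have /andP[t0 t1] := t01; rewrite /abel_tail mulrC ler_wpM2r ?powR_ge0//.
have := natmul_expr_le K t01; have : t ^+ K <= 1 by rewrite exprn_ile1// ltW.
lra.
Qed.

Lemma integrable_powR_I01 : mu.-integrable I01 (fun t => (3 * (1 - t) `^ (- b))%:E).
Proof.
have m1 := measurable_powR_1B (- b).
apply/integrableP; split.
  by apply/measurable_EFinP; apply: measurable_funM => //; exact: measurable_cst.
under eq_integral do rewrite gee0_abs ?lee_fin ?mulr_ge0 ?powR_ge0//.
rewrite intZ//; last by move=> *; exact: powR_ge0.
have [M hM] := carleson_powR b0 b1.
apply: (@le_lt_trans _ _ (3%:E * M%:E)%E); last by rewrite -EFinM ltry.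
by rewrite lee_wpmul2l// lee_fin.
Qed.

Lemma tail_intE K : (\int[mu]_(t in I01) (abel_tail b K t)%:E = (tail_int K)%:E)%E.
Proof.
rewrite /tail_int fineK// ge0_fin_numE; last first.
  by apply: integral_ge0 => t /=; rewrite in_itv /= lee_fin => ?; exact: abel_tail_ge0.
apply: (@le_lt_trans _ _ (\int[mu]_(t in I01) (3 * (1 - t) `^ (- b))%:E)%E).
  apply: int_le => //.
  - by move=> t /=; rewrite in_itv /= => ?; exact: abel_tail_ge0.
  - exact: measurable_abel_tail.
  - by apply: measurable_funM; [exact: measurable_cst|exact: measurable_powR_1B].
  by move=> t /=; rewrite in_itv /=; exact: abel_tail_le3.
have /integrableP[_] := integrable_powR_I01.
by under eq_integral do rewrite gee0_abs ?lee_fin ?mulr_ge0 ?powR_ge0//.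
Qed.

Lemma tail_int_ge0 K : 0 <= tail_int K.
Proof.
rewrite -lee_fin -tail_intE.
by apply: integral_ge0 => t /=; rewrite in_itv /= lee_fin => ?; exact: abel_tail_ge0.
Qed.

(** With t = y^2, one factor y^K absorbs the growth in K and the other tends to 0. *)
Lemma abel_tail_cvg0 (t : R) : 0 <= t < 1 -> (fun K => abel_tail b K t) @ \oo --> (0 : R).
Proof.
move=> /andP[t0 t1]; pose y := Num.sqrt t.
have y2 : y ^+ 2 = t by rewrite sqr_sqrtr.
have y0 : 0 <= y by exact: sqrtr_ge0.
have y1 : y < 1 by rewrite -(@ltr_pXn2r _ 2)// ?nnegrE// y2 expr1n.
have y01 : 0 <= y < 1 by rewrite y0 y1.
set P := (1 - t) `^ (- b); have P0 : 0 <= P by exact: powR_ge0.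
have ty : 1 - t = (1 - y) * (1 + y) by rewrite -y2; ring.
have bd K : abel_tail b K t <= P * 4 * y ^+ K.
  rewrite /abel_tail -/P -mulrA ler_wpM2l// -y2 -exprM mulnC exprM expr2 y2.
  have yK0 := exprn_ge0 K y0; have yK1 : y ^+ K <= 1 by rewrite exprn_ile1// ltW.
  have h := natmul_expr_le K y01.
  have -> : y ^+ K * y ^+ K * (2 + K%:R * (1 - t)) =
     (y ^+ K * 2 + (K%:R * y ^+ K * (1 - y)) * (1 + y)) * y ^+ K by rewrite ty; ring.
  by apply: ler_wpM2r => //; nra.
apply/cvgr_seqP => e e0.
have [|N hN] := @expr_small R y (e / (P * 4 + 1)) y0 y1.
  by rewrite divr_gt0//; lra.
exists N => n /hN; rewrite ltr_pdivlMr; last by lra.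
have := bd n; have := exprn_ge0 n y0 => h1 h2 h3.
have t01 : 0 <= t < 1 by rewrite t0 t1.
rewrite sub0r normrN ger0_norm ?abel_tail_ge0//; nra.
Qed.

Lemma tail_int_small (e : R) : 0 < e ->
  exists N, forall K, (N <= K)%N -> tail_int K < e.
Proof.
move=> e0.
have [] := @dominated_convergence _ _ _ mu I01 mI (fun K t => (abel_tail b K t)%:E)
  (fun=> 0%E) (fun t => (3 * (1 - t) `^ (- b))%:E).
- by move=> K; apply/measurable_EFinP; exact: measurable_abel_tail.
- exact: measurable_cst.
- apply: aeW => t /=; rewrite in_itv /= => t01.
  by apply: cvg_EFin; [exact: nearW|exact: abel_tail_cvg0].
- exact: integrable_powR_I01.
- apply: aeW => t K /=; rewrite in_itv /= => t01.
  by rewrite ger0_norm ?lee_fin ?abel_tail_le3 ?abel_tail_ge0.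
move=> _ _; rewrite integral0 => /fine_cvg /cvgr_seqP /(_ e e0) [N hN].
exists N => K /hN; rewrite sub0r normrN /= => h.
by apply: le_lt_trans h; exact: ler_norm.
Qed.

End Moments.

(** * Convergence of the operator and its integral majorant *)

Section HilbertIntegral.
Variables (R : realType) (mu : {finite_measure set R -> \bar R}).
Local Notation I01 := (`[(0:R), (1:R)[%classic : set R).
Hypothesis car : carleson mu.
Variables (f : R[i]^o -> R[i]^o) (a : nat -> R[i]^o) (A b : R).
Hypotheses (fa : taylor_expansion f a) (A0 : 0 <= A) (b0 : 0 <= b) (b1 : b < 1).
Hypothesis hA : forall k, normc (\sum_(0 <= i < k) a i) <= A * k%:R `^ b.

Let mI : measurable I01.
Proof. exact: measurable_itv. Qed.

Local Notation tail := (tail_int mu b).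

Let tailE K := tail_intE car b0 b1 K.

Lemma disc_real (t : R) : 0 <= t < 1 -> disc (t%:C%C : R[i]^o).
Proof.
move=> /andP[t0 t1]; rewrite /disc; change (normc (t%:C%C) < 1).
by rewrite normc_real ger0_norm.
Qed.

Lemma measurable_normc_taylor_real : measurable_fun I01 (fun t : R => normc (f t%:C%C)).
Proof.
apply: (@measurable_normc_cvg _ _ _ _ (fun n (t : R) => \sum_(k <- index_iota 0 n) a k * (t ^+ k)%:C%C)).
  by move=> n; exact: cmeasurable_sum_expr.
move=> t /=; rewrite in_itv /= => t01; have := fa (disc_real t01).
rewrite (_ : power_series a _ = fun n => \sum_(k <- index_iota 0 n) a k * (t ^+ k)%:C%C)//.
by apply/funext => n; rewrite power_seriesE; apply: eq_bigr => k _; rewrite rmorphXn.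
Qed.

Lemma hilbert_innerE n K : hilbert_inner mu a n K =
  \sum_(k <- index_iota 0 K) a k * (moment mu (n + k))%:C%C.
Proof. by rewrite /hilbert_inner /series /=; apply: eq_bigr => k _; rewrite mulrC. Qed.

(** The shift n contributes only a factor t^n <= 1, so the bound is uniform in n. The boundedness of
    the image coefficients rests on this. *)
Lemma hilbert_inner_tail n K L : (K <= L)%N ->
  normc (hilbert_inner mu a n L - hilbert_inner mu a n K) <= 3 * A * tail K.
Proof.
move=> KL; rewrite !hilbert_innerE (big_cat_nat (n := K))//= addrAC subrr add0r.
rewrite -lee_fin.
apply: le_trans (normc_moment_sum_le mu (index_iota K L) a (fun k => n + k)%N) _.
have A3 : 0 <= 3 * A by rewrite mulr_ge0.
rewrite EFinM -tailE -intZ//; last 2 first.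
- by move=> t /=; rewrite in_itv /= => ?; exact: abel_tail_ge0.
- exact: measurable_abel_tail.
apply: int_le => //.
- by move=> t _; exact: normc_ge0.
- exact: cmeasurable_normc (cmeasurable_sum_expr _ _ _).
- by apply: measurable_funM; [exact: measurable_cst|exact: measurable_abel_tail].
move=> t /=; rewrite in_itv /= => t01; have /andP[t0 t1] := t01.
have -> : \sum_(i <- index_iota K L) a i * (t ^+ (n + i))%:C%C =
    (t ^+ n)%:C%C * \sum_(K <= i < L) a i * (t ^+ i)%:C%C.
  rewrite mulr_sumr; apply: eq_bigr => i _.
  by rewrite exprD rmorphM mulrCA.
rewrite normcM normc_real ger0_norm ?exprn_ge0//.
apply: le_trans (abel_sum_le A0 b0 (ltW b1) hA t01 KL).
by rewrite ler_piMl ?normc_ge0// exprn_ile1// ltW.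
Qed.

Lemma tail_int_scaled_small (c e : R) : 0 <= c -> 0 < e ->
  exists N, forall K, (N <= K)%N -> c * tail K < e.
Proof.
move=> c0 e0; have [|N hN] := tail_int_small car b0 b1 (e := e / (c + 1)).
  by rewrite divr_gt0//; lra.
exists N => K /hN; rewrite ltr_pdivlMr; last by lra.
by have := tail_int_ge0 car b0 b1 K; nra.
Qed.

Lemma cvg_hilbert_inner n : hilbert_inner mu a n @ \oo --> hilbert_coef mu a n.
Proof.
have [l hl] : exists l : R[i]^o, hilbert_inner mu a n @ \oo --> l.
  apply: cvgc_cauchy => e e0.
  have A3 : 0 <= 3 * A by rewrite mulr_ge0.
  have [N hN] := tail_int_scaled_small A3 e0.
  exists N => k m Nk Nm; have [mk|km] := leqP m k.
    exact: le_lt_trans (hilbert_inner_tail _ mk) (hN _ Nm).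
  rewrite normcB; exact: le_lt_trans (hilbert_inner_tail _ (ltnW km)) (hN _ Nk).
by rewrite /hilbert_coef (cvgc_lim hl).
Qed.

Lemma hilbert_coef_tail n K :
  normc (hilbert_coef mu a n - hilbert_inner mu a n K) <= 3 * A * tail K.
Proof.
have h := @cvgcB _ _ _ (hilbert_inner mu a n K) (@cvg_hilbert_inner n).
by apply: (cvgc_le h); exists K => m; exact: hilbert_inner_tail.
Qed.

Lemma hilbert_coef_bounded n : normc (hilbert_coef mu a n) <= 3 * A * tail 0.
Proof.
(* The empty partial sum is 0, so the tail from 0 is the whole coefficient. *)
have := hilbert_coef_tail n 0.
by rewrite hilbert_innerE big_geq// subr0.
Qed.

Lemma cvg_hilbert_op (z : R[i]^o) : disc z ->
  power_series (hilbert_coef mu a) z @ \oo --> hilbert_op mu a z.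
Proof.
move=> /(cvg_power_series_bounded hilbert_coef_bounded) [l hl].
by rewrite /hilbert_op (cvgc_lim hl).
Qed.

Lemma hilbert_op_taylor : taylor_expansion (hilbert_op mu a) (hilbert_coef mu a).
Proof. by move=> z zd; exact: cvg_hilbert_op. Qed.

Lemma hilbert_op_analytic : analytic_in_disc (hilbert_op mu a).
Proof. exact: analytic_bounded_coef hilbert_op_taylor hilbert_coef_bounded. Qed.

Lemma hilbert_well_defined_carleson : hilbert_well_defined mu a.
Proof.
split; last exact: hilbert_op_analytic.
  by move=> n; exact: (cvgP _ (@cvg_hilbert_inner n)).
by move=> z zd; exact: (cvgP _ (cvg_hilbert_op zd)).
Qed.

(** The first bound, with 2 from |1 - w^N| <= 2, yields the kernel of the integral majorant. The
    second does not depend on t and multiplies the error terms that end up in [tail_int]. *)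
Lemma normc_geom_le (z : R[i]) (t : R) N : normc z < 1 -> 0 <= t < 1 ->
  normc (\sum_(0 <= n < N) (z * t%:C%C) ^+ n) <= 2 / normc (1 - z * t%:C%C) /\
  normc (\sum_(0 <= n < N) (z * t%:C%C) ^+ n) <= (1 - normc z)^-1.
Proof.
move=> z1 /andP[t0 t1]; set w := z * t%:C%C.
have wz : normc w <= normc z.
  by rewrite normcM normc_real ger0_norm// ler_piMr ?normc_ge0// ltW.
have w1 : normc w < 1 by exact: le_lt_trans wz z1.
have v0 : 0 < normc (1 - w).
  by have := ler_distc_dist 1 w; rewrite normc1; lra.
split.
  rewrite ler_pdivlMr// -normcM mulrC big_mkord -[_ * _]opprK -mulNr opprB -subrX1.
  rewrite opprB; apply: le_trans (ler_normcB _ _) _; rewrite normc1 normcX.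
  have : normc w ^+ N <= 1 by apply: exprn_ile1; [exact: normc_ge0|exact: ltW].
  by lra.
apply: le_trans (normc_sum _ _ _) _.
apply: (@le_trans _ _ (\sum_(0 <= n < N) normc z ^+ n)).
  apply: ler_sum => n _; rewrite normcX.
  by rewrite lerXn2r ?nnegrE ?normc_ge0.
by have := @sum_geom_le R (normc z) 0 N (normc_ge0 z) z1; rewrite expr0 mul1r.
Qed.

Lemma measurable_hilbert_kernel (z : R[i]) : normc z < 1 ->
  measurable_fun I01 (fun t : R => normc (f t%:C%C) / normc (1 - z * t%:C%C)).
Proof.
move=> z1; apply: measurable_funM; first exact: measurable_normc_taylor_real.
have m1 : measurable_fun I01 (fun t : R => normc (1 - z * t%:C%C)).
  have := cmeasurable_horner (1 - z *: 'X) (@cmeasurable_real_expr R 1).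
  move=> /cmeasurable_normc; apply: eq_measurable_fun => t _.
  by rewrite !hornerE expr1.
rewrite (_ : (fun _ => _) = (@powR R ^~ (-1)) \o (fun t : R => normc (1 - z * t%:C%C))).
  by apply: measurableT_comp => //; exact: measurable_powR.
by apply/funext => t /=; rewrite powR_inv1 ?normc_ge0.
Qed.

(** Both series are truncated, so that sums and integrals are exchanged only finitely. Replacing the
    coefficients by inner sums up to K, and then the Taylor polynomial by f, costs a factor 3 each:
    together the 6. *)
Lemma hilbert_partial_le (z : R[i]^o) N K : disc z ->
  ((normc (power_series (hilbert_coef mu a) z N))%:E <=
   (2%:E * \int[mu]_(t in I01) (normc (f t%:C%C) / normc (1 - z * t%:C%C))%:E) +
   (6 * A / (1 - normc z) * tail K)%:E)%E.
Proof.
move=> zd; have z1 : normc z < 1 by [].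
have u0 : 0 < 1 - normc z by rewrite subr_gt0.
pose G : R[i] := \sum_(n <- index_iota 0 N) \sum_(k <- index_iota 0 K)
   (z ^+ n * a k) * (moment mu (n + k))%:C%C.
have h1 : normc (power_series (hilbert_coef mu a) z N - G) <=
    3 * A / (1 - normc z) * tail K.
  rewrite power_seriesE /G -sumrB; apply: le_trans (normc_sum _ _ _) _.
  apply: (@le_trans _ _ (\sum_(0 <= n < N) (3 * A * tail K) * normc z ^+ n)).
    apply: ler_sum => n _.
    have -> : \sum_(k <- index_iota 0 K) z ^+ n * a k * (moment mu (n + k))%:C%C =
       hilbert_inner mu a n K * z ^+ n.
      by rewrite hilbert_innerE mulr_suml; apply: eq_bigr => k _; rewrite -mulrA mulrC.
    rewrite -mulrBl normcM normcX ler_wpM2r ?exprn_ge0 ?normc_ge0//.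
    exact: hilbert_coef_tail.
  rewrite -mulr_sumr [leRHS]mulrAC; apply: ler_wpM2l.
    by rewrite mulr_ge0 ?tail_int_ge0// mulr_ge0.
  by have := @sum_geom_le R (normc z) 0 N (normc_ge0 z) z1; rewrite expr0 mul1r.
pose s := [seq (n, k) | n <- index_iota 0 N, k <- index_iota 0 K].
have GE : G = \sum_(x <- s) (z ^+ x.1 * a x.2) * (moment mu (x.1 + x.2))%:C%C.
  by rewrite /s big_allpairs.
have t01P (t : R) : I01 t -> 0 <= t < 1 by rewrite /= in_itv.
have A3 : 0 <= 3 * A / (1 - normc z) by rewrite mulr_ge0 ?invr_ge0 ?(ltW u0)// mulr_ge0.
have h2 : ((normc G)%:E <=
   (2%:E * \int[mu]_(t in I01) (normc (f t%:C%C) / normc (1 - z * t%:C%C))%:E) +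
   (3 * A / (1 - normc z) * tail K)%:E)%E.
  rewrite GE; apply: le_trans (normc_moment_sum_le mu s (fun x => z ^+ x.1 * a x.2)
     (fun x => x.1 + x.2)%N) _.
  have ker0 (t : R) : 0 <= normc (f t%:C%C) / normc (1 - z * t%:C%C).
    by rewrite mulr_ge0 ?invr_ge0 ?normc_ge0.
  have ta0 (t : R) : I01 t -> 0 <= 3 * A / (1 - normc z) * abel_tail b K t.
    by move=> /t01P ?; rewrite mulr_ge0 ?abel_tail_ge0.
  have mta : measurable_fun I01 (fun t => 3 * A / (1 - normc z) * abel_tail b K t).
    by apply: measurable_funM; [exact: measurable_cst|exact: measurable_abel_tail].
  have mk := measurable_hilbert_kernel z1.
  have mk2 : measurable_fun I01 (fun t : R => 2 * (normc (f t%:C%C) / normc (1 - z * t%:C%C))).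
    by apply: measurable_funM => //; exact: measurable_cst.
  have -> : ((3 * A / (1 - normc z) * tail K)%:E =
      \int[mu]_(t in I01) (3 * A / (1 - normc z) * abel_tail b K t)%:E)%E.
    rewrite EFinM -tailE intZ//; first by move=> t /t01P ?; exact: abel_tail_ge0.
    exact: measurable_abel_tail.
  rewrite -intZ// -intD//; last by move=> t _; rewrite mulr_ge0.
  apply: int_le => //.
  - by move=> t _; exact: normc_ge0.
  - exact: cmeasurable_normc (cmeasurable_sum_expr _ _ _).
  - exact: measurable_funD.
  move=> t /t01P t01; have [g1 g2] := normc_geom_le N z1 t01.
  have -> : \sum_(x <- s) z ^+ x.1 * a x.2 * (t ^+ (x.1 + x.2))%:C%C =
     (\sum_(0 <= n < N) (z * t%:C%C) ^+ n) * power_series a t%:C%C K.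
    rewrite /s big_allpairs power_seriesE mulr_suml; apply: eq_bigr => n _.
    rewrite mulr_sumr; apply: eq_bigr => k _ /=.
    by rewrite exprD rmorphM !rmorphXn exprMn; ring.
  set g := \sum_(0 <= n < N) _ in g1 g2 *.
  have -> : g * power_series a t%:C%C K =
     g * f t%:C%C - g * (f t%:C%C - power_series a t%:C%C K).
    by rewrite -mulrBr opprB addrCA subrr addr0.
  apply: le_trans (ler_normcB _ _) _; rewrite !normcM; apply: lerD.
    rewrite mulrA mulrAC; apply: ler_wpM2r; first exact: normc_ge0.
    exact: g1.
  have -> : 3 * A / (1 - normc z) * abel_tail b K t =
    (1 - normc z)^-1 * (3 * A * abel_tail b K t) by ring.
  apply: ler_pM; rewrite ?normc_ge0//.
  exact: (taylor_abel_tail K fa A0 b0 (ltW b1) hA t01).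
apply: (@le_trans _ _ ((normc G)%:E + (3 * A / (1 - normc z) * tail K)%:E)%E).
  rewrite -EFinD lee_fin; have := ler_distc_dist (power_series (hilbert_coef mu a) z N) G.
  lra.
apply: le_trans (leeD2r _ h2) _.
rewrite -addeA -EFinD leeD2l// lee_fin le_eqVlt; apply/orP; left; apply/eqP; ring.
Qed.

(** K tends to infinity at fixed N, which removes the tail, and then N does. An infinite right-hand
    side is set apart because the last limit is taken with a real bound. *)
Lemma hilbert_op_le (z : R[i]^o) : disc z ->
  ((normc (hilbert_op mu a z))%:E <=
   2%:E * \int[mu]_(t in I01) (normc (f t%:C%C) / normc (1 - z * t%:C%C))%:E)%E.
Proof.
move=> zd; have z1 : normc z < 1 by [].
have u0 : 0 < 1 - normc z by rewrite subr_gt0.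
set J := (2%:E * _)%E.
have J0 : (0 <= J)%E.
  apply: mule_ge0 => //; apply: integral_ge0 => t _.
  by rewrite lee_fin mulr_ge0 ?invr_ge0 ?normc_ge0.
have h N : ((normc (power_series (hilbert_coef mu a) z N))%:E <= J)%E.
  apply/lee_addgt0Pr => e e0.
  have c0 : 0 <= 6 * A / (1 - normc z).
    by rewrite mulr_ge0 ?invr_ge0 ?(ltW u0)// mulr_ge0.
  have [K hK] := tail_int_scaled_small c0 e0.
  apply: le_trans (hilbert_partial_le N K zd) _.
  by rewrite leeD2l// lee_fin ltW// hK.
have [Jfin|Jinf] := boolP (J \is a fin_num); last first.
  by move: Jinf; rewrite ge0_fin_numE// -leNgt leye_eq => /eqP ->; rewrite leey.
rewrite -(fineK Jfin) lee_fin; apply: (cvgc_le (cvg_hilbert_op zd)).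
by exists 0%N => n _; rewrite -lee_fin fineK.
Qed.

End HilbertIntegral.

(** * Boundedness *)

Section PowerLemmas.
Variable R : realType.

Lemma powRVK (p x : R) : 0 < p -> 0 <= x -> (x `^ p^-1) `^ p = x.
Proof. by move=> p0 x0; rewrite -powRrM mulVf ?gt_eqF// powRr1. Qed.

Lemma powRKV (p x : R) : 0 < p -> 0 <= x -> (x `^ p) `^ p^-1 = x.
Proof. by move=> p0 x0; rewrite -powRrM mulfV ?gt_eqF// powRr1. Qed.

Lemma powR_le_cancel (p x y : R) : 0 < p -> 0 <= x -> 0 <= y ->
  x `^ p <= y `^ p -> x <= y.
Proof.
move=> p0 x0 y0; rewrite !leNgt; apply: contra => yx.
by apply: gt0_ltr_powR; rewrite ?nnegrE.
Qed.

Lemma powR_expr (x p : R) n : 0 <= x -> (x ^+ n) `^ p = (x `^ p) ^+ n.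
Proof.
move=> x0; have -> : x ^+ n = x `^ n%:R by rewrite powR_mulrn.
by rewrite -powRrM mulrC powRrM powR_mulrn ?powR_ge0.
Qed.

(** Subtraction of naturals truncates at 0, so the exponent is |i - j|; there is one geometric
    series on each side of i. *)
Lemma sum_dist_le (y : R) (i m : nat) : 0 <= y -> y < 1 ->
  \sum_(0 <= j < m) y ^+ ((i - j) + (j - i)) <= 2 / (1 - y).
Proof.
move=> y0 y1; have g n : \sum_(0 <= k < n) y ^+ k <= (1 - y)^-1.
  by have := sum_geom_le 0 n y0 y1; rewrite expr0 mul1r.
apply: (@le_trans _ _ (\sum_(0 <= j < i + m) y ^+ ((i - j) + (j - i)))).
  rewrite (big_cat_nat (n := m) (p := i + m))//= ?leq_addl// lerDl.
  by apply: sumr_ge0 => j _; exact: exprn_ge0.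
rewrite (big_cat_nat (n := i))//= ?leq_addr//.
have -> : 2 / (1 - y) = (1 - y)^-1 + (1 - y)^-1 by ring.
apply: lerD.
  apply: le_trans (g i); rewrite big_nat_rev /= add0n.
  rewrite big_nat_cond [leRHS]big_nat_cond; apply: ler_sum => j /andP[/andP[_ ji] _].
  have -> : ((i - (i - j.+1)) + (i - j.+1 - i) = j.+1)%N by lia.
  by apply: ler_wiXn2l => //; exact: ltW.
apply: le_trans (g m); rewrite (_ : \sum_(i <= j < i + m) _ =
    \sum_(0 <= j < m) y ^+ ((i - (j + i)) + (j + i - i))); last first.
    by rewrite -{1}(add0n i) big_addn addKn.
apply: ler_sum => j _.
by have -> : ((i - (j + i)) + (j + i - i) = j)%N by lia.
Qed.

End PowerLemmas.

(** * Dyadic shells and the convolution estimate *)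

Section DyadicDecomposition.
Variables (R : realType) (p alpha : R).
Hypotheses (alpha_gt : -1 < alpha) (alpha_lt : alpha < p - 2).
Local Notation area := (area R).
Local Notation udisc := (@udisc R).

Let p1 : 1 < p. Proof. by move: alpha_gt alpha_lt => *; lra. Qed.
Let p0 : 0 < p. Proof. exact: lt_trans p1. Qed.
Let a2 : 0 < alpha + 2. Proof. by move: alpha_gt => *; lra. Qed.
Let h2 : (0 : R) < 2^-1. Proof. by rewrite invr_gt0. Qed.
Let h20 : (0 : R) <= 2^-1. Proof. exact: ltW. Qed.

(** This is 2^beta, the factor by which the pointwise bound grows from one shell to the next. That
    it is below 2 is the condition alpha < p - 2. *)
Definition growth : R := 2 `^ ((alpha + 2) / p).
Local Notation b := growth.

Lemma growth_gt1 : 1 < b.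
Proof.
rewrite -[ltLHS](@powRr0 R 2); apply: powR_lt_exponent; first by rewrite ltr1n.
exact: divr_gt0.
Qed.

Lemma growth_lt2 : b < 2.
Proof.
rewrite -[ltRHS]powRr1//; apply: powR_lt_exponent; first by rewrite ltr1n.
by rewrite ltr_pdivrMr// mul1r; move: alpha_lt => *; lra.
Qed.

Let b0 : 0 < b. Proof. exact: lt_trans growth_gt1. Qed.
Let b0' : 0 <= b. Proof. exact: ltW. Qed.

Lemma growth_powR : b `^ p = 2 `^ (alpha + 2).
Proof. by rewrite /growth -powRrM divfK// gt_eqF. Qed.

Lemma growth_dyadic j : (2^-1 ^+ j) `^ (alpha + 2) * (b ^+ j) `^ p = 1.
Proof.
rewrite !powR_expr// growth_powR -exprMn -powRM// mulVf// ?pnatr_eq0//.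
by rewrite powR1 expr1n.
Qed.

Definition bergman_int (g : plane R -> R) : \bar R :=
  (\int[area]_(w in udisc) (weight alpha w * g w `^ p)%:E)%E.

Let mU : measurable udisc. Proof. exact: measurable_udisc. Qed.

Let w0 (w : plane R) : 0 <= weight alpha w. Proof. exact: powR_ge0. Qed.

(** The endpoints of each annulus have ratio 8 = 2^3, so a point lies in at most three of them. *)
Lemma annulus_overlap (w : plane R) n :
  \sum_(0 <= j < n) (\1_(annulus (2^-1 ^+ j.+2) (2 * 2^-1 ^+ j)) w : R) <= 3.
Proof.
pose v : R := 1 - normc (cpt w).
(* the indicator of the j-th annulus is at most [h j - h j.+3] *)
pose h (j : nat) : R := (v < 2 * 2^-1 ^+ j)%R%:R.
have h01 j : 0 <= h j <= 1 by rewrite /h ler0n lern1 leq_b1.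
have ind j : (\1_(annulus (2^-1 ^+ j.+2) (2 * 2^-1 ^+ j)) w : R) <= h j - h j.+3.
  rewrite indicE.
  have hj : h j.+3 <= h j.
    have e0 : (0 : R) < 2^-1 ^+ j by rewrite exprn_gt0.
    rewrite /h; case: (ltP v (2 * 2^-1 ^+ j.+3)) => [v3|_]; last by rewrite ler0n.
    have -> // : v < 2 * 2^-1 ^+ j.
    by apply: lt_trans v3 _; rewrite !exprS; lra.
  have [|_] := boolP (w \in _); last by rewrite subr_ge0.
  rewrite inE /annulus /= -/v => /andP[v1 v2].
  have -> : h j = 1 by rewrite /h v2.
  suff -> : h j.+3 = 0 by rewrite subr0 lexx.
  rewrite /h ltNge; have -> // : 2 * 2^-1 ^+ j.+3 <= v.
  by apply: ltW; apply: le_lt_trans v1; rewrite !exprS; lra.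
have tel m : \sum_(0 <= j < m) (h j - h j.+3) =
    h 0%N + h 1%N + h 2%N - h m - h m.+1 - h m.+2.
  elim: m => [|m IH]; first by rewrite big_geq//; ring.
  by rewrite big_nat_recr//= IH; ring.
apply: (@le_trans _ _ (\sum_(0 <= j < n) (h j - h j.+3))).
  by apply: ler_sum => j _; exact: ind.
rewrite tel; have := h01 0%N; have := h01 1%N; have := h01 2%N.
by have := h01 n; have := h01 n.+1; have := h01 n.+2; lra.
Qed.

(** x_j is the p-th root of a multiple of the integral over the annulus serving the j-th shell, and
    [annulus_overlap] sums these integrals, hence the 3. The factor b^p compensates for 1 - |z|
    being as small as 2^-(j+1) on the shell. *)
Lemma dyadic_bound : exists2 K : R, 0 <= K &
  forall (f : R[i]^o -> R[i]^o) (a : nat -> R[i]^o) (M : R), taylor_expansion f a ->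
  (bergman_int (fun w => normc (f (cpt w))) <= M%:E)%E ->
  exists x : nat -> R, [/\ forall j, 0 <= x j,
    forall n, \sum_(0 <= j < n) x j `^ p <= K * M &
    forall j (z : R[i]^o), 2^-1 ^+ j.+1 <= 1 - normc z -> 1 - normc z <= 2^-1 ^+ j ->
      normc (f z) <= x j * b ^+ j].
Proof.
have [K K0 hK] := @weighted_point_le R p alpha p1.
exists (K * b `^ p * 3) => [|f a M fa hM].
  by rewrite !mulr_ge0 ?powR_ge0// ltW.
pose F (w : plane R) := weight alpha w * normc (f (cpt w)) `^ p.
have F0 w : 0 <= F w by rewrite mulr_ge0 ?powR_ge0.
have mf : measurable_fun udisc (fun w => normc (f (cpt w))).
  by apply: (measurable_normc_taylor fa) => w.
have mF : measurable_fun udisc F.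
  apply: measurable_funM; first exact: measurable_weight.
  exact: (measurableT_comp (@measurable_powR R p)) mf.
pose A j : set (plane R) := annulus (2^-1 ^+ j.+2) (2 * 2^-1 ^+ j).
have mA j : measurable (A j) by exact: measurable_annulus.
have AU j : A j `<=` udisc.
  move=> w; rewrite /A /annulus /udisc /= => /andP[h _].
  have : (0 : R) < 2^-1 ^+ j.+2 by rewrite exprn_gt0.
  lra.
pose J j : R := fine (\int[area]_(w in A j) (F w)%:E)%E.
have JE j : (\int[area]_(w in A j) (F w)%:E = (J j)%:E)%E.
  rewrite /J fineK// ge0_fin_numE; last by apply: integral_ge0 => w _; rewrite lee_fin.
  apply: le_lt_trans (le_lt_trans hM (ltry M)).
  by apply: int_subset => //; exact: AU.
have J0 j : 0 <= J j by rewrite -lee_fin -JE; apply: integral_ge0 => w _; rewrite lee_fin.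
have Jsum n : \sum_(0 <= j < n) J j <= 3 * M.
  rewrite -lee_fin -sumEFin; under eq_bigr do rewrite -JE.
  have mAF j : measurable_fun udisc (fun w => (F w * \1_(A j) w)%:E).
    by apply/measurable_EFinP; apply: measurable_funM => //; exact: measurable_indic.
  have eA j : (\int[area]_(w in A j) (F w)%:E = \int[area]_(w in udisc) (F w * \1_(A j) w)%:E)%E.
    rewrite -[in LHS](setIidr (@AU j)) integral_mkcondr; apply: eq_integral => w _.
    by rewrite /patch indicE; case: ifP => h; rewrite ?h ?mulr1 ?mulr0.
  under eq_bigr do rewrite eA.
  rewrite -ge0_integral_sum//; last first.
    by move=> j w _; rewrite lee_fin mulr_ge0.
  apply: (@le_trans _ _ (\int[area]_(w in udisc) (3 * F w)%:E)%E); last first.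
    by rewrite intZ// EFinM lee_wpmul2l.
  under eq_integral do rewrite sumEFin -mulr_sumr.
  apply: int_le => //.
  - by move=> w _; rewrite mulr_ge0// sumr_ge0.
  - apply: measurable_funM => //; apply: measurable_sum => j.
    exact: measurable_indic.
  - by apply: measurable_funM => //; exact: measurable_cst.
  by move=> w _; rewrite mulrC ler_wpM2r// annulus_overlap.
have KJ0 j : 0 <= K * b `^ p * J j by rewrite !mulr_ge0 ?powR_ge0// ltW.
exists (fun j => (K * b `^ p * J j) `^ p^-1); split.
- by move=> j; exact: powR_ge0.
- move=> n; under eq_bigr do rewrite powRVK//.
  by rewrite -mulr_sumr -[leRHS]mulrA ler_wpM2l// !mulr_ge0 ?powR_ge0// ltW.
move=> j z z1 z2; set u := 1 - normc z in z1 z2.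
have e0 : (0 : R) < 2^-1 ^+ j.+1 by rewrite exprn_gt0.
have u0 : 0 < u by exact: lt_le_trans z1.
have zd : disc z by rewrite /disc /= -subr_gt0.
have bj0 k : 0 <= b ^+ k by rewrite exprn_ge0.
apply: (powR_le_cancel p0); rewrite ?normc_ge0 ?mulr_ge0 ?powR_ge0//.
rewrite powRM ?powR_ge0// powRVK//.
have h3 : normc (f z) `^ p * u `^ (alpha + 2) <= K * J j.
  rewrite -lee_fin [X in (_ <= X)%E]EFinM -JE.
  apply: le_trans (hK f a z fa zd) _; rewrite lee_wpmul2l ?lee_fin ?(ltW K0)//.
  have sub : annulus ((1 - normc z) / 2) (2 * (1 - normc z)) `<=` A j.
    move=> w; rewrite /A /annulus /= -/u => /andP[v1 v2]; apply/andP; split.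
      by apply: le_lt_trans v1; rewrite exprS; lra.
    by apply: lt_le_trans v2 _; lra.
  exact: (int_subset area (mA j) (measurable_annulus _ _) sub (fun w _ => F0 w)
    (measurable_funS mU (@AU j) mF)).
have h4 : (2^-1 ^+ j.+1) `^ (alpha + 2) <= u `^ (alpha + 2).
  by apply: ge0_ler_powR; rewrite ?nnegrE ?(ltW u0) ?(ltW e0) ?(ltW a2).
have h5 := growth_dyadic j.+1.
have h6 : normc (f z) `^ p * (2^-1 ^+ j.+1) `^ (alpha + 2) <= K * J j.
  by apply: le_trans h3; rewrite ler_wpM2l ?powR_ge0.
rewrite -[leLHS]mulr1 -h5 mulrA.
have -> : K * b `^ p * J j * (b ^+ j) `^ p = K * J j * (b ^+ j.+1) `^ p.
  by rewrite exprS powRM//; ring.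
by rewrite ler_wpM2r ?powR_ge0.
Qed.

(** For i <= j the decay is (b / 2)^(j - i), for j <= i it is b^-(i - j); [y] is a common bound of
    the two rates, which lie below 1 because 1 < b < 2. *)
Lemma kernel_sum_le (x : nat -> R) (y : R) i :
  b^-1 <= y -> b / 2 <= y -> (forall j, 0 <= x j) -> forall j,
  x j * b ^+ j * 2^-1 ^+ j * 2 ^+ minn i j <= b ^+ i * (x j * y ^+ ((i - j) + (j - i))).
Proof.
move=> y1 y2 x0 j.
have c0 : 0 <= b^-1 by rewrite invr_ge0.
have d0 : 0 <= b / 2 by rewrite divr_ge0.
have bN : b != 0 by rewrite gt_eqF.
have two_pow n : (2^-1 : R) ^+ n * 2 ^+ n = 1.
  by rewrite -exprMn mulVf ?expr1n// pnatr_eq0.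
have [ij|/ltnW ji] := leqP i j.
  have -> : (i - j = 0)%N by apply/eqP; rewrite subn_eq0.
  have -> : x j * b ^+ j * 2^-1 ^+ j * 2 ^+ i = b ^+ i * (x j * (b / 2) ^+ (j - i)).
    have -> : b ^+ j = b ^+ (j - i) * b ^+ i by rewrite -exprD subnK.
    have -> : (2^-1 : R) ^+ j = 2^-1 ^+ (j - i) * 2^-1 ^+ i by rewrite -exprD subnK.
    rewrite exprMn; transitivity (b ^+ i * (x j * (b ^+ (j - i) * 2^-1 ^+ (j - i))) * (2^-1 ^+ i * 2 ^+ i)).
      by ring.
    by rewrite two_pow mulr1.
  by rewrite ler_wpM2l ?exprn_ge0// ler_wpM2l// lerXn2r ?nnegrE// (le_trans d0).
have -> : (j - i = 0)%N by apply/eqP; rewrite subn_eq0.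
have -> : x j * b ^+ j * 2^-1 ^+ j * 2 ^+ j = b ^+ i * (x j * b^-1 ^+ (i - j)).
  have -> : b ^+ i = b ^+ (i - j) * b ^+ j by rewrite -exprD subnK.
  transitivity (x j * b ^+ j * (2^-1 ^+ j * 2 ^+ j)); first by ring.
  rewrite two_pow mulr1; transitivity (x j * b ^+ j * (b ^+ (i - j) * b^-1 ^+ (i - j))).
    by rewrite -exprMn mulfV// expr1n mulr1.
  by ring.
by rewrite addn0 ler_wpM2l ?exprn_ge0// ler_wpM2l// lerXn2r ?nnegrE// (le_trans c0).
Qed.

(** The core of both directions: x comes from f in the sufficiency part and from a single shell for
    the test function. It is a discrete Young inequality for convolution with a geometric kernel,
    where one half of the decay is paired with a supremum, so that no conjugate exponents appear. *)
Lemma kernel_weight_le : exists2 K : R, 0 <= K &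
  forall (g : plane R -> R) (x : nat -> R) (M : R),
  measurable_fun udisc g -> (forall w, udisc w -> 0 <= g w) ->
  (forall j, 0 <= x j) -> (forall n, \sum_(0 <= j < n) x j `^ p <= M) ->
  (forall w i, udisc w -> 2^-1 ^+ i <= normc (1 - cpt w) ->
    ((g w)%:E <= \sum_(0 <= j <oo) (x j * b ^+ j * 2^-1 ^+ j * 2 ^+ minn i j)%:E)%E) ->
  (bergman_int g <= (K * M)%:E)%E.
Proof.
have [C C0 hC] := weight_region_le alpha_gt.
pose q := Num.max b^-1 (b / 2).
have b1 := growth_gt1; have b2 := growth_lt2.
have q0 : 0 < q by rewrite lt_max invr_gt0 b0.
have q1 : q < 1.
  rewrite gt_max; apply/andP; split; first by rewrite invf_lt1.
  by rewrite ltr_pdivrMr// mul1r.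
(* Half of the decay [q ^ d = h ^ d * h ^ d] is spent on summing over [j], the
   other half stays in [T i] and is summed over [i]. *)
pose h := Num.sqrt q.
have hh : h ^+ 2 = q by rewrite sqr_sqrtr// ltW.
have h0 : 0 <= h by exact: sqrtr_ge0.
have h1 : h < 1 by rewrite -(@ltr_pXn2r _ 2)// ?nnegrE// hh expr1n.
pose hp := h `^ p.
have hp0 : 0 <= hp by exact: powR_ge0.
have hp1 : hp < 1.
  have : h `^ p < 1 `^ p by apply: gt0_ltr_powR; rewrite ?nnegrE.
  by rewrite powR1.
pose S := 2 / (1 - h); have S0 : 0 <= S by rewrite divr_ge0// subr_ge0 ltW.
pose Sp := 2 / (1 - hp); have Sp0 : 0 <= Sp by rewrite divr_ge0// subr_ge0 ltW.
have hS i n : \sum_(0 <= j < n) h ^+ ((i - j) + (j - i)) <= S by exact: sum_dist_le.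
have hSp i n : \sum_(0 <= j < n) hp ^+ ((i - j) + (j - i)) <= Sp by exact: sum_dist_le.
clearbody S Sp.
exists (S `^ p * (C * 4 `^ (alpha + 2)) * Sp).
  by rewrite !mulr_ge0 ?powR_ge0.
move=> g x M mg g0 x0 xM hg.
pose dist i j := ((i - j) + (j - i))%N.
pose T i : \bar R := (\sum_(0 <= j <oo) (hp ^+ dist i j * x j `^ p)%:E)%E.
have xp0 j : 0 <= x j `^ p by exact: powR_ge0.
have t0 i j : 0 <= hp ^+ dist i j * x j `^ p by rewrite mulr_ge0 ?exprn_ge0.
have TM i : (T i <= M%:E)%E.
  apply: nneseries_le => n; rewrite ?sumEFin lee_fin//.
  apply: le_trans (xM n); apply: ler_sum => j _.
  by rewrite ler_piMl// exprn_ile1// ltW.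
have T0 i : (0 <= T i)%E by apply: nneseries_ge0 => *; rewrite lee_fin.
pose t i := fine (T i).
have tE i : T i = (t i)%:E.
  by rewrite /t fineK// ge0_fin_numE// (le_lt_trans (TM i))// ltry.
have ti0 i : 0 <= t i by rewrite -lee_fin -tE.
(* The p-th power of the left side is one term of the series [T i]. *)
have xT i j : x j * h ^+ dist i j <= t i `^ p^-1.
  apply: (powR_le_cancel p0); rewrite ?mulr_ge0 ?exprn_ge0 ?powR_ge0//.
  rewrite powRVK// powRM ?exprn_ge0// powR_expr// -/hp mulrC -lee_fin -tE.
  apply: (@nneseries_term_le R (fun j => (hp ^+ dist i j * x j `^ p)%:E) j) => n.
  by rewrite lee_fin.
(* After exchanging the sums, each x_j^p is weighted by a geometric sum over i. *)
have tsum n : \sum_(0 <= i < n) t i <= Sp * M.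
  rewrite -lee_fin -sumEFin; under eq_bigr do rewrite -tE.
  rewrite -nneseries_sum; last by move=> *; rewrite lee_fin.
  apply: nneseries_le => m; first by apply: sume_ge0 => *; rewrite lee_fin.
  under eq_bigr do rewrite sumEFin -mulr_suml.
  rewrite sumEFin lee_fin.
  apply: (@le_trans _ _ (\sum_(0 <= j < m) Sp * x j `^ p)).
    apply: ler_sum => j _; rewrite ler_wpM2r//.
    under eq_bigr do rewrite /dist addnC.
    exact: hSp.
  by rewrite -mulr_sumr ler_wpM2l.
pose c i := S `^ p * (b ^+ i) `^ p * t i.
have c0 i : 0 <= c i by rewrite !mulr_ge0 ?powR_ge0.
(* The i-th piece satisfies |1 - w| <= 2 * 2^-i; the 4 makes the inequality strict. *)
pose A i : set (plane R) := ndisc (4 * 2^-1 ^+ i).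
have gc w : udisc w -> exists k, A k w /\ g w `^ p <= c k.
  move=> wU; have nw : 0 < normc (1 - cpt w).
    by have := ler_distc_dist 1 (cpt w); rewrite normc1; move: wU; rewrite /udisc /=; lra.
  have nw2 : normc (1 - cpt w) <= 2.
    by have := ler_normcB 1 (cpt w); rewrite normc1; move: wU; rewrite /udisc /=; lra.
  have [k [k1 k2]] := dyadic_exists nw nw2.
  have e0 : (0 : R) < 2^-1 ^+ k by rewrite exprn_gt0.
  exists k; split.
    by apply: le_lt_trans k2 _; rewrite ltr_pM2r// ltr_nat.
  have ek : 2^-1 ^+ k <= normc (1 - cpt w).
    by move: k1; rewrite exprS mulrA mulfV ?mul1r// pnatr_eq0.
  have gS : g w <= S * b ^+ k * t k `^ p^-1.
    rewrite -lee_fin; apply: le_trans (hg w k wU ek) _.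
    apply: nneseries_le => n.
      by rewrite lee_fin !mulr_ge0 ?exprn_ge0.
    rewrite sumEFin lee_fin.
    apply: (@le_trans _ _ (\sum_(0 <= j < n) (b ^+ k * t k `^ p^-1) * h ^+ dist k j)).
      apply: ler_sum => j _.
      have qb1 : b^-1 <= q by rewrite le_max lexx.
      have qb2 : b / 2 <= q by rewrite le_max lexx orbT.
      apply: le_trans (kernel_sum_le k qb1 qb2 x0 j) _.
      rewrite -hh -exprM mulnC exprM -mulrA ler_wpM2l ?exprn_ge0//.
      by rewrite expr2 mulrA ler_wpM2r ?exprn_ge0// xT.
    rewrite -mulr_sumr -[leRHS]mulrA [leRHS]mulrC; apply: ler_wpM2l.
      by rewrite mulr_ge0 ?exprn_ge0 ?powR_ge0.
    exact: hS.
  have bk0 : 0 <= b ^+ k by exact: exprn_ge0.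
  have -> : c k = (S * b ^+ k * t k `^ p^-1) `^ p.
    by rewrite !powRM ?mulr_ge0 ?powR_ge0// powRVK.
  apply: ge0_ler_powR; rewrite ?nnegrE ?(ltW p0) ?g0//.
  by rewrite !mulr_ge0 ?powR_ge0.
have mgp : measurable_fun udisc (fun w => g w `^ p).
  exact: (measurableT_comp (@measurable_powR R p)) mg.
have mA k : measurable (A k) by exact: measurable_ndisc.
have gp0 w : udisc w -> 0 <= g w `^ p by move=> _; exact: powR_ge0.
apply: le_trans (integral_cover_le area mU (fun w _ => w0 w)
  (@measurable_weight R alpha udisc) gp0 mgp mA c0 gc) _.
apply: nneseries_le => n.
  by rewrite mule_ge0 ?lee_fin// integral_ge0// => *; rewrite lee_fin.
apply: (@le_trans _ _ (\sum_(0 <= i < n) (S `^ p * (C * 4 `^ (alpha + 2)) * t i)%:E)%E).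
  apply: lee_sum => i _.
  have r0 : (0 : R) < 4 * 2^-1 ^+ i by rewrite mulr_gt0// exprn_gt0.
  apply: le_trans (lee_wpmul2l _ (hC _ r0)) _; first by rewrite lee_fin.
  rewrite -EFinM lee_fin powRM ?exprn_ge0//.
  have := growth_dyadic i; set X := (2^-1 ^+ i) `^ _; set Y := (b ^+ i) `^ p => XY.
  rewrite /c -/Y.
  have -> : S `^ p * Y * t i * (C * (4 `^ (alpha + 2) * X)) =
    S `^ p * (C * 4 `^ (alpha + 2)) * t i * (X * Y) by ring.
  by rewrite XY mulr1.
rewrite sumEFin lee_fin -mulr_sumr -[leRHS]mulrA ler_wpM2l//.
by rewrite !mulr_ge0 ?powR_ge0.
Qed.

End DyadicDecomposition.

Section Boundedness.
Variables (R : realType) (p alpha : R).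
Hypotheses (alpha_gt : -1 < alpha) (alpha_lt : alpha < p - 2).
Local Notation b := (growth p alpha).
Local Notation bint f := (bergman_int p alpha (fun w => normc (f (cpt w)))).

Let p1 : 1 < p. Proof. by move: alpha_gt alpha_lt => *; lra. Qed.
Let p0 : 0 < p. Proof. exact: lt_trans p1. Qed.
Let b1 : 1 < b. Proof. exact: growth_gt1. Qed.
Let b0 : 0 < b. Proof. exact: lt_trans b1. Qed.

(** A single x_j is at most the p-th root of the whole sum, and b^j <= (1 - |z|)^-beta on the j-th
    shell. *)
Lemma growth_le_powR : exists2 K : R, 0 <= K &
  forall (f : R[i]^o -> R[i]^o) (a : nat -> R[i]^o) (M : R) (z : R[i]^o),
  taylor_expansion f a -> (bint f <= M%:E)%E -> disc z ->
  normc (f z) <= (K * M) `^ p^-1 * (1 - normc z) `^ (- ((alpha + 2) / p)).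
Proof.
have [K K0 hK] := dyadic_bound alpha_gt alpha_lt.
exists K => // f a M z fa fM zd; have [x [x0 xs hx]] := hK f a M fa fM.
have KM0 : 0 <= K * M by have := xs 0%N; rewrite big_geq.
have u0 : 0 < 1 - normc z by rewrite subr_gt0.
have u1 : 1 - normc z <= 1 by rewrite lerBlDr lerDl normc_ge0.
have [j [j1 j2]] := dyadic_exists u0 u1; rewrite !mul1r in j1 j2.
apply: le_trans (hx j z j1 j2) _.
have bj0 : 0 <= b ^+ j by rewrite exprn_ge0// ltW.
apply: ler_pM => //.
  apply: (powR_le_cancel p0); rewrite ?powR_ge0//.
  rewrite powRVK//; apply: le_trans (xs j.+1); rewrite big_nat_recr//= lerDr.
  by apply: sumr_ge0 => i _; exact: powR_ge0.
apply: (powR_le_cancel p0); rewrite ?powR_ge0//.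
have := growth_dyadic alpha_gt alpha_lt j; set X := _ `^ (alpha + 2) => XY.
have X0 : 0 < X by rewrite powR_gt0// exprn_gt0// invr_gt0.
rewrite -powRrM mulNr divfK ?gt_eqF// powRN.
rewrite -(ler_pM2l X0) XY ler_pdivlMr ?powR_gt0// mul1r.
by apply: ge0_ler_powR; rewrite ?nnegrE ?exprn_ge0 ?invr_ge0// ltW//; move: alpha_gt; lra.
Qed.

(** |1 - z t| is at least 1 - t, and at least |1 - z| / 2 because 1 - z = (1 - z t) - z (1 - t). *)
Lemma normc_1BM_ge (z : R[i]) (t : R) i j : normc z < 1 -> 0 <= t <= 1 ->
  2^-1 ^+ i <= normc (1 - z) -> 2^-1 ^+ j.+1 <= 1 - t ->
  (normc (1 - z * t%:C%C))^-1 <= 2 * 2 ^+ minn i j.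
Proof.
move=> z1 /andP[t0 t1] zi tj.
set v := normc (1 - z * t%:C%C).
have zt : normc (z * t%:C%C) <= t.
  by rewrite normcM normc_real ger0_norm// ler_piMl// ltW.
have v1 : 1 - t <= v by have := ler_distc_dist 1 (z * t%:C%C); rewrite normc1 -/v; lra.
have v2 : normc (1 - z) <= 2 * v.
  have -> : 1 - z = (1 - z * t%:C%C) - z * (1 - t)%:C%C by rewrite rmorphB rmorph1; ring.
  apply: le_trans (ler_normcB _ _) _; rewrite -/v normcM normc_real ger0_norm ?subr_ge0//.
  have : normc z * (1 - t) <= 1 - t by rewrite ler_piMl ?subr_ge0// ltW.
  by lra.
have ei k : 0 < (2^-1 : R) ^+ k by rewrite exprn_gt0// invr_gt0.
have v0 : 0 < v by have := ei j.+1; lra.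
have inv k : 2^-1 ^+ k <= 2 * v -> v^-1 <= 2 * 2 ^+ k.
  move=> hk; rewrite -ler_pdivrMl//.
  have -> : 2^-1 / v = (2 * v)^-1 by rewrite invfM.
  have -> : 2 ^+ k = (2^-1 ^+ k)^-1 :> R by rewrite exprVn invrK.
  by rewrite lef_pV2 ?posrE ?mulr_gt0.
rewrite /minn; case: ifP => _; apply: inv; first exact: le_trans zi v2.
by move: tj; rewrite exprS; lra.
Qed.

Section Operator.
Variable mu : {finite_measure set R -> \bar R}.
Hypothesis car : carleson mu.

Lemma carleson_summable (f : R[i]^o -> R[i]^o) (a : nat -> R[i]^o) (M : R) :
  taylor_expansion f a -> (bint f <= M%:E)%E ->
  exists A c : R, [/\ 0 <= A, 0 <= c, c < 1 &
    forall k, normc (\sum_(0 <= i < k) a i) <= A * k%:R `^ c].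
Proof.
move=> fa fM; have [K K0 hK] := growth_le_powR.
pose be := (alpha + 2) / p.
have be0 : 0 <= be by rewrite divr_ge0 ?(ltW p0)//; move: alpha_gt; lra.
have be1 : be < 1 by rewrite ltr_pdivrMr// mul1r; move: alpha_lt; lra.
(* The midpoint of beta and 1 leaves room for the logarithm and stays below 1, as integrability
   against [mu] requires. *)
have bec : be < (be + 1) / 2 by lra.
have [A A0 hA] := partial_sum_le fa (powR_ge0 (K * M) p^-1) be0 bec
  (fun z zd => hK f a M z fa fM zd).
by exists A, ((be + 1) / 2); split=> //; lra.
Qed.

(** Covering [0, 1) by the intervals [B j], of measure at most C 2^-j, brings the integral majorant
    to the form of [kernel_weight_le] with x_j multiplied by 4 C: 2 from [hilbert_op_le], 2 from
    [normc_1BM_ge] and C from the measure. *)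
Lemma hilbert_bergman_int_le : exists2 K : R, 0 <= K &
  forall (f : R[i]^o -> R[i]^o) (a : nat -> R[i]^o) (M : R), taylor_expansion f a ->
  (bint f <= M%:E)%E -> (bint (hilbert_op mu a) <= (K * M)%:E)%E.
Proof.
have [K1 K10 hK1] := dyadic_bound alpha_gt alpha_lt.
have [K2 K20 hK2] := kernel_weight_le alpha_gt alpha_lt.
have [C C0 hC] := car; have C0' := ltW C0.
have C40 : 0 <= 4 * C by rewrite mulr_ge0.
exists (K2 * ((4 * C) `^ p * K1)) => [|f a M fa fM].
  by rewrite !mulr_ge0 ?powR_ge0.
have [x [x0 xs hx]] := hK1 f a M fa fM.
have [A [c [A0 c0 c1 hA]]] := carleson_summable fa fM.
pose I01 : set R := `[0, 1[%classic.
have mI : measurable I01 by exact: measurable_itv.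
rewrite -mulrA; apply: (hK2 _ (fun j => 4 * C * x j)).
- by apply: (measurable_normc_taylor (hilbert_op_taylor car A0 c0 c1 hA)) => w.
- by move=> w _; exact: normc_ge0.
- by move=> j; rewrite mulr_ge0.
- move=> n; under eq_bigr do rewrite powRM//.
  by rewrite -mulr_sumr -mulrA ler_wpM2l ?powR_ge0.
move=> w i wU wi.
apply: le_trans (hilbert_op_le car fa A0 c0 c1 hA wU) _.
pose F (t : R) := normc (f t%:C%C) / normc (1 - cpt w * t%:C%C).
have F0 t : 0 <= F t by rewrite mulr_ge0 ?invr_ge0 ?normc_ge0.
have mF : measurable_fun I01 F.
  exact: (measurable_hilbert_kernel fa wU).
pose B j : set R := `[1 - 2^-1 ^+ j, 1[%classic.
have mB j : measurable (B j) by exact: measurable_itv.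
pose d j : R := x j * b ^+ j * (2 * 2 ^+ minn i j).
have d0 j : 0 <= d j by rewrite !mulr_ge0 ?exprn_ge0// ltW.
have cover (t : R) : I01 t -> exists k, B k t /\ F t <= d k.
  rewrite /I01 /= in_itv /= => /andP[t0 t1].
  have u0 : 0 < 1 - t by rewrite subr_gt0.
  have u1 : 1 - t <= 1 by rewrite lerBlDr lerDl.
  have [k [k1 k2]] := dyadic_exists u0 u1; rewrite !mul1r in k1 k2.
  have nt : normc (t%:C%C) = t by rewrite normc_real ger0_norm.
  exists k; split.
    by rewrite /B /= in_itv /= t1 andbT lerBlDr -lerBlDl.
  rewrite /F /d; apply: ler_pM; rewrite ?invr_ge0 ?normc_ge0//.
    by apply: hx; rewrite nt.
  by apply: normc_1BM_ge => //; rewrite t0 ltW.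
have m1 : measurable_fun I01 (fun=> 1 : R) by exact: measurable_cst.
have h := integral_cover_le mu mI (fun t _ => @ler01 R) m1 (fun t _ => F0 t) mF mB d0 cover.
have {}h : (\int[mu]_(t in I01) (F t)%:E <=
    \sum_(0 <= k <oo) ((d k * (C * 2^-1 ^+ k))%:E))%E.
  have -> : (\int[mu]_(t in I01) (F t)%:E = \int[mu]_(t in I01) (1 * F t)%:E)%E.
    by apply: eq_integral => t _; rewrite mul1r.
  apply: le_trans h _; apply: lee_nneseries => [k _ _|k _].
    by rewrite mule_ge0 ?lee_fin// integral_ge0.
  rewrite integral_cst; last exact: measurableI.
  rewrite mul1e (EFinM (d k)) lee_wpmul2l ?lee_fin//.
  apply: (@le_trans _ _ (mu (B k))).
    by apply: le_measure; rewrite ?inE//; exact: measurableI.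
  have := hC (1 - 2^-1 ^+ k).
  have e1 : (2^-1 : R) ^+ k <= 1 by rewrite exprn_ile1 ?invr_ge0// invf_le1// ler1n.
  have e0 : 0 < (2^-1 : R) ^+ k by rewrite exprn_gt0// invr_gt0.
  have e2 : 0 <= 1 - (2^-1 : R) ^+ k < 1 by lra.
  by move=> /(_ e2); have -> : 1 - (1 - 2^-1 ^+ k) = 2^-1 ^+ k :> R by ring.
apply: le_trans (lee_wpmul2l _ h) _ => //.
have dk0 k : (0 <= (d k * (C * 2^-1 ^+ k))%:E)%E.
  by rewrite lee_fin mulr_ge0// mulr_ge0// exprn_ge0// invr_ge0.
rewrite -(nneseriesZl 2 0 (fun k _ => dk0 k)).
apply: lee_nneseries => [k _ _|k _].
  by rewrite mule_ge0.
rewrite -EFinM lee_fin le_eqVlt; apply/orP; left; apply/eqP.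
by rewrite /d; ring.
Qed.

End Operator.
End Boundedness.

(** * Necessity *)

Section Necessity.
Variables (R : realType) (p alpha : R).
Hypotheses (alpha_gt : -1 < alpha) (alpha_lt : alpha < p - 2).
Local Notation b := (growth p alpha).
Local Notation bint f := (bergman_int p alpha (fun w => normc (f (cpt w)))).

Let p1 : 1 < p. Proof. by move: alpha_gt alpha_lt => *; lra. Qed.
Let p0 : 0 < p. Proof. exact: lt_trans p1. Qed.
Let b1 : 1 < b. Proof. exact: growth_gt1. Qed.
Let b2 : b < 2. Proof. exact: growth_lt2. Qed.
Let b0 : 0 < b. Proof. exact: lt_trans b1. Qed.

Definition geom (r : R) (z : R[i]^o) : R[i]^o := (1 - z * r%:C%C)^-1.
Definition geom_coef (r : R) (k : nat) : R[i]^o := (r ^+ k)%:C%C.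

Lemma cvgc_Re_ge (u : nat -> R[i]^o) (l : R[i]^o) (M : R) :
  u @ \oo --> l -> (exists N, forall n, (N <= n)%N -> M <= complex.Re (u n)) ->
  M <= complex.Re l.
Proof.
have ReB (x y : R[i]) : complex.Re (x - y) = complex.Re x - complex.Re y.
  by case: x y => ? ? [].
move=> /cvgc_seqP ul [N hN]; apply/ler_addgt0Pr => e e0.
have [N' hN'] := ul e e0; have {hN} := hN (maxn N N') (leq_maxl _ _).
have {hN'} := hN' (maxn N N') (leq_maxr _ _).
set n := maxn N N'; move=> h1 h2.
have : complex.Re (u n) - complex.Re l <= normc (l - u n).
  rewrite normcB; apply: le_trans (le_trans (ler_norm _) (ler_Re_normc (u n - l))).
  by rewrite ReB.
lra.
Qed.

Lemma normc_geom_base_gt0 (r : R) (z : R[i]) : 0 <= r < 1 -> normc z < 1 ->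
  normc (z * r%:C%C) < 1 /\ 0 < normc (1 - z * r%:C%C).
Proof.
move=> /andP[r0 r1] z1.
have h : normc (z * r%:C%C) < 1.
  rewrite normcM normc_real ger0_norm//; apply: le_lt_trans r1.
  by rewrite ler_piMl// ltW.
by split=> //; have := ler_distc_dist 1 (z * r%:C%C); rewrite normc1; lra.
Qed.

Lemma geom_taylor (r : R) : 0 <= r < 1 -> taylor_expansion (geom r) (geom_coef r).
Proof.
move=> r01 z zd; have [w1 v0] := normc_geom_base_gt0 r01 zd.
apply/cvgc_seqP => e e0.
have [N hN] := expr_small (normc_ge0 _) w1 (mulr_gt0 e0 v0).
exists N => n /hN h; rewrite power_seriesE.
have -> : \sum_(0 <= k < n) geom_coef r k * z ^+ k = \sum_(k < n) (z * r%:C%C) ^+ k.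
  by rewrite big_mkord; apply: eq_bigr => k _; rewrite /geom_coef exprMn rmorphXn mulrC.
set w := z * r%:C%C in w1 v0 h *.
have nz : 1 - w != 0 by apply: contraTneq v0 => ->; rewrite normc0 ltxx.
have -> : geom r z - \sum_(k < n) w ^+ k = w ^+ n / (1 - w).
  apply: (mulIf nz); rewrite mulrBl mulVf// divfK//.
  have := subrX1 w n => e1.
  have -> : (\sum_(k < n) w ^+ k) * (1 - w) = - ((w - 1) * \sum_(k < n) w ^+ k) by ring.
  by rewrite -e1; ring.
by rewrite normcM normcV normcX ltr_pdivrMr.
Qed.

Lemma geom_analytic (r : R) : 0 <= r < 1 -> analytic_in_disc (geom r).
Proof.
move=> r01; have /andP[r0 r1] := r01.
apply: (analytic_bounded_coef (geom_taylor r01) (B := 1)) => n.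
by rewrite /geom_coef normc_real ger0_norm ?exprn_ge0// exprn_ile1// ltW.
Qed.

(** By [normc_1BM_ge], 1 / |1 - r z| is at most 2 * 2^min(i, N), the kernel of [kernel_weight_le]
    for a sequence carried by the index N. Its value X = 2 (2 / b)^N makes x_N b^N 2^-N equal to
    2. *)
Lemma geom_int_le : exists2 K : R, 0 <= K & forall (r : R) N, 0 <= r < 1 ->
  2^-1 ^+ N.+1 <= 1 - r -> (bint (geom r) <= (K * (2 ^+ N / b ^+ N) `^ p)%:E)%E.
Proof.
have [K K0 hK] := kernel_weight_le alpha_gt alpha_lt.
exists (K * 2 `^ p) => [|r N r01 rN]; first by rewrite mulr_ge0 ?powR_ge0.
have /andP[r0 r1] := r01.
pose X : R := 2 * (2 ^+ N / b ^+ N).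
have q0 : 0 <= 2 ^+ N / b ^+ N :> R by rewrite divr_ge0 ?exprn_ge0// ltW.
have X0 : 0 <= X by rewrite mulr_ge0.
have -> : K * 2 `^ p * (2 ^+ N / b ^+ N) `^ p = K * X `^ p by rewrite /X (@powRM R 2 _ p (ler0n R 2) q0) mulrA.
pose x j : R := if j == N then X else 0.
have x0 j : 0 <= x j by rewrite /x; case: ifP.
apply: (hK _ x) => //.
- by apply: (measurable_normc_taylor (geom_taylor r01)) => w.
- by move=> w _; exact: normc_ge0.
- move=> n; suff -> : \sum_(0 <= j < n) x j `^ p = if (N < n)%N then X `^ p else 0.
    by case: ifP => // _; exact: powR_ge0.
  have xE j : x j `^ p = if j == N then X `^ p else 0.
    by rewrite /x; case: ifP => // _; rewrite powR0// gt_eqF.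
  elim: n => [|n IH]; first by rewrite big_geq.
  rewrite big_nat_recr//= IH xE ltnS (leq_eqVlt N n) (eq_sym n N).
  by have [->|_] := eqVneq N n; rewrite ?ltnn ?add0r ?addr0.
move=> w i wU wi.
apply: (@le_trans _ _ (x N * b ^+ N * 2^-1 ^+ N * 2 ^+ minn i N)%:E); last first.
  apply: (@nneseries_term_le R (fun j => (x j * b ^+ j * 2^-1 ^+ j * 2 ^+ minn i j)%:E) N) => n.
  by rewrite lee_fin !mulr_ge0 ?exprn_ge0 ?invr_ge0// ltW.
rewrite lee_fin /x eqxx /X.
have -> : 2 * (2 ^+ N / b ^+ N) * b ^+ N * 2^-1 ^+ N * 2 ^+ minn i N =
    2 * 2 ^+ minn i N :> R.
  rewrite (mulrA 2) divfK ?expf_neq0 ?gt_eqF//.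
  by rewrite -(mulrA 2) -exprMn mulfV ?pnatr_eq0// expr1n mulr1.
rewrite /geom normcV; apply: normc_1BM_ge => //.
by rewrite r0 ltW.
Qed.

Variable mu : {finite_measure set R -> \bar R}.
Local Notation I01 := (`[(0:R), (1:R)[%classic : set R).

Let mI : measurable I01.
Proof. exact: measurable_itv. Qed.

Let m (r : R) : R := fine (mu `[r, 1[%classic).

Let mE (r : R) : (mu `[r, 1%R[%classic = (m r)%:E)%E.
Proof. by rewrite /m fineK// fin_num_measure. Qed.

Let m0 r : 0 <= m r.
Proof. exact: fine_ge0. Qed.

Lemma moment_ge (r : R) n : 0 <= r -> r ^+ n * m r <= moment mu n.
Proof.
move=> r0; have mr : measurable (`[r, 1[%classic : set R) by exact: measurable_itv.
have rn0 : 0 <= r ^+ n by exact: exprn_ge0.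
rewrite -lee_fin moment_EFin EFinM -mE -(integral_cst mu mr (r ^+ n)%:E).
have mX (D : set R) : measurable_fun D (fun t : R => t ^+ n) by exact: measurable_funX.
apply: (@le_trans _ _ (\int[mu]_(t in `[r, 1%R[) (t ^+ n)%:E)%E).
  apply: int_le => //.
  by move=> t /=; rewrite in_itv /= => /andP[rt _]; rewrite lerXn2r ?nnegrE// (le_trans r0).
apply: int_subset => //.
  by move=> t /=; rewrite !in_itv /= => /andP[rt ->]; rewrite (le_trans r0).
by move=> t /=; rewrite in_itv /= => /andP[t0 _]; exact: exprn_ge0.
Qed.

Lemma moment_ge0 n : 0 <= moment mu n.
Proof. by apply: le_trans (moment_ge n (lexx 0)); rewrite mulr_ge0 ?exprn_ge0. Qed.

(** All terms are nonnegative, so truncating both series at N only decreases the real parts. After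
    the lower bound on mu_(n+k) the truncated double sum factors, whence the square. *)
Lemma hilbert_geom_ge (r : R) N : 0 <= r < 1 -> hilbert_well_defined mu (geom_coef r) ->
  m r * (\sum_(0 <= k < N) (r ^+ 2) ^+ k) ^+ 2 <=
  complex.Re (hilbert_op mu (geom_coef r) r%:C%C).
Proof.
move=> r01 [wd1 wd2 _]; have /andP[r0 r1] := r01.
set a := geom_coef r in wd1 wd2 *.
set G := \sum_(0 <= k < N) (r ^+ 2) ^+ k.
have G0 : 0 <= G by apply: sumr_ge0 => k _; rewrite exprn_ge0// sqr_ge0.
have ReI n K : complex.Re (hilbert_inner mu a n K) =
    \sum_(0 <= k < K) moment mu (n + k) * r ^+ k.
  rewrite /hilbert_inner /series /= Re_sum; apply: eq_bigr => k _.
  by rewrite /a /geom_coef Re_mulr_real.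
have t0 n k : 0 <= moment mu (n + k) * r ^+ k by rewrite mulr_ge0 ?moment_ge0 ?exprn_ge0.
have c0 n : 0 <= complex.Re (hilbert_coef mu a n).
  apply: (cvgc_Re_ge (wd1 n)); exists 0%N => K _; rewrite ReI.
  exact: sumr_ge0.
have cG n : r ^+ n * m r * G <= complex.Re (hilbert_coef mu a n).
  apply: (cvgc_Re_ge (wd1 n)); exists N => K NK; rewrite ReI.
  rewrite (big_cat_nat (n := N))//=; apply: (@le_trans _ _ (\sum_(0 <= k < N) moment mu (n + k) * r ^+ k)).
    rewrite /G mulr_sumr; apply: ler_sum => k _.
    have -> : r ^+ n * m r * (r ^+ 2) ^+ k = r ^+ (n + k) * m r * r ^+ k.
      by rewrite -exprM mulnC exprM exprD expr2; ring.
    by rewrite ler_wpM2r ?exprn_ge0// moment_ge.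
  by rewrite lerDl; exact: sumr_ge0.
have rd : disc (r%:C%C : R[i]^o) by exact: disc_real.
apply: (cvgc_Re_ge (wd2 _ rd)); exists N => K NK.
have ReK : complex.Re (power_series (hilbert_coef mu a) r%:C%C K) =
    \sum_(0 <= n < K) complex.Re (hilbert_coef mu a n) * r ^+ n.
  rewrite power_seriesE Re_sum; apply: eq_bigr => n _.
  by rewrite -rmorphXn Re_mulr_real.
rewrite ReK (big_cat_nat (n := N))//=.
apply: (@le_trans _ _ (\sum_(0 <= n < N) complex.Re (hilbert_coef mu a n) * r ^+ n)).
  have -> : m r * G ^+ 2 = \sum_(0 <= n < N) (r ^+ 2) ^+ n * (m r * G).
    by rewrite -mulr_suml -/G; ring.
  apply: ler_sum => n _.
  have -> : (r ^+ 2) ^+ n * (m r * G) = r ^+ n * m r * G * r ^+ n.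
    by rewrite -exprM mulnC exprM expr2; ring.
  by rewrite ler_wpM2r ?exprn_ge0.
by rewrite lerDl; apply: sumr_ge0 => n _; rewrite mulr_ge0 ?exprn_ge0.
Qed.

(** For r^(2 N) < 1 / 2 the sum is at least 1 / (2 (1 - r^2)), and 1 - r^2 <= 2 (1 - r). *)
Lemma geom_sum_half (r : R) : 0 <= r < 1 -> exists N,
  (4 * (1 - r))^-1 <= \sum_(0 <= k < N) (r ^+ 2) ^+ k.
Proof.
move=> /andP[r0 r1]; set x := r ^+ 2.
have x0 : 0 <= x by exact: sqr_ge0.
have x1 : x < 1 by rewrite exprn_ilt1.
have u0 : 0 < 1 - r by rewrite subr_gt0.
have v0 : 0 < 1 - x by rewrite subr_gt0.
have h2 : (0 : R) < 2^-1 by rewrite invr_gt0.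
have [N hN] := expr_small x0 x1 h2; exists N.
have := hN N (leqnn N) => xN.
have e : (\sum_(0 <= k < N) x ^+ k) * (1 - x) = 1 - x ^+ N.
  by rewrite big_mkord; have := subrX1 x N => e1; rewrite -(opprB (x ^+ N)) e1; ring.
have ux : 1 - x <= 2 * (1 - r).
  have -> : 1 - x = (1 + r) * (1 - r) by rewrite /x; ring.
  by rewrite ler_wpM2r ?(ltW u0)//; lra.
rewrite -(ler_pM2r v0) e.
have : (4 * (1 - r))^-1 * (1 - x) <= 2^-1; last by lra.
by rewrite mulrC ler_pdivrMr ?mulr_gt0//; lra.
Qed.

(** The test function contributes (2 / b)^N, the growth estimate at r contributes b^(N+1), and 2^N
    (1 - r) <= 1. What remains of |H f(r)| (1 - r) is a constant times b, bounded by the 2 in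
    [L]. *)
Lemma carleson_of_bounded (K : R) : 0 <= K ->
  (forall r, 0 <= r < 1 -> hilbert_well_defined mu (geom_coef r)) ->
  (forall (r M : R), 0 <= r < 1 -> (bint (geom r) <= M%:E)%E ->
     (bint (hilbert_op mu (geom_coef r)) <= (K * M)%:E)%E) ->
  carleson mu.
Proof.
move=> K0 wd bd.
have [K1 K10 hK1] := geom_int_le.
have [K2 K20 hK2] := growth_le_powR alpha_gt alpha_lt.
pose L := (K2 * (K * K1)) `^ p^-1 * 2; have L0 : 0 <= L by rewrite mulr_ge0 ?powR_ge0.
(* 16 is the square of the 4 in [geom_sum_half]; the added 1 makes the constant positive, as
   [carleson] demands. *)
exists (16 * L + 1) => [|r r01].
  by rewrite ltr_wpDl// mulr_ge0.
have /andP[r0 r1] := r01; have u0 : 0 < 1 - r by rewrite subr_gt0.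
have u1 : 1 - r <= 1 by rewrite lerBlDr lerDl.
have [N [N1 N2]] := dyadic_exists u0 u1; rewrite !mul1r in N1 N2.
have bN0 n : 0 < b ^+ n by rewrite exprn_gt0.
have e0 n : (0 : R) < 2^-1 ^+ n by rewrite exprn_gt0// invr_gt0.
have q0 : 0 <= 2 ^+ N / b ^+ N :> R by rewrite divr_ge0 ?exprn_ge0// ltW.
have gt : taylor_expansion (hilbert_op mu (geom_coef r)) (hilbert_coef mu (geom_coef r)).
  by move=> z zd; have [_ h _] := wd r r01; exact: h.
have rd : disc (r%:C%C : R[i]^o) by exact: disc_real.
have := hK2 _ _ _ _ gt (bd _ _ r01 (hK1 r N r01 N1)) rd.
have nr : normc (r%:C%C : R[i]) = r by rewrite normc_real ger0_norm.
rewrite nr; set g := normc _ => hg.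
have hb : (1 - r) `^ (- ((alpha + 2) / p)) <= b ^+ N.+1.
  have -> : b ^+ N.+1 = ((2^-1 ^+ N.+1) `^ ((alpha + 2) / p))^-1.
    rewrite powR_expr ?invr_ge0// /growth.
    by rewrite -[2^-1](powR_inv1 (ler0n R 2)) -powRrM mulN1r powRN exprVn invrK.
  rewrite powRN lef_pV2 ?posrE ?powR_gt0//.
  apply: ge0_ler_powR; rewrite ?nnegrE ?(ltW u0) ?(ltW (e0 _))//.
  by rewrite divr_ge0 ?(ltW p0)//; move: alpha_gt; lra.
have gL : g * (1 - r) <= L.
  have e1 : (K2 * (K * (K1 * (2 ^+ N / b ^+ N) `^ p))) `^ p^-1 =
      (K2 * (K * K1)) `^ p^-1 * (2 ^+ N / b ^+ N).
    have -> : K2 * (K * (K1 * (2 ^+ N / b ^+ N) `^ p)) =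
       K2 * (K * K1) * (2 ^+ N / b ^+ N) `^ p by ring.
    by rewrite powRM ?powR_ge0 ?mulr_ge0// powRKV.
  rewrite e1 in hg.
  have e2 : g <= (K2 * (K * K1)) `^ p^-1 * (2 ^+ N / b ^+ N) * b ^+ N.+1.
    by apply: le_trans hg _; rewrite ler_wpM2l// mulr_ge0 ?powR_ge0.
  have e3 : (K2 * (K * K1)) `^ p^-1 * (2 ^+ N / b ^+ N) * b ^+ N.+1 =
      (K2 * (K * K1)) `^ p^-1 * b * 2 ^+ N.
    by rewrite exprS; field; rewrite expf_neq0// gt_eqF.
  rewrite e3 in e2.
  have e4 : 2 ^+ N * (1 - r) <= 1.
    apply: le_trans (ler_wpM2l _ N2) _; first exact: exprn_ge0.
    by rewrite -exprMn mulfV ?pnatr_eq0// expr1n.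
  apply: le_trans (ler_wpM2r (ltW u0) e2) _.
  rewrite -[leLHS]mulrA /L; apply: (@le_trans _ _ ((K2 * (K * K1)) `^ p^-1 * b * 1)).
    by rewrite ler_wpM2l// mulr_ge0 ?powR_ge0// ltW.
  by rewrite mulr1 ler_wpM2l ?powR_ge0// ltW.
have [N' hN'] := geom_sum_half r01.
have lowm := hilbert_geom_ge N' r01 (wd r r01).
set G := \sum_(0 <= k < N') _ in lowm hN'.
have v0 : 0 < (4 * (1 - r))^-1 by rewrite invr_gt0 mulr_gt0.
have h3 : m r * ((4 * (1 - r))^-1) ^+ 2 <= g.
  apply: (@le_trans _ _ (m r * G ^+ 2)).
    by rewrite ler_wpM2l// lerXn2r ?nnegrE ?(ltW v0)// (le_trans (ltW v0)).
  by apply: le_trans lowm _; exact: le_trans (ler_norm _) (ler_Re_normc _).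
rewrite mE lee_fin.
have h4 : m r <= g * (4 * (1 - r)) ^+ 2.
  by rewrite -ler_pdivrMr ?exprn_gt0 ?mulr_gt0// -exprVn.
apply: le_trans h4 _.
have -> : g * (4 * (1 - r)) ^+ 2 = 16 * (g * (1 - r)) * (1 - r) by ring.
rewrite ler_wpM2r ?(ltW u0)//; lra.
Qed.

End Necessity.

(** * From integrals to norms *)

Section BergmanNorm.
Variables (R : realType) (p alpha : R).
Hypotheses (alpha_gt : -1 < alpha) (p0 : 0 < p).
Local Notation bint f := (bergman_int p alpha (fun w => normc (f (cpt w)))).

Definition norm_const : R := (alpha + 1) * pi^-1.

Lemma norm_const_gt0 : 0 < norm_const.
Proof. by rewrite mulr_gt0 ?invr_gt0 ?pi_gt0//; move: alpha_gt => *; lra. Qed.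

(** The domain, the weight and the measure agree by unfolding with those of [bergman_norm]; only the
    two constants are regrouped. *)
Lemma bergman_normE (f : R[i]^o -> R[i]^o) :
  bergman_norm p alpha f = poweR (norm_const%:E * bint f)%E p^-1.
Proof. by rewrite /norm_const EFinM -muleA. Qed.

Lemma bergman_int_ge0 (f : R[i]^o -> R[i]^o) : (0 <= bint f)%E.
Proof. by apply: integral_ge0 => w _; rewrite lee_fin mulr_ge0 ?powR_ge0. Qed.

Lemma bergman_norm_fin (f : R[i]^o -> R[i]^o) (v : R) : bint f = v%:E ->
  bergman_norm p alpha f = ((norm_const * v) `^ p^-1)%:E.
Proof. by rewrite bergman_normE => ->. Qed.

Lemma bergman_int_fin (f : R[i]^o -> R[i]^o) : (bergman_norm p alpha f < +oo)%E ->
  exists2 v : R, 0 <= v & bint f = v%:E.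
Proof.
move=> h; have b0 := bergman_int_ge0 f.
have [bf|] := boolP (bint f \is a fin_num).
  by exists (fine (bint f)); rewrite ?fineK// fine_ge0.
rewrite ge0_fin_numE// -leNgt leye_eq => /eqP e; move: h.
by rewrite bergman_normE e gt0_muley ?lte_fin ?norm_const_gt0//= gt_eqF ?invr_gt0.
Qed.

(** The positive factor [norm_const] is common to both sides and the p-th root is increasing. This
    lets each direction of the theorem work with integrals only. *)
Lemma bergman_norm_le (f g : R[i]^o -> R[i]^o) (u v C : R) : 0 <= u -> 0 <= v -> 0 <= C ->
  bint f = u%:E -> bint g = v%:E ->
  (bergman_norm p alpha g <= C%:E * bergman_norm p alpha f)%E <-> v <= C `^ p * u.
Proof.
move=> u0 v0 C0 /bergman_norm_fin -> /bergman_norm_fin ->.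
have k0 := norm_const_gt0.
have ku : 0 <= norm_const * u by rewrite mulr_ge0// ltW.
have kv : 0 <= norm_const * v by rewrite mulr_ge0// ltW.
rewrite -EFinM lee_fin.
have e : C * (norm_const * u) `^ p^-1 = (norm_const * (C `^ p * u)) `^ p^-1.
  by rewrite mulrCA (powRM _ (powR_ge0 C p) ku) powRKV.
have kC : 0 <= norm_const * (C `^ p * u) by rewrite mulr_ge0 ?(ltW k0)// mulr_ge0 ?powR_ge0.
have pV : 0 < p^-1 by rewrite invr_gt0.
rewrite e; split=> [/(powR_le_cancel pV kv kC)|h]; first by rewrite ler_pM2l.
by apply: ge0_ler_powR; rewrite ?nnegrE ?(ltW pV)// ler_pM2l.
Qed.

End BergmanNorm.

Theorem theorem4 (R : realType) (p alpha : R)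
    (mu : {finite_measure set R -> \bar R})
    (mu_on_01 : mu (~` `[0, 1[) = 0%E)
    (alpha_gt : -1 < alpha) (alpha_lt : alpha < p - 2) :
  (hilbert_well_defined_on_bergman mu p alpha /\
   hilbert_bounded_on_bergman mu p alpha)
  <-> carleson mu.
Proof.
have p0 : 0 < p by lra.
split=> [[wd [C C0 bd]]|car].
  have [K1 K10 hK1] := geom_int_le alpha_gt alpha_lt.
  have geomB r : 0 <= r < 1 -> bergman p alpha (geom r).
    move=> r01; split; first exact: geom_analytic.
    have /andP[r0 r1] := r01; have u0 : 0 < 1 - r by rewrite subr_gt0.
    have u1 : 1 - r <= 1 by rewrite lerBlDr lerDl.
    have [N [N1 _]] := dyadic_exists u0 u1; rewrite mul1r in N1.
    rewrite bergman_normE; apply: poweR_lty.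
    apply: lte_mul_pinfty; rewrite ?lee_fin ?ltW ?norm_const_gt0//.
    exact: le_lt_trans (hK1 r N r01 N1) (ltry _).
  (* Integrals scale with the p-th power of the norm, hence the power p of [C]. *)
  apply: (carleson_of_bounded alpha_gt alpha_lt (powR_ge0 C p)).
    by move=> r r01; apply: wd (geomB r r01) (geom_taylor r01).
  move=> r M r01 hM; have gB := geomB r r01.
  have [hB hle] := bd _ _ gB (geom_taylor r01).
  have [u u0 eu] := bergman_int_fin alpha_gt p0 gB.2.
  have [v v0 ev] := bergman_int_fin alpha_gt p0 hB.2.
  have := (bergman_norm_le alpha_gt p0 u0 v0 C0 eu ev).1 hle => hv.
  rewrite ev lee_fin; apply: le_trans hv _; rewrite ler_wpM2l ?powR_ge0//.
  by rewrite -lee_fin -eu.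
have [K K0 hK] := hilbert_bergman_int_le alpha_gt alpha_lt car.
have key f a : bergman p alpha f -> taylor_expansion f a ->
    exists A c : R, [/\ 0 <= A, 0 <= c, c < 1 &
    forall k, normc (\sum_(0 <= i < k) a i) <= A * k%:R `^ c].
  move=> fB fa; have [u u0 eu] := bergman_int_fin alpha_gt p0 fB.2.
  by apply: (carleson_summable alpha_gt alpha_lt fa (M := u)); rewrite eu.
split=> [f a fB fa|].
  have [A [c [A0 c0 c1 hA]]] := key f a fB fa.
  exact: (hilbert_well_defined_carleson car A0 c0 c1 hA).
(* The reverse passage: a factor K on integrals is its p-th root on norms. *)
exists (K `^ p^-1) => [|f a fB fa]; first exact: powR_ge0.
have [A [c [A0 c0 c1 hA]]] := key f a fB fa.
have [u u0 eu] := bergman_int_fin alpha_gt p0 fB.2.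
have fle : (bergman_int p alpha (fun w => normc (f (cpt w))) <= u%:E)%E by rewrite eu.
have hle := hK f a u fa fle.
have hfin : (bergman_norm p alpha (hilbert_op mu a) < +oo)%E.
  rewrite bergman_normE; apply: poweR_lty.
  apply: lte_mul_pinfty; rewrite ?lee_fin ?ltW ?norm_const_gt0//.
  exact: le_lt_trans hle (ltry _).
split; first exact: (conj (hilbert_op_analytic car A0 c0 c1 hA) hfin).
have [v v0 ev] := bergman_int_fin alpha_gt p0 hfin.
apply/(bergman_norm_le alpha_gt p0 u0 v0 (powR_ge0 _ _) eu ev).
by rewrite powRVK// -lee_fin -ev.
Qed.
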